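(* Consider the second price auction with a profit only sharing contract (POSC) and weakly risk averse buyers, with $s$ and the revenues as defined in the context. Then: (i) The seller's expected revenue from the auction stage, $\mathbb{E}[s(\alpha,Z_1,Z_1)\mid Y_1>Z_1]$ (possibly negative), is decreasing in the share fraction $\alpha\in[0,1)$, while the expected revenue from the POSC stage, $\mathbb{E}[\alpha[X_1-s(\alpha,Z_1,Z_1)]^+\mid Y_1>Z_1]$, is positive for $\alpha\in(0,1)$ and increasing in $\alpha\in[0,1)$. (ii) The seller's expected total revenue $$R^{posc}_{sp}(\alpha)=\mathbb{E}\big[s(\alpha,Z_1,Z_1)+\alpha[X_1-s(\alpha,Z_1,Z_1)]^+\,\big|\,Y_1>Z_1\big]$$ is positive and nondecreasing in $\alpha$: for any $0\le\alpha<\widehat\alpha<1$, $R^{posc}_{sp}(\widehat\alpha)\ge R^{posc}_{sp}(\alpha)>0$. In particular, the expected total revenue is at least the expected revenue $R^{posc}_{sp}(0)$ from the second price auction with only a one-time payment.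
   Context: ''Increasing'' and ''decreasing'' mean strictly so; $[a]^+=\max\{0,a\}$. There are $N\ge 2$ buyers. Real random variables $X_n$ (value of the resource to buyer $n$, possibly negative) and $Y_n$ (signal observed only by buyer $n$), $1\le n\le N$, have a commonly known joint law; $\mathbf{Y}=(Y_1,\dots,Y_N)$ and $\mathbf{Y}_{-n}$ is $\mathbf{Y}$ without the $n$-th entry. Symmetry: the joint CDF of $(X_n,Y_n,\mathbf{Y}_{-n})$ is the same for every $n$ and symmetric in the last $N-1$ components. Each $Y_n$ takes values in an interval $\mathcal{I}_Y\subset\mathbb{R}$; $\mathbf{Y}$ has a joint density that is positive on all of $\mathcal{I}_Y^N$ ($(X_n,\mathbf{Y})$ need not have a density). Positive dependence: for any increasing $h:\mathbb{R}\to\mathbb{R}$ and $a_n\le b_n$ in $\mathcal{I}_Y$, $\mathbb{E}[h(X_1)\mid Y_1\in[a_1,b_1],\dots,Y_N\in[a_N,b_N]]$ is increasing in $a_1$ and $b_1$ and nondecreasing in $a_n,b_n$ for $n\ge2$, whenever it exists ($a_n=b_n$ means conditioning on $Y_n=a_n$). Weakly risk averse buyers: all buyers have the same utility of money $u:\mathbb{R}\to\mathbb{R}$, concave (possibly linear), increasing, $u(0)=0$. All expectations and conditional expectations of interest exist and are finite, and $\mathbb{E}[u(X_1)\mid\mathbf{Y}=\mathbf{y}]>0$ for all $\mathbf{y}\in\mathcal{I}_Y^N$. The seller is risk neutral. $Z_1=\max\{Y_2,\dots,Y_N\}$. For $\alpha\in[0,1)$ and $y_1,z_1\in\mathcal{I}_Y$,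 $s(\alpha,y_1,z_1)$ is the unique $b$ with $\mathbb{E}[u(X_1-b-\alpha[X_1-b]^+)\mid Y_1=y_1,Z_1=z_1]=0$. Second price auction with the POSC determined by $\alpha$: the highest bidder wins and pays the second highest bid $b$ (bids may be negative); when his value $x$ is revealed he additionally pays $\alpha[x-b]^+$. Revenues are evaluated at the symmetric equilibrium in which each buyer $n$ bids $s(\alpha,Y_n,Y_n)$; by symmetry they equal buyer 1's expected payments conditional on winning ($Y_1>Z_1$). $\alpha=0$ is the auction with only a one-time payment.
   Formalization: Auction-stage revenue is nonincreasing in general, and strictly decreasing unless, for almost every winning z, X_1 is a.s. constant given Y_1=Z_1=z; strictness fails otherwise, e.g. for private values X_n=Y_n i.i.d. uniform on (1,2), where bids do not depend on α. *)

(* Defs.v *)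
From HB Require Import structures.
From mathcomp Require Import all_boot all_order all_algebra all_fingroup.
From mathcomp Require Import all_classical all_reals all_analysis.

Set Implicit Arguments.
Unset Strict Implicit.
Unset Printing Implicit Defensive.

Import Order.TTheory GRing.Theory Num.Theory.
Import numFieldNormedType.Exports.

Local Open Scope classical_set_scope.
Local Open Scope ring_scope.

(* There are N = n.+2 buyers, so that N >= 2; buyer 1 is ord0 : 'I_n.+2. *)

Section IteratedIntegral.
Context {R : realType}.

(* Integration over one coordinate constrained to the interval D: Lebesgue
   integration, except that a one-point D = {a} stands for conditioning on the
   value a, i.e. for evaluation at a. *)
Definition coord_integral (D : set R) (F : R -> \bar R) : \bar R :=
  if `[< D = [set xget 0 D] >] then F (xget 0 D)
  else (\int[lebesgue_measure]_(t in D) F t)%E.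

Fixpoint iterated_integral (N : nat) :
    ('I_N -> set R) -> (N.-tuple R -> \bar R) -> \bar R :=
  match N with
  | 0 => fun _ F => F [tuple]
  | m.+1 => fun D F =>
      coord_integral (D ord0) (fun t =>
        iterated_integral (fun i : 'I_m => D (lift ord0 i))
          (fun v => F (cons_tuple t v)))
  end.

End IteratedIntegral.

Section Conditioning.
Context {R : realType}.

(* M stands for an unnormalized conditional law of a real random variable, given
   through the integrals M phi of nonnegative functions phi; cond_mean M g is the
   conditional expectation of g, where g is split into its positive and negative
   parts. *)
Definition cond_mean_exists (M : (R -> R) -> \bar R) (g : R -> R) : Prop :=
  [/\ (0 < M (fun=> 1%R))%E, (M (fun=> 1%R) < +oo)%E &
      (M (fun x => `|g x|%R) < +oo)%E].

Definition cond_mean (M : (R -> R) -> \bar R) (g : R -> R) : R :=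
  (fine (M (fun x => Num.max (g x) 0)) - fine (M (fun x => Num.max (- g x) 0)))
  / fine (M (fun=> 1)).

Context {N : nat}.
Variables (f : N.-tuple R -> R)
  (Q : R.-pker (N.-tuple (measurableTypeR R)) ~> (measurableTypeR R)).

(* f is the joint density of Y, and Q y the conditional law of X_1 given Y = y.
   The conditional law of X_1 given that Y_i \in D i for all i is proportional to
   the integral of f(y) Q_y over the product of the D i, Dirac on the coordinates
   where D i is a point. *)
Definition box_law (D : 'I_N -> set R) (phi : R -> R) : \bar R :=
  iterated_integral D
    (fun y => ((f y)%:E * \int[Q y]_x (phi x)%:E)%E).

Definition closed_box (a b : 'I_N -> R) : 'I_N -> set R :=
  fun i => `[a i, b i]%classic.

Definition box_in (I : set R) (a b : 'I_N -> R) : Prop :=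
  forall i, [/\ I (a i), I (b i) & a i <= b i].

End Conditioning.

Section Signals.
Context {R : realType} {n : nat}.
Variables (I : set R) (f : n.+2.-tuple R -> R)
  (Q : R.-pker (n.+2.-tuple (measurableTypeR R)) ~> (measurableTypeR R)).

(* Increasing in the endpoints a_1, b_1 and nondecreasing in the other a_i, b_i,
   compared in the product order, so that a point y_i = a_i = b_i can be moved
   as a whole. *)
Definition positive_dependence : Prop :=
  forall h : R -> R, {homo h : x y / x < y} ->
  forall a b a' b' : 'I_n.+2 -> R,
    box_in I a b -> box_in I a' b' ->
    (forall i, a i <= a' i) -> (forall i, b i <= b' i) ->
    cond_mean_exists (box_law f Q (closed_box a b)) h ->
    cond_mean_exists (box_law f Q (closed_box a' b')) h ->
    cond_mean (box_law f Q (closed_box a b)) h <=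
      cond_mean (box_law f Q (closed_box a' b')) h /\
    (a ord0 < a' ord0 \/ b ord0 < b' ord0 ->
     cond_mean (box_law f Q (closed_box a b)) h <
      cond_mean (box_law f Q (closed_box a' b')) h).

(* Z_1 = max_{k >= 2} Y_k takes the value z1 when some Y_k is z1 and the other
   Y_j, j >= 2, are at most z1. Summing over k gives the conditional law of X_1
   given Y_1 = y1 and Z_1 = z1. This is defined for all y1 and z1, in particular
   on the null set y1 = z1, where the equilibrium bids are computed. *)
Definition top_signal_box (y1 z1 : R) (k : 'I_n.+2) : 'I_n.+2 -> set R :=
  fun i => if i == ord0 then [set y1]
           else if i == k then [set z1]
           else I `&` `]-oo, z1].

Definition signal_law (y1 z1 : R) (phi : R -> R) : \bar R :=
  (\sum_(k < n.+2 | k != ord0) box_law f Q (top_signal_box y1 z1 k) phi)%E.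

(* Conditionally on Y_1 = Z_1 = z, X_1 is a constant c. The bid s alpha z z is then c
   for every alpha; with private values X_n = Y_n this happens at every z. *)
Definition value_revealed (z : R) : Prop :=
  exists c : R, signal_law z z (\1_(~` [set c])) = 0%E.

End Signals.

Section Auction.
Context {R : realType}.

Definition pos_part (a : R) : R := Num.max 0 a.

Definition concave (u : R -> R) : Prop :=
  forall x y t : R, 0 <= t <= 1 ->
    t * u x + (1 - t) * u y <= u (t * x + (1 - t) * y).

(* Net gain of a winner with value x who pays b and then shares his profit. *)
Definition net_gain (alpha b x : R) : R := x - b - alpha * pos_part (x - b).

Definition is_bid_function {n : nat} (I : set R) (f : n.+2.-tuple R -> R)
    (Q : R.-pker (n.+2.-tuple (measurableTypeR R)) ~> (measurableTypeR R))
    (u : R -> R) (s : R -> R -> R -> R) : Prop :=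
  forall alpha y1 z1 : R, 0 <= alpha < 1 -> I y1 -> I z1 ->
  forall b : R,
    cond_mean (signal_law I f Q y1 z1) (fun x => u (net_gain alpha b x)) = 0 <->
    b = s alpha y1 z1.

End Auction.

Section Model.
Context {R : realType} {n : nat} {d : measure_display} {T : measurableType d}.
Variables (P : probability T R) (X Y : 'I_n.+2 -> {RV P >-> R}).

Definition signal_vector (w : T) : n.+2.-tuple R := [tuple Y i w | i < n.+2].

(* The permutations fixing ord0 give the symmetry in the last N - 1 components of
   the CDF of (X_n, Y_n, Y_{-n}); the others give its independence of n. *)
Definition symmetric_model : Prop :=
  forall (sigma : {perm 'I_n.+2}) (x : R) (y : 'I_n.+2 -> R),
    P [set w | X (sigma ord0) w <= x /\ forall i, Y (sigma i) w <= y i] =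
    P [set w | X ord0 w <= x /\ forall i, Y i w <= y i].

Definition is_joint_density (f : n.+2.-tuple R -> R) : Prop :=
  [/\ measurable_fun setT (f : n.+2.-tuple (measurableTypeR R) -> R),
      forall y, 0 <= f y &
      forall B : set (n.+2.-tuple (measurableTypeR R)), measurable B ->
        P (signal_vector @^-1` B) =
        iterated_integral (fun=> setT) (fun y => (f y * \1_B y)%:E)].

Definition is_cond_law
    (Q : R.-pker (n.+2.-tuple (measurableTypeR R)) ~> (measurableTypeR R)) : Prop :=
  forall (A : set (measurableTypeR R)) (B : set (n.+2.-tuple (measurableTypeR R))),
    measurable A -> measurable B ->
    P (X ord0 @^-1` A `&` signal_vector @^-1` B) =
    (\int[P]_(w in signal_vector @^-1` B) Q (signal_vector w) A)%E.

Definition Z1 (w : T) : R :=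
  \big[Num.max/Y (lift ord0 ord0) w]_(i < n.+2 | i != ord0) Y i w.

Definition win : set T := [set w | Z1 w < Y ord0 w].

Definition mean_if_win (g : T -> R) : R :=
  fine (\int[P]_(w in win) (g w)%:E)%E / fine (P win).

Variable s : R -> R -> R -> R.

Definition price (alpha : R) (w : T) : R := s alpha (Z1 w) (Z1 w).

Definition share (alpha : R) (w : T) : R :=
  alpha * pos_part (X ord0 w - price alpha w).

Definition auction_revenue (alpha : R) : R := mean_if_win (price alpha).

Definition posc_revenue (alpha : R) : R := mean_if_win (share alpha).

Definition total_revenue (alpha : R) : R :=
  mean_if_win (fun w => price alpha w + share alpha w).

End Model.

(* Main.v *)
(** Let M_z be the conditional law of X_1 given Y_1 = Z_1 = z and p_a(z) = s(a, z, z).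

    Positive dependence compares means over boxes of signals. By symmetry each slice
    {Y_1 = z, Y_k = z, Y_j <= z} making up M_z is a limit of boxes which, after a
    permutation of the signals of the competitors, lie below any given box where Y_1
    and some competitor are at least z. Hence M_z is stochastically dominated by the
    law of X_1 on such a box, and by M_z' when z < z', so that p_a is nondecreasing.

    For a < a' put p = p_a(z), p' = p_a'(z) and
    g(x) = a' [x - p']^+ - a [x - p]^+. Then p' <= p and g is nondecreasing. The expected
    utilities of the two net gains vanish under M_z, and their difference is at most
    m (g - (p - p')), where m is the slope of a supergradient of u at the point where the two
    net gains agree; so p - p' <= E[g] under M_z. By dominance this passes to every box
    above z. Summing over the cells a_j <= Z_1 < a_(j+1) <= Y_1 of a grid and refining the
    grid, which is legitimate because p_a has countably many jumps and Z_1 has no atom,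
    shows that the total revenue is nondecreasing. Working with cells avoids
    conditioning X_1 on the exact values of Y_1 and Z_1 off the diagonal. *)

From HB Require Import structures.
Require Import Defs.
From mathcomp Require Import all_boot all_order all_algebra all_fingroup.
From mathcomp Require Import all_classical all_reals all_analysis.
From mathcomp Require Import measurable_realfun ring lra.
From mathcomp Require finmap.
Set Implicit Arguments.
Unset Strict Implicit.
Unset Printing Implicit Defensive.
Import Order.TTheory GRing.Theory Num.Theory.
Import numFieldNormedType.Exports.
Local Open Scope classical_set_scope.
Local Open Scope ring_scope.

(** * Iterated integrals and conditional laws on boxes *)

Section IteratedIntegral.
Context {R : realType}.
Notation mR := (measurableTypeR R).

(** The law of the value given Y_1 = Z_1 = z sits on a null event: it depends on the versions [f]
    and [Q], and symmetry, a statement about [P], says nothing about it directly. Signals are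
    therefore permuted only in boxes with nonempty interior, where [box_law] is an integral against
    [P], and positive dependence carries the result to the slices. For the same reason two slices z
    < z' are compared through a full-dimensional box inserted between them. Strictness comes from
    the strict half of positive dependence. If the POSC stage did not strictly gain, the winner's
    value would never exceed the price; near a continuity point z of the bids the null tail of a box
    above z passes down to M_z. With zero expected utility and no gain, M_z is then a point mass at
    the bid, and moving y_1 up from z could not raise the conditional mean. Auction revenue has no
    such argument: equal bids for two shares only force the value to be revealed at z, hence the
    extra condition in its strict form. Positivity of the total revenue starts at share 0, where
    bids are positive because the expected utility of the value is. *)

Definition is_point (D : set R) := exists a, D = [set a].

Lemma not_point (D : set R) x y : D x -> D y -> x != y -> ~ is_point D.
Proof. by move=> Dx Dy /eqP xy [a aE]; apply: xy; move: Dx Dy; rewrite aE => -> ->. Qed.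

Lemma coord_integral_point (a : R) (F : R -> \bar R) :
  coord_integral [set a] F = F a.
Proof.
have xa : xget 0 [set a] = a by apply: xget_unique.
by rewrite /coord_integral xa asboolT.
Qed.

Lemma coord_integral_nonpoint (D : set R) (F : R -> \bar R) :
  ~ is_point D -> coord_integral D F = (\int[lebesgue_measure]_(t in D) F t)%E.
Proof. by move=> nD; rewrite /coord_integral; case: asboolP => // DE; case: nD; exists (xget 0 D). Qed.

Lemma coord_integral_ge0 (D : set mR) (F : R -> \bar R) :
  (forall x, D x -> 0 <= F x)%E -> (0 <= coord_integral D F)%E.
Proof.
move=> F0; have [[a Da]|nD] := pselect (is_point D).
  by subst D; rewrite coord_integral_point; exact: F0.
by rewrite coord_integral_nonpoint//; apply: integral_ge0.
Qed.

Lemma eq_coord_integral (D : set mR) (F G : R -> \bar R) :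
  (forall x, D x -> F x = G x) -> coord_integral D F = coord_integral D G.
Proof.
move=> FG; have [[a Da]|nD] := pselect (is_point D).
  by subst D; rewrite !coord_integral_point; exact: FG.
by rewrite !coord_integral_nonpoint//; apply: eq_integral => x /[!inE]; exact: FG.
Qed.

Definition in_box N (D : 'I_N -> set R) : set (N.-tuple mR) :=
  [set y | forall i, D i (tnth y i)].

Lemma in_box_cons N (D : 'I_N.+1 -> set R) x (v : N.-tuple R) :
  in_box D (cons_tuple x v) <->
  D ord0 x /\ in_box (fun i => D (lift ord0 i)) v.
Proof.
split=> [Dv|[Dx Dv] i].
  split=> [|i]; first by have := Dv ord0; rewrite tnth0.
  by have := Dv (lift ord0 i); rewrite tnthS.
by have [j ->|->] := unliftP ord0 i; rewrite ?tnthS ?tnth0//; exact: Dv.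
Qed.

Lemma measurable_in_box N (D : 'I_N -> set mR) :
  (forall i, measurable (D i)) -> measurable (in_box D).
Proof.
move=> mD; rewrite (_ : in_box D = \bigcap_(i in [set: 'I_N]) ((fun y : N.-tuple mR => tnth y i) @^-1` D i)).
  apply: fin_bigcap_measurable => // i _; rewrite -[X in measurable X]setTI.
  exact: measurable_tnth.
by apply/seteqP; split=> y /= Dy i => [_|]; exact: Dy.
Qed.

Lemma iterated_integral_ge0 N (D : 'I_N -> set mR) (F : N.-tuple R -> \bar R) :
  (forall y, in_box D y -> 0 <= F y)%E -> (0 <= iterated_integral D F)%E.
Proof.
elim: N D F => [|N IH] D F F0 /=; first by apply: F0 => -[].
apply: coord_integral_ge0 => x Dx; apply: IH => v Dv.
by apply: F0; apply/in_box_cons.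
Qed.

Lemma eq_iterated_integral N (D : 'I_N -> set mR) (F G : N.-tuple R -> \bar R) :
  (forall y, in_box D y -> F y = G y) -> iterated_integral D F = iterated_integral D G.
Proof.
elim: N D F G => [|N IH] D F G FG /=; first by apply: FG => -[].
apply: eq_coord_integral => x Dx; apply: IH => v Dv.
by apply: FG; apply/in_box_cons.
Qed.

Lemma measurable_cons_tuple d' (T' : measurableType d') N (f : T' -> mR) (g : T' -> N.-tuple mR) :
  measurable_fun setT f -> measurable_fun setT g ->
  measurable_fun setT (fun x => cons_tuple (f x) (g x) : N.+1.-tuple mR).
Proof.
move=> mf mg; rewrite [X in measurable_fun _ X](_ : _ =
    (fun x => [the N.+1.-tuple mR of f x :: g x])); first exact: measurable_cons.
by apply/funext => x; exact/val_inj.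
Qed.

Lemma measurable_coord_integral d' (T' : measurableType d') (D : set mR)
    (g : T' * mR -> \bar R) :
  measurable D -> measurable_fun setT g -> (forall x, 0 <= g x)%E ->
  measurable_fun setT (fun t => coord_integral D (fun x => g (t, x))).
Proof.
move=> mD mg g0; have [[a Da]|nD] := pselect (is_point D).
  subst D; rewrite [X in measurable_fun _ X](_ : _ = g \o (pair^~ a)).
    by apply: measurableT_comp => //; exact: pair2_measurable.
  by apply/funext => t /=; rewrite coord_integral_point.
(* The indicator of [D] turns the constrained integral into one over the whole line, to which
   Tonelli's theorem applies. *)
pose g' : T' * mR -> \bar R := fun p => (g p * (\1_D p.2)%:E)%E.
have mg' : measurable_fun setT g'.
  apply: emeasurable_funM => //; apply/measurable_EFinP.
  by apply: measurableT_comp => //; exact: measurable_indic.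
have g'0 x : (0 <= g' x)%E by rewrite mule_ge0// lee_fin.
have := @measurable_fun_fubini_tonelli_F _ _ T' mR R lebesgue_measure g' mg' g'0.
congr (measurable_fun _ _); apply/funext => t.
rewrite coord_integral_nonpoint// [RHS]integral_mkcond /fubini_F.
by apply: eq_integral => x _; rewrite patchE /g' /= indicE; case: ifPn => _;
  rewrite ?mule1 ?mule0.
Qed.

(** The parameter space is arbitrary so that the induction can absorb the first coordinate into
    it. *)
Lemma measurable_iterated_integral N d' (T' : measurableType d')
    (D : 'I_N -> set mR) (F : T' * N.-tuple mR -> \bar R) :
  (forall i, measurable (D i)) -> measurable_fun setT F ->
  (forall x, 0 <= F x)%E ->
  measurable_fun setT (fun t => iterated_integral D (fun y => F (t, y))).
Proof.
elim: N d' T' D F => [|N IH] d' T' D F mD mF F0 /=.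
  by apply: (measurableT_comp mF); exact: pair2_measurable.
pose g : T' * mR -> \bar R := fun p => iterated_integral
  (fun i => D (lift ord0 i)) (fun v => F (p.1, cons_tuple p.2 v)).
apply: (@measurable_coord_integral _ _ _ g) => // [|x]; last first.
  by apply: iterated_integral_ge0 => *; exact: F0.
pose F' : (T' * mR) * N.-tuple mR -> \bar R :=
    fun q => F (q.1.1, cons_tuple q.1.2 q.2).
apply: (IH _ _ _ F') => [i||x]; [exact: mD| |exact: F0].
have m11 : measurable_fun setT (fun q : (T' * mR) * N.-tuple mR => q.1.1).
  exact: (measurableT_comp measurable_fst measurable_fst).
have m12 : measurable_fun setT (fun q : (T' * mR) * N.-tuple mR => q.1.2).
  exact: (measurableT_comp measurable_snd measurable_fst).
apply: (measurableT_comp mF); apply: (@measurable_fun_pair _ _ _ _ _ _ (fun q => q.1.1)) => //.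
by apply: measurable_cons_tuple.
Qed.

Lemma measurable_iterated_tail N (D : 'I_N -> set mR) (F : N.+1.-tuple mR -> \bar R) :
  (forall i, measurable (D i)) -> measurable_fun setT F -> (forall y, 0 <= F y)%E ->
  measurable_fun (setT : set mR) (fun t => iterated_integral D (fun v => F (cons_tuple t v))).
Proof.
move=> mD mF F0.
apply: (@measurable_iterated_integral _ _ mR D (fun p => F (cons_tuple p.1 p.2))) => //.
by apply: (measurableT_comp mF); exact: measurable_cons_tuple.
Qed.

Lemma measurable_tail N (F : N.+1.-tuple mR -> \bar R) t : measurable_fun setT F ->
  measurable_fun (setT : set (N.-tuple mR)) (fun v => F (cons_tuple t v)).
Proof. by move=> mF; apply: (measurableT_comp mF); exact: measurable_cons_tuple. Qed.

End IteratedIntegral.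

Section IteratedIntegralTheory.
Context {R : realType}.
Notation mR := (measurableTypeR R).

Lemma le_iterated_integral N (D : 'I_N -> set mR) (F G : N.-tuple mR -> \bar R) :
  (forall i, measurable (D i)) ->
  measurable_fun setT F -> measurable_fun setT G ->
  (forall y, 0 <= F y)%E -> (forall y, F y <= G y)%E ->
  (iterated_integral D F <= iterated_integral D G)%E.
Proof.
elim: N D F G => [|N IH] D F G mD mF mG F0 FG //=.
have G0 y : (0 <= G y)%E by exact: le_trans (FG y).
have h t : (iterated_integral (fun i => D (lift ord0 i)) (fun v => F (cons_tuple t v)) <=
    iterated_integral (fun i => D (lift ord0 i)) (fun v => G (cons_tuple t v)))%E.
  by apply: IH => //; exact: measurable_tail.
have [[a Da]|nD] := pselect (is_point (D ord0)).
  by rewrite Da !coord_integral_point.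
rewrite !coord_integral_nonpoint//; apply: ge0_le_integral => //.
- by move=> x _; apply: iterated_integral_ge0.
- by apply: measurable_funTS; exact: measurable_iterated_tail.
- by apply: measurable_funTS; exact: measurable_iterated_tail.
Qed.

Lemma iterated_integralD N (D : 'I_N -> set mR) (F G : N.-tuple mR -> \bar R) :
  (forall i, measurable (D i)) ->
  measurable_fun setT F -> measurable_fun setT G ->
  (forall y, 0 <= F y)%E -> (forall y, 0 <= G y)%E ->
  iterated_integral D (fun y => F y + G y)%E =
  (iterated_integral D F + iterated_integral D G)%E.
Proof.
elim: N D F G => [|N IH] D F G mD mF mG F0 G0 //=.
transitivity (coord_integral (D ord0) (fun t =>
    iterated_integral (fun i => D (lift ord0 i)) (fun v => F (cons_tuple t v)) +
    iterated_integral (fun i => D (lift ord0 i)) (fun v => G (cons_tuple t v)))%E).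
  apply: eq_coord_integral => t _.
  by apply: (IH _ (fun v => F (cons_tuple t v)) (fun v => G (cons_tuple t v))) => //;
     exact: measurable_tail.
have [[a Da]|nD] := pselect (is_point (D ord0)).
  by rewrite Da !coord_integral_point.
rewrite !coord_integral_nonpoint//; apply: ge0_integralD => //.
- by move=> x _; apply: iterated_integral_ge0.
- by apply: measurable_funTS; exact: measurable_iterated_tail.
- by move=> x _; apply: iterated_integral_ge0.
- by apply: measurable_funTS; exact: measurable_iterated_tail.
Qed.

Lemma iterated_integralZl N (D : 'I_N -> set mR) (F : N.-tuple mR -> \bar R) (c : \bar R) :
  (forall i, measurable (D i)) -> measurable_fun setT F ->
  (forall y, 0 <= F y)%E -> (0 <= c)%E ->
  iterated_integral D (fun y => c * F y)%E = (c * iterated_integral D F)%E.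
Proof.
elim: N D F => [|N IH] D F mD mF F0 c0 //=.
transitivity (coord_integral (D ord0) (fun t => c *
    iterated_integral (fun i => D (lift ord0 i)) (fun v => F (cons_tuple t v)))%E).
  apply: eq_coord_integral => t _.
  by apply: (IH _ (fun v => F (cons_tuple t v))) => //; exact: measurable_tail.
have [[a Da]|nD] := pselect (is_point (D ord0)).
  by rewrite Da !coord_integral_point.
rewrite !coord_integral_nonpoint//; apply: ge0_integralZl => //.
- by apply: measurable_funTS; exact: measurable_iterated_tail.
- by move=> x _; apply: iterated_integral_ge0.
Qed.

Lemma iterated_integral_lim N (D : 'I_N -> set mR) (F : (N.-tuple mR -> \bar R)^nat) :
  (forall i, measurable (D i)) -> (forall n, measurable_fun setT (F n)) ->
  (forall n y, 0 <= F n y)%E ->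
  (forall y, {homo F ^~ y : n m / (n <= m)%N >-> (n <= m)%E}) ->
  iterated_integral D (fun y => limn (F ^~ y)) = limn (fun n => iterated_integral D (F n)).
Proof.
elim: N D F => [|N IH] D F mD mF F0 nF //=.
transitivity (coord_integral (D ord0) (fun t => limn (fun n =>
    iterated_integral (fun i => D (lift ord0 i)) (fun v => F n (cons_tuple t v))))).
  apply: eq_coord_integral => t _.
  by apply: (IH _ (fun n v => F n (cons_tuple t v))) => // n; exact: measurable_tail.
have [[a Da]|nD] := pselect (is_point (D ord0)).
  by rewrite Da coord_integral_point; apply/congr_lim/funext => n /=; rewrite coord_integral_point.
rewrite !coord_integral_nonpoint//.
rewrite (monotone_convergence lebesgue_measure (mD ord0)).
- by apply/congr_lim/funext => n /=; rewrite coord_integral_nonpoint.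
- by move=> n; apply: measurable_funTS; exact: measurable_iterated_tail.
- by move=> n x _; apply: iterated_integral_ge0.
- move=> x _ n m nm; apply: le_iterated_integral => //; try exact: measurable_tail.
  by move=> y; exact: nF.
Qed.

Lemma iterated_integral_cvg N (D : 'I_N -> set mR) (F : (N.-tuple mR -> \bar R)^nat) :
  (forall i, measurable (D i)) -> (forall n, measurable_fun setT (F n)) ->
  (forall n y, 0 <= F n y)%E ->
  (forall y, {homo F ^~ y : n m / (n <= m)%N >-> (n <= m)%E}) ->
  iterated_integral D (F n) @[n --> \oo] -->
  iterated_integral D (fun y => limn (F ^~ y)).
Proof.
move=> mD mF F0 nF; rewrite iterated_integral_lim//.
apply: ereal_nondecreasing_is_cvgn => n m nm.
by apply: le_iterated_integral => // y; exact: nF.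
Qed.

(* Evaluation on a point and integration over an interval restrict differently:
   hence the assumption that D' i is a point exactly when D i is. *)
Lemma iterated_integral_restrict N (D D' : 'I_N -> set mR) (F : N.-tuple mR -> \bar R) :
  (forall i, measurable (D i)) -> (forall i, measurable (D' i)) ->
  (forall i, D' i `<=` D i) -> (forall i, is_point (D' i) <-> is_point (D i)) ->
  measurable_fun setT F -> (forall y, 0 <= F y)%E ->
  iterated_integral D' F = iterated_integral D (fun y => F y * (\1_(in_box D') y)%:E)%E.
Proof.
elim: N D D' F => [|N IH] D D' F mD mD' DD' DpD' mF F0 /=.
  by rewrite indicE mem_set ?mule1//= => -[].
transitivity (coord_integral (D' ord0) (fun t => iterated_integral (fun i => D (lift ord0 i))
    (fun v => F (cons_tuple t v) * (\1_(in_box (fun i => D' (lift ord0 i))) v)%:E)%E)).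
  apply: eq_coord_integral => t _.
  by apply: (IH _ _ (fun v => F (cons_tuple t v))) => //; exact: measurable_tail.
have eqin t v : in_box D' (cons_tuple t v) <-> D' ord0 t /\ in_box (fun i => D' (lift ord0 i)) v.
  exact: in_box_cons.
have in1 t v : D' ord0 t ->
    \1_(in_box D') (cons_tuple t v) = \1_(in_box (fun i => D' (lift ord0 i))) v :> R.
  move=> Dt; rewrite !indicE; congr (_%:R); congr nat_of_bool.
  by apply/idP/idP => /[!inE] => [/eqin[]//|h]; apply/eqin.
have in0 t v : ~ D' ord0 t -> \1_(in_box D') (cons_tuple t v) = 0 :> R.
  by move=> Dt; rewrite indicE memNset// => /eqin[].
have [[a Da]|nD] := pselect (is_point (D ord0)).
  have /DpD' [b Db] : is_point (D ord0) by exists a.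
  have ab : b = a by have : D' ord0 b; [rewrite Db|move=> /DD'; rewrite Da].
  by rewrite Da Db ab !coord_integral_point; apply: eq_iterated_integral => v _;
    rewrite in1 // Db ab.
have nD' : ~ is_point (D' ord0) by move/DpD'.
rewrite !coord_integral_nonpoint//.
rewrite [LHS]integral_mkcond [RHS]integral_mkcond; apply: eq_integral => t _.
rewrite !patchE; case: ifPn => [/set_mem D't|/negP D't].
  rewrite ifT ?inE; last exact: DD'.
  by apply: eq_iterated_integral => v _; rewrite in1.
case: ifPn => // _; apply/esym.
have {}D't : ~ D' ord0 t by move=> h; apply: D't; rewrite inE.
transitivity (iterated_integral (fun i => D (lift ord0 i)) (fun v => 0 * F (cons_tuple t v))%E).
  by apply: eq_iterated_integral => v _; rewrite in0// mule0 mul0e.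
by rewrite iterated_integralZl// ?mul0e//; exact: measurable_tail.
Qed.

(** Only the coordinate integrals have to agree, not the sets: this is what exchanges closed,
    half-open and open sides. *)
Lemma iterated_integral_eq_domain N (D D' : 'I_N -> set mR) (F : N.-tuple mR -> \bar R) :
  (forall i, measurable (D i)) ->
  (forall i (G : mR -> \bar R), measurable_fun setT G ->
     coord_integral (D i) G = coord_integral (D' i) G) ->
  measurable_fun setT F -> (forall y, 0 <= F y)%E ->
  iterated_integral D F = iterated_integral D' F.
Proof.
elim: N D D' F => [|N IH] D D' F mD DD' mF F0 //=.
rewrite DD'; last exact: measurable_iterated_tail.
apply: eq_coord_integral => t _.
by apply: (IH _ _ (fun v => F (cons_tuple t v))) => // [i|]; [exact: DD'|exact: measurable_tail].
Qed.

Lemma iterated_integral_gt0 N (D : 'I_N -> set mR) (F : N.-tuple mR -> \bar R) :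
  (forall i, measurable (D i)) ->
  (forall i, is_point (D i) \/ (0 < (lebesgue_measure (D i) : \bar R))%E) ->
  measurable_fun setT F -> (forall y, 0 <= F y)%E -> (forall y, in_box D y -> 0 < F y)%E ->
  (0 < iterated_integral D F)%E.
Proof.
elim: N D F => [|N IH] D F mD D0 mF F0 FD /=; first by apply: FD => -[].
have h t : D ord0 t -> (0 < iterated_integral (fun i => D (lift ord0 i)) (fun v => F (cons_tuple t v)))%E.
  move=> Dt; apply: (IH _ (fun v => F (cons_tuple t v))) => //; first exact: measurable_tail.
  by move=> v Dv; apply: FD; apply/in_box_cons.
have [[a Da]|nD] := pselect (is_point (D ord0)).
  by rewrite Da coord_integral_point; apply: h; rewrite Da.
rewrite coord_integral_nonpoint// lt_neqAle integral_ge0 ?andbT; last first.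
  by move=> t /h /ltW.
apply/eqP => /esym I0.
have [//|D0'] := D0 ord0.
have : ae_eq lebesgue_measure (D ord0) (fun t => iterated_integral (fun i => D (lift ord0 i))
    (fun v => F (cons_tuple t v))) (cst 0%E).
  apply/ae_eq_integral_abs => //.
    by apply: measurable_funTS; exact: measurable_iterated_tail.
  by rewrite -[RHS]I0; apply: eq_integral => t _; rewrite gee0_abs//; exact: iterated_integral_ge0.
move=> [A [mA A0 sA]]; move: D0'; rewrite ltNge => /negP; apply.
rewrite -A0; apply: le_measure; rewrite ?inE// => t Dt; apply: sA => /= /(_ Dt) e.
by have := h t Dt; rewrite e ltxx.
Qed.

End IteratedIntegralTheory.

(** * Positive functionals represented by measures *)

Section FunctionalMeasure.
Import HBNNSimple finmap.finmap.
Context {d : measure_display} {T : measurableType d} {R : realType}.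

(** The hypotheses of a Daniell-type representation, asked only of nonnegative functions. Mixtures
    of evaluations and Lebesgue integrals satisfy them, and so become integrals against a single
    measure. *)
Definition positive_functional (M : (T -> \bar R) -> \bar R) :=
  [/\ forall F, (forall x, 0 <= F x)%E -> (0 <= M F)%E,
      forall F G, measurable_fun setT F -> measurable_fun setT G ->
        (forall x, 0 <= F x)%E -> (forall x, 0 <= G x)%E ->
        M (fun x => F x + G x)%E = (M F + M G)%E,
      forall c F, measurable_fun setT F -> (forall x, 0 <= F x)%E -> (0 <= c)%E ->
        M (fun x => c * F x)%E = (c * M F)%E &
      forall F : (T -> \bar R)^nat, (forall n, measurable_fun setT (F n)) ->
        (forall n x, 0 <= F n x)%E ->
        (forall x, {homo F ^~ x : n m / (n <= m)%N >-> (n <= m)%E}) ->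
        M (F n) @[n --> \oo] --> M (fun x => limn (F ^~ x))].

Variable M : (T -> \bar R) -> \bar R.
Hypothesis pM : positive_functional M.

Lemma functional0 : M (fun=> 0%E) = 0%E.
Proof.
case: pM => _ _ MZ _; transitivity (0 * M (fun=> 0%E))%E; last by rewrite mul0e.
by rewrite -MZ//; congr M; apply/funext => x; rewrite mul0e.
Qed.

Lemma functional_sum (I : Type) (s : seq I) (F : I -> T -> \bar R) :
  (forall i, measurable_fun setT (F i)) -> (forall i x, 0 <= F i x)%E ->
  M (fun x => \sum_(i <- s) F i x)%E = (\sum_(i <- s) M (F i))%E.
Proof.
case: (pM) => _ MD _ _ mF F0; elim: s => [|i s IH].
  by rewrite big_nil -[RHS]functional0; congr M; apply/funext => x; rewrite big_nil.
rewrite big_cons -IH -MD//; [|exact: emeasurable_sum|by move=> x; exact: sume_ge0].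
by congr M; apply/funext => x; rewrite big_cons.
Qed.

Lemma functional_measure : exists mu : {measure set T -> \bar R},
  forall F, measurable_fun setT F -> (forall x, 0 <= F x)%E -> M F = (\int[mu]_x F x)%E.
Proof.
case: (pM) => Mge0 MD MZ Mcvg.
pose m (A : set T) := M (fun x => (\1_A x)%:E).
have m0 : m set0 = 0%E.
  by rewrite -[RHS]functional0; congr M; apply/funext => x; rewrite indic0.
have mge0 A : (0 <= m A)%E by apply: Mge0 => x; rewrite lee_fin.
have mI (A : set T) : measurable A -> measurable_fun setT (fun x => (\1_A x)%:E : \bar R).
  by move=> mA; apply/measurable_EFinP; exact: measurable_indic.
have msa : semi_sigma_additive m.
  move=> F mF tF mUF.
  pose G n x : \bar R := (\sum_(0 <= i < n) (\1_(F i) x)%:E)%E.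
  have GE n : M (G n) = (\sum_(0 <= i < n) m (F i))%E.
    by rewrite functional_sum// => i; exact: mI.
  under eq_fun do rewrite -GE.
  rewrite (_ : m _ = M (fun x => limn (G ^~ x))).
    apply: Mcvg => [n|n x|x].
    - by apply: emeasurable_sum => i _; exact: mI.
    - by apply: sume_ge0 => i _; rewrite lee_fin.
    - by apply: ereal_nondecreasing_series => i _ _; rewrite lee_fin.
  by congr M; apply/funext => x; rewrite indic_bigcup.
pose hm := isMeasure.Build d T R m m0 mge0 msa.
pose mu : {measure set T -> \bar R} := HB.pack m hm.
exists mu => F mF F0.
have mS (A : set T) : mu A = M (fun x => (\1_A x)%:E) by [].
have Mnn (h : {nnsfun T >-> R}) : M (EFin \o h) = (\int[mu]_x (h x)%:E)%E.
  rewrite integralT_nnsfun sintegralE.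
  rewrite fsbig_finite//=.
  (* The index [y] runs over all reals, and [functional_sum] wants every term nonnegative; on the
     range of [h] the absolute value changes nothing. *)
  pose H (y : R) x : \bar R := (`|y|%:E * (\1_(h @^-1` [set y]) x)%:E)%E.
  have mh y : measurable (h @^-1` [set y]) by [].
  have -> : EFin \o h = fun x => (\sum_(y <- fset_set (range h)) H y x)%E.
    apply/funext => x /=; rewrite fimfunE fsbig_finite//= -sumEFin.
    rewrite big_seq [RHS]big_seq; apply: eq_bigr => y.
    by rewrite in_fset_set// => /set_mem[t _ <-]; rewrite /H EFinM ger0_norm.
  rewrite functional_sum.
  - rewrite big_seq [RHS]big_seq; apply: eq_bigr => y.
    rewrite in_fset_set// => /set_mem[t _ <-]; rewrite MZ ?ger0_norm ?lee_fin//.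
    exact: mI.
  - by move=> y; apply: emeasurable_funM => //; exact: mI.
  - by move=> y x; rewrite mule_ge0// lee_fin.
pose g := nnsfun_approx measurableT mF.
have gF x : (fun n => (g n x)%:E) @ \oo --> F x by exact: cvg_nnsfun_approx.
have ndg x : {homo (fun n => (g n x)%:E) : n m / (n <= m)%N >-> (n <= m)%E}.
  by move=> a b ab; rewrite lee_fin; exact/lefP/nd_nnsfun_approx.
have FE : F = fun x => limn (fun n => (g n x)%:E).
  by apply/funext => x; apply/esym/cvg_lim.
have mg n : measurable_fun setT (fun x => (g n x)%:E) by exact/measurable_EFinP.
have g0 n x : (0 <= (g n x)%:E)%E by rewrite lee_fin.
have h1 := Mcvg (fun n x => (g n x)%:E) mg g0 ndg.
have h2 := @cvg_monotone_convergence _ _ _ mu setT measurableT _ mg (fun n x _ => g0 n x) (fun x _ => ndg x).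
rewrite FE.
rewrite -(cvg_lim _ h1)// -(cvg_lim _ h2)//.
by congr (limn _); apply/funext => n; exact: Mnn.
Qed.

End FunctionalMeasure.

(** * The law of the value over a box of signals *)

Section BoxLaw.
Context {R : realType} {N : nat}.
Notation mR := (measurableTypeR R).
Variables (f : N.-tuple R -> R) (Q : R.-pker (N.-tuple mR) ~> mR).
Hypothesis mf : measurable_fun setT (f : N.-tuple mR -> R).
Hypothesis f0 : forall y, 0 <= f y.

Definition box_weight (F : mR -> \bar R) (y : N.-tuple mR) : \bar R :=
  ((f y)%:E * \int[Q y]_x F x)%E.

Lemma measurable_box_weight F : measurable_fun setT F -> (forall x, 0 <= F x)%E ->
  measurable_fun setT (box_weight F).
Proof.
move=> mF F0; apply: emeasurable_funM; first exact/measurable_EFinP.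
by apply: measurable_fun_integral_kernel => // U mU; exact: measurable_kernel.
Qed.

Lemma box_weight_ge0 F y : (forall x, 0 <= F x)%E -> (0 <= box_weight F y)%E.
Proof. by move=> F0; rewrite mule_ge0 ?lee_fin//; exact: integral_ge0. Qed.

Lemma box_weight1 y : box_weight (fun=> 1%:E) y = (f y)%:E.
Proof. by rewrite /box_weight integral_cst// mul1e prob_kernel mule1. Qed.

Lemma box_lawE D phi : box_law f Q D phi = iterated_integral D (box_weight (EFin \o phi)).
Proof. by []. Qed.

Lemma positive_box_functional (D : 'I_N -> set mR) : (forall i, measurable (D i)) ->
  positive_functional (fun F => iterated_integral D (box_weight F)).
Proof.
move=> mD; split.
- by move=> F F0; apply: iterated_integral_ge0 => y _; exact: box_weight_ge0.
- move=> F G mF mG F0 G0.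
  rewrite -iterated_integralD//; do ?exact: measurable_box_weight;
    do ?by move=> y; exact: box_weight_ge0.
  apply: eq_iterated_integral => y _.
  by rewrite /box_weight ge0_integralD// ge0_muleDr//; exact: integral_ge0.
- move=> c F mF F0 c0.
  rewrite -iterated_integralZl//; do ?exact: measurable_box_weight;
    do ?by move=> y; exact: box_weight_ge0.
  apply: eq_iterated_integral => y _.
  by rewrite /box_weight ge0_integralZl// muleCA.
- move=> F mF F0 nF.
  have := @iterated_integral_cvg R N D (fun n => box_weight (F n)) mD
    (fun n => measurable_box_weight (mF n) (F0 n)) (fun n y => box_weight_ge0 y (F0 n)).
  have nI y : {homo (fun n => \int[Q y]_x F n x)%E : n m / (n <= m)%N >-> (n <= m)%E}.
    move=> n m nm; apply: ge0_le_integral => // x _; exact: nF.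
  rewrite (_ : iterated_integral D (box_weight (fun x => limn (F^~ x))) =
    iterated_integral D (fun y => limn (fun n => box_weight (F n) y))).
    by apply => y n m nm; apply: lee_wpmul2l; [rewrite lee_fin|exact: nI].
  apply: eq_iterated_integral => y _.
  rewrite /box_weight monotone_convergence// limeMl//.
  exact: ereal_nondecreasing_is_cvgn (nI y).
Qed.

Lemma box_law_measure (D : 'I_N -> set mR) : (forall i, measurable (D i)) ->
  exists mu : {measure set mR -> \bar R}, forall phi : R -> R,
    measurable_fun setT (phi : mR -> mR) -> (forall x, 0 <= phi x) ->
    box_law f Q D phi = (\int[mu]_x (phi x)%:E)%E.
Proof.
move=> mD; have [mu muE] := functional_measure (positive_box_functional mD).
exists mu => phi mphi phi0; rewrite box_lawE muE//.
exact/measurable_EFinP.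
Qed.

Lemma box_law_ge0 (D : 'I_N -> set mR) phi : (forall x, 0 <= phi x) -> (0 <= box_law f Q D phi)%E.
Proof.
by move=> phi0; apply: iterated_integral_ge0 => y _; apply: box_weight_ge0 => x; rewrite lee_fin.
Qed.

Lemma box_law_gt0 (D : 'I_N -> set mR) : (forall i, measurable (D i)) ->
  (forall i, is_point (D i) \/ (0 < (lebesgue_measure (D i) : \bar R))%E) ->
  (forall y, in_box D y -> 0 < f y) -> (0 < box_law f Q D (fun=> 1%R))%E.
Proof.
move=> mD D0 fD; rewrite box_lawE; apply: iterated_integral_gt0 => //.
- apply: measurable_box_weight => [|x]; [exact: measurable_cst|by rewrite lee_fin].
- by move=> y; apply: box_weight_ge0 => x; rewrite lee_fin.
- by move=> y Dy; rewrite box_weight1 lte_fin fD.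
Qed.

(** The second law is the first plus the iterated integral of a gap that is positive on a box of
    positive mass. *)
Lemma box_law_lt (D : 'I_N -> set mR) (phi psi : R -> R) : (forall i, measurable (D i)) ->
  (forall i, is_point (D i) \/ (0 < (lebesgue_measure (D i) : \bar R))%E) ->
  (forall y, in_box D y -> 0 < f y) ->
  measurable_fun setT (phi : mR -> mR) -> measurable_fun setT (psi : mR -> mR) ->
  (forall x, 0 <= phi x) -> (forall x, 0 <= psi x) ->
  (forall y, in_box D y -> (\int[Q y]_x (phi x)%:E < \int[Q y]_x (psi x)%:E)%E) ->
  (box_law f Q D phi < +oo)%E -> (box_law f Q D phi < box_law f Q D psi)%E.
Proof.
move=> mD D0 fD mphi mpsi phi0 psi0 lt phioo.
have mE (h : R -> R) : measurable_fun setT (h : mR -> mR) ->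
    measurable_fun setT (EFin \o h : mR -> \bar R) by move=> mh; exact/measurable_EFinP.
have mI (h : R -> R) : measurable_fun setT (h : mR -> mR) -> (forall x, 0 <= h x) ->
    measurable_fun setT (fun y : N.-tuple mR => \int[Q y]_x (h x)%:E)%E.
  move=> mh h0; apply: measurable_fun_integral_kernel => // [U mU|]; first exact: measurable_kernel.
  exact: mE.
(* The maximum with 0 keeps the gap nonnegative off the box, where the two inner integrals are not
   assumed to be ordered. *)
pose gap y : \bar R := maxe (\int[Q y]_x (psi x)%:E - \int[Q y]_x (phi x)%:E)%E 0%E.
pose G (y : N.-tuple mR) : \bar R := ((f y)%:E * gap y)%E.
have gap0 y : (0 <= gap y)%E by rewrite le_max lexx orbT.
have G0 y : (0 <= G y)%E by rewrite mule_ge0// lee_fin.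
have mG : measurable_fun setT G.
  apply: emeasurable_funM; first exact/measurable_EFinP.
  by apply: measurable_maxe => //; apply: emeasurable_funB; exact: mI.
have mphiW : measurable_fun setT (box_weight (EFin \o phi)).
  by apply: measurable_box_weight => [|x]; [exact: mE|rewrite lee_fin].
have phiW0 y : (0 <= box_weight (EFin \o phi) y)%E.
  by apply: box_weight_ge0 => x; rewrite lee_fin.
have -> : box_law f Q D psi = (box_law f Q D phi + iterated_integral D G)%E.
  rewrite !box_lawE -iterated_integralD//; apply: eq_iterated_integral => y Dy.
  have phi_ge0 : (0 <= \int[Q y]_x (phi x)%:E)%E by apply: integral_ge0 => x _; rewrite lee_fin.
  have phi_fin : (\int[Q y]_x (phi x)%:E)%E \is a fin_num.
    by rewrite ge0_fin_numE// (lt_le_trans (lt y Dy))// leey.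
  rewrite /box_weight /G -ge0_muleDr//; congr (_ * _)%E.
  rewrite /gap (max_idPl _) ?sube_ge0 ?phi_fin ?orbT//; last exact: ltW (lt y Dy).
  by rewrite addeCA subee// adde0.
have phifin : box_law f Q D phi \is a fin_num.
  by rewrite ge0_fin_numE; [exact: phioo|exact: box_law_ge0].
rewrite lteDl//; apply: iterated_integral_gt0 => // y Dy.
by rewrite mule_gt0 ?lte_fin ?fD// /gap lt_max sube_gt0 lt.
Qed.

Lemma box_law_restrict (D D' : 'I_N -> set mR) (phi : R -> R) :
  (forall i, measurable (D i)) -> (forall i, measurable (D' i)) ->
  (forall i, D' i `<=` D i) -> (forall i, is_point (D' i) <-> is_point (D i)) ->
  measurable_fun setT (phi : mR -> mR) -> (forall x, 0 <= phi x) ->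
  box_law f Q D' phi =
  iterated_integral D (fun y => box_weight (EFin \o phi) y * (\1_(in_box D') y)%:E)%E.
Proof.
move=> mD mD' DD' pDD' mphi phi0; rewrite box_lawE (iterated_integral_restrict (D := D))//.
- by apply: measurable_box_weight => //; exact/measurable_EFinP.
- by move=> y; apply: box_weight_ge0 => x; rewrite lee_fin.
Qed.

Lemma le_box_law (D D' : 'I_N -> set mR) (phi : R -> R) :
  (forall i, measurable (D i)) -> (forall i, measurable (D' i)) ->
  (forall i, D' i `<=` D i) -> (forall i, is_point (D' i) <-> is_point (D i)) ->
  measurable_fun setT (phi : mR -> mR) -> (forall x, 0 <= phi x) ->
  (box_law f Q D' phi <= box_law f Q D phi)%E.
Proof.
move=> mD mD' DD' pDD' mphi phi0.
have mw : measurable_fun setT (box_weight (EFin \o phi)).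
  by apply: measurable_box_weight => //; exact/measurable_EFinP.
have w0 y : (0 <= box_weight (EFin \o phi) y)%E.
  by apply: box_weight_ge0 => x; rewrite lee_fin.
rewrite (box_law_restrict mD mD')//; apply: le_iterated_integral => //.
- apply: emeasurable_funM => //; apply/measurable_EFinP/measurable_indic.
  exact: measurable_in_box.
- by move=> y; rewrite mule_ge0// lee_fin.
- by move=> y; rewrite indicE; case: (_ \in _); rewrite ?mule1 ?mule0//; exact: w0.
Qed.

(** Monotone convergence: seen from the large box, the small ones are indicators increasing to 1,
    since a point has finitely many coordinates and each enters at some stage. *)
Lemma box_law_cvg (D : 'I_N -> set mR) (E : nat -> 'I_N -> set mR) (phi : R -> R) :
  (forall i, measurable (D i)) -> (forall m i, measurable (E m i)) ->
  (forall m i, E m i `<=` D i) -> (forall m i, is_point (E m i) <-> is_point (D i)) ->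
  (forall i m m', (m <= m')%N -> E m i `<=` E m' i) ->
  (forall i x, D i x -> exists m, E m i x) ->
  measurable_fun setT (phi : mR -> mR) -> (forall x, 0 <= phi x) ->
  box_law f Q (E m) phi @[m --> \oo] --> box_law f Q D phi.
Proof.
move=> mD mE ED pED ndE DE mphi phi0.
have mw : measurable_fun setT (box_weight (EFin \o phi)).
  by apply: measurable_box_weight => //; exact/measurable_EFinP.
have w0 y : (0 <= box_weight (EFin \o phi) y)%E.
  by apply: box_weight_ge0 => x; rewrite lee_fin.
rewrite (_ : (fun m => _) = fun m => iterated_integral D
    (fun y => box_weight (EFin \o phi) y * (\1_(in_box (E m)) y)%:E)%E); last first.
  by apply/funext => m; exact: box_law_restrict.
rewrite (_ : box_law f Q D phi = iterated_integral D (fun y =>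
    limn (fun m => box_weight (EFin \o phi) y * (\1_(in_box (E m)) y)%:E)%E)); last first.
  apply: eq_iterated_integral => y Dy; apply/esym/cvg_lim => //; apply: cvg_near_cst.
  have /choice[g gE] : forall i, exists m, E m i (tnth y i) by move=> i; exact: DE.
  exists (\max_i g i)%N => // m /= gm; rewrite indicE mem_set ?mule1// => i.
  by apply: ndE (gE i); apply: leq_trans gm; exact: leq_bigmax.
apply: iterated_integral_cvg => //.
- move=> m; apply: emeasurable_funM => //; apply/measurable_EFinP/measurable_indic.
  exact: measurable_in_box.
- by move=> m y; rewrite mule_ge0// lee_fin.
- move=> y m m' mm'; apply: lee_wpmul2l => //; rewrite lee_fin !indicE ler_nat.
  have [Ey|] := boolP (y \in in_box (E m)) => //.
  by rewrite mem_set// => i; apply: ndE mm' _ _; move/set_mem : Ey; exact.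
Qed.

Lemma box_law_eq_domain (D D' : 'I_N -> set mR) (phi : R -> R) :
  (forall i, measurable (D i)) ->
  (forall i (G : mR -> \bar R), measurable_fun setT G ->
     coord_integral (D i) G = coord_integral (D' i) G) ->
  measurable_fun setT (phi : mR -> mR) -> (forall x, 0 <= phi x) ->
  box_law f Q D phi = box_law f Q D' phi.
Proof.
move=> mD DD' mphi phi0; rewrite !box_lawE (iterated_integral_eq_domain mD DD')//.
- by apply: measurable_box_weight => //; exact/measurable_EFinP.
- by move=> y; apply: box_weight_ge0 => x; rewrite lee_fin.
Qed.

End BoxLaw.

(** * Density and conditional law as probabilities *)

Section SignalLaw.
Context {R : realType} {n : nat} {d : measure_display} {T : measurableType d}.
Notation mR := (measurableTypeR R).
Variables (P : probability T R) (X Y : 'I_n.+2 -> {RV P >-> R}).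
Variables (f : n.+2.-tuple R -> R) (Q : R.-pker (n.+2.-tuple mR) ~> mR).
Hypothesis hf : is_joint_density Y f.
Hypothesis hQ : is_cond_law X Y Q.

Let mf : measurable_fun setT (f : n.+2.-tuple mR -> R). Proof. by case: hf. Qed.
Let f0 y : 0 <= f y. Proof. by case: hf. Qed.

Lemma measurable_signal_vector : measurable_fun setT (signal_vector Y : T -> n.+2.-tuple mR).
Proof.
apply/measurable_fun_tnthP => i; rewrite (_ : _ \o _ = Y i).
 exact: (@measurable_funPT _ _ _ _ (Y i)).
by apply/funext => w /=; rewrite tnth_mktuple.
Qed.

(** The density formula is given for sets. Its right-hand side is a positive functional, hence a
    measure, and that measure agrees with the law of the signals on sets. *)
Lemma integral_signal_vector (G : n.+2.-tuple mR -> \bar R) :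
  measurable_fun setT G -> (forall y, 0 <= G y)%E ->
  (\int[P]_w G (signal_vector Y w) = iterated_integral (fun=> setT) (fun y => (f y)%:E * G y))%E.
Proof.
move=> mG G0.
have mfE : measurable_fun setT (fun y : n.+2.-tuple mR => (f y)%:E : \bar R).
  exact/measurable_EFinP.
have pM : positive_functional (fun G : n.+2.-tuple mR -> \bar R =>
    iterated_integral (fun=> setT) (fun y => ((f y)%:E * G y)%E)).
  split.
  - by move=> F F0; apply: iterated_integral_ge0 => y _; rewrite mule_ge0 ?lee_fin.
  - move=> F H mF mH F0 H0; rewrite -iterated_integralD; last 5 first.
    + by [].
    + exact: emeasurable_funM.
    + exact: emeasurable_funM.
    + by move=> y; rewrite mule_ge0 ?lee_fin.
    + by move=> y; rewrite mule_ge0 ?lee_fin.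
    by apply: eq_iterated_integral => y _; rewrite ge0_muleDr.
  - move=> c F mF F0 c0; rewrite -iterated_integralZl; last 4 first.
    + by [].
    + exact: emeasurable_funM.
    + by move=> y; rewrite mule_ge0 ?lee_fin.
    + exact: c0.
    by apply: eq_iterated_integral => y _; rewrite muleCA.
  - move=> F mF F0 nF.
    rewrite (_ : iterated_integral _ (fun y => ((f y)%:E * limn (F^~ y))%E) =
        iterated_integral (fun=> setT) (fun y : n.+2.-tuple mR => limn (fun m => (f y)%:E * F m y)%E)).
      apply: (@iterated_integral_cvg R n.+2 (fun=> setT) (fun m y => (f y)%:E * F m y)%E) => //.
      + by move=> m; exact: emeasurable_funM.
      + by move=> m y; rewrite mule_ge0 ?lee_fin.
      + by move=> y m m' mm'; rewrite lee_wpmul2l ?lee_fin//; exact: nF.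
    apply: eq_iterated_integral => y _; rewrite limeMl//.
    by apply: ereal_nondecreasing_is_cvgn; exact: nF.
have [nu nuE] := functional_measure pM.
rewrite nuE//.
have -> : (\int[P]_w G (signal_vector Y w) =
    \int[pushforward P (signal_vector Y : T -> n.+2.-tuple mR)]_y G y)%E.
  by rewrite ge0_integral_pushforward//; exact: measurable_signal_vector.
apply: eq_measure_integral => [|mS B mB _]; first exact: measurable_signal_vector.
have [_ _ /(_ B mB) hB] := hf; rewrite [LHS]hB.
rewrite -[RHS]mul1e -integral_cst// integral_mkcond.
transitivity (\int[nu]_y (\1_B y)%:E)%E.
  rewrite -nuE//; last by apply/measurable_EFinP; exact: measurable_indic.
apply: eq_integral => y _; by rewrite patchE indicE; case: ifP.
Qed.

Lemma prob_value_signal (A : set mR) (B : set (n.+2.-tuple mR)) : measurable A -> measurable B ->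
  P (X ord0 @^-1` A `&` signal_vector Y @^-1` B) =
  iterated_integral (fun=> setT) (fun y =>
    box_weight f Q (EFin \o \1_A) y * (\1_B y)%:E)%E.
Proof.
move=> mA mB; rewrite hQ//.
have mQA : measurable_fun setT (fun y => Q y A) by exact: measurable_kernel.
rewrite integral_mkcond.
transitivity (\int[P]_w (Q (signal_vector Y w) A * (\1_B (signal_vector Y w))%:E))%E.
  apply: eq_integral => w _; rewrite patchE indicE.
  have [Bw|Bw] := boolP (w \in _); [move/set_mem : Bw => Bw|have {}Bw : ~ B (signal_vector Y w)].
  - by rewrite mem_set ?mule1.
  - by move=> h; move/negP : Bw; apply; apply/mem_set.
  - by rewrite memNset ?mule0.
rewrite (integral_signal_vector (G := fun y => Q y A * (\1_B y)%:E)%E).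
- apply: eq_iterated_integral => y _; rewrite muleA; congr (_ * _ * _)%E.
  by rewrite integral_indic// setIT.
- by apply: emeasurable_funM => //; apply/measurable_EFinP; exact: measurable_indic.
- by move=> y; rewrite mule_ge0// lee_fin.
Qed.

(** The bridge from [f] and [Q] to [P]. It excludes point sides, on which [box_law] evaluates a
    density instead of measuring an event. *)
Lemma prob_value_box (A : set mR) (D : 'I_n.+2 -> set mR) : measurable A ->
  (forall i, measurable (D i)) -> (forall i, ~ is_point (D i)) ->
  P [set w | A (X ord0 w) /\ forall i, D i (Y i w)] = box_law f Q D \1_A.
Proof.
move=> mA mD nD.
rewrite (box_law_restrict Q mf f0 (D := fun=> setT))//.
- rewrite -prob_value_signal//; last exact: measurable_in_box.
  congr (P _); apply/seteqP; split=> w [Aw Dw]; split=> // i; have := Dw i;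
    by rewrite ?tnth_mktuple.
- move=> i; split=> [/nD//|]; have // := @not_point R setT 0 1 I I.
  by rewrite eq_sym oner_neq0 => /(_ isT).
Qed.

Lemma prob_value_half_open (A : set mR) (a b : 'I_n.+2 -> R) : measurable A ->
  (forall i, a i < b i) ->
  P [set w | A (X ord0 w) /\ forall i, a i <= Y i w < b i] = box_law f Q (closed_box a b) \1_A.
Proof.
move=> mA ab.
have nco i : ~ is_point `[a i, b i[%classic.
  apply: (not_point (x := a i) (y := (a i + b i) / 2)) => /=.
  - by rewrite in_itv/= lexx ab.
  - by rewrite in_itv/= midf_lt// ltW// midf_lt.
  - by rewrite lt_eqF// midf_lt.
have ncc i : ~ is_point `[a i, b i]%classic.
  apply: (not_point (x := a i) (y := b i)) => /=.
  - by rewrite in_itv/= lexx ltW.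
  - by rewrite in_itv/= lexx ltW.
  - by rewrite lt_eqF.
rewrite -(box_law_eq_domain Q mf f0 (D := fun i => [set` `[a i, b i[])) => //.
- by rewrite -prob_value_box.
- move=> i G mG; rewrite (coord_integral_nonpoint _ (nco i)) (coord_integral_nonpoint _ (ncc i)).
  by apply: integral_itv_bndo_bndc; exact: measurable_funTS.
Qed.

(** The open and the closed ray ending at [c] have the same Lebesgue integrals, hence the same
    probability. *)
Lemma prob_signal_eq (i : 'I_n.+2) (c : R) : P [set w | Y i w = c] = 0%E.
Proof.
have mY j : measurable_fun setT (Y j : T -> mR) by exact: (@measurable_funPT _ _ _ _ (Y j)).
pose D b j : set mR := if j == i then [set` Interval -oo%O (BSide b c)] else setT.
have mD b j : measurable (D b j) by rewrite /D; case: ifP => // _; exact: measurable_itv.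
have nD b j : ~ is_point (D b j).
  rewrite /D; case: ifP => _; last by apply: (not_point (x := 0) (y := 1)) => //; rewrite eq_sym oner_neq0.
  apply: (not_point (x := c - 1) (y := c - 2)) => /=.
  - by case: b; rewrite in_itv/= ?ltrBlDr ?lerBlDr ?ltrDl ?lerDl.
  - by case: b; rewrite in_itv/= ?ltrBlDr ?lerBlDr ?ltrDl ?lerDl.
  - by rewrite gt_eqF// ltrD2l ltrN2 ltr1n.
have DE b : P [set w | D b i (Y i w)] = box_law f Q (D b) \1_setT.
  rewrite -prob_value_box//; congr (P _); apply/seteqP; split=> w /=.
    by move=> h; split=> // j; have [->//|ji] := eqVneq j i; rewrite /D (negbTE ji).
  by move=> [_]; exact.
have : P [set w | D true i (Y i w)] = P [set w | D false i (Y i w)].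
  rewrite !DE; apply: (box_law_eq_domain Q mf f0) => //.
  move=> j G mG; rewrite !coord_integral_nonpoint// /D; case: ifP => // _.
  by rewrite integral_itv_bndo_bndc//; exact: measurable_funTS.
have mS b : measurable [set w | D b i (Y i w)].
  by rewrite -[X in measurable X]setTI; exact: mY.
have -> : [set w | Y i w = c] = [set w | D false i (Y i w)] `\` [set w | D true i (Y i w)].
  apply/seteqP; split=> w /=; rewrite /D eqxx /= !in_itv/=.
    by move=> ->; rewrite lexx ltxx.
  by move=> [yc /negP]; rewrite -leNgt => cy; apply/eqP; rewrite eq_le yc cy.
move=> DD; rewrite measureD//; last by rewrite ltey_eq fin_num_measure.
rewrite [X in (_ - P X)%E]setIidr; last first.
  by move=> w /=; rewrite /D eqxx /= !in_itv/= => /ltW.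
by rewrite DD subee// fin_num_measure.
Qed.

End SignalLaw.

(** * Symmetry *)

Section RaysDetermineLaw.
Context {R : realType}.
Notation mR := (measurableTypeR R).

Lemma eq_measure_rays (mu nu : {measure set mR -> \bar R}) :
  (forall A, measurable A -> mu A \is a fin_num) ->
  (forall x : R, mu `]-oo, x]%classic = nu `]-oo, x]%classic) ->
  forall A : set mR, measurable A -> mu A = nu A.
Proof.
move=> fmu munu.
have mray (x : R) : (measurable (`]-oo, x]%classic : set mR)) by exact: measurable_itv.
have fray (x : R) : nu `]-oo, x]%classic \is a fin_num by rewrite -munu fmu.
(* The intersection stands in for the ray up to [a] because [a] may exceed [b]. *)
have oc (m : {measure set mR -> \bar R}) (a b : R) :
    (m `]-oo, b]%classic \is a fin_num)%E ->
    m `]a, b]%classic = (m `]-oo, b]%classic - m (`]-oo, b]%classic `&` `]-oo, a]%classic))%E.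
  move=> fm; rewrite -measureD//; last by rewrite ltey_eq fm.
  congr (m _); apply/seteqP; split=> x /=; rewrite !in_itv/=.
    by move=> /andP[ax ->]; split=> //; apply/negP; rewrite -ltNge.
  by move=> [-> /negP]; rewrite -ltNge => ->.
pose g (k : nat) : set mR := `]- k%:R, k%:R]%classic.
apply: (@measure_unique _ R mR (@ocitv R) g _ _ _ _ mu nu) => //.
- exact: ocitvI.
- by move=> k; exact: is_ocitv.
- apply/seteqP; split=> // x _; exists (Num.truncn `|x|).+1 => //=.
  have := truncnS_gt `|x|; rewrite /g/= in_itv/= ltr_norml => /andP[-> /ltW ->//].
- move=> _ [[a b] _ <-] /=; rewrite !oc ?fmu// munu; congr (_ - _)%E.
  have [ab|ba] := leP a b.
    rewrite (_ : _ `&` _ = `]-oo, a]%classic)//.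
    by apply: setIidr => x /=; rewrite !in_itv/= => /le_trans; exact.
  rewrite (_ : _ `&` _ = `]-oo, b]%classic)//.
  by apply: setIidl => x /=; rewrite !in_itv/= => /le_trans; apply; exact: ltW.
- by move=> k; rewrite ltey_eq fmu//; exact: measurable_itv.
Qed.

(** Rays are traded for Borel sets one index at a time: with the other indices frozen, both sides
    are finite measures in the set at that index, and these are determined by rays. *)
Lemma joint_rays_determine_law d (T : measurableType d) (P : probability T R) (K : finType)
    (V W : K -> T -> mR) :
  (forall k, measurable_fun setT (V k)) -> (forall k, measurable_fun setT (W k)) ->
  (forall y : K -> R, P [set w | forall k, V k w <= y k] = P [set w | forall k, W k w <= y k]) ->
  forall C : K -> set mR, (forall k, measurable (C k)) ->
  P [set w | forall k, C k (V k w)] = P [set w | forall k, C k (W k w)].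
Proof.
move=> mV mW VW.
have mall (U : K -> T -> mR) (C : K -> set mR) (p : pred K) : (forall k, measurable_fun setT (U k)) ->
    (forall k, measurable (C k)) -> measurable [set w | forall k, p k -> C k (U k w)].
  move=> mU mC; rewrite (_ : [set w | _] = \bigcap_(k in [set k | p k]) (U k @^-1` C k))//.
  by apply: fin_bigcap_measurable => // k _; rewrite -[X in measurable X]setTI; exact: mU.
(* The list holds the indices whose set is already arbitrary; all others still carry rays. *)
suff H (s : seq K) (C : K -> set mR) : (forall k, measurable (C k)) ->
    (forall k, k \notin s -> exists y : R, C k = `]-oo, y]%classic) ->
    P [set w | forall k, C k (V k w)] = P [set w | forall k, C k (W k w)].
  by move=> C mC; apply: (H (enum K)) => // k; rewrite mem_enum.
elim: s C => [|j s IH] C mC rayC.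
  have /choice[y Cy] : forall k, exists y : R, C k = `]-oo, y]%classic by move=> k; exact: rayC.
  have UE (U : K -> T -> mR) : [set w | forall k, C k (U k w)] = [set w | forall k, U k w <= y k].
    apply/seteqP; split=> w /= h k; have := h k; rewrite Cy/= in_itv//=.
  by rewrite !UE.
pose E U := [set w : T | forall k : K, k != j -> C k (U k w)].
have mE U : (forall k, measurable_fun setT (U k)) -> measurable (E U).
  by move=> mU; exact: (mall U C (fun k => k != j)).
have EE U (A : set mR) : E U `&` U j @^-1` A =
    [set w | forall k, (if k == j then A else C k) (U k w)].
  apply/seteqP; split=> w /=.
    by move=> [Ew Aw] k; have [->//|] := eqVneq k j; exact: Ew.
  move=> h; split=> [k kj|]; last by have := h j; rewrite eqxx.
  by have := h k; rewrite (negbTE kj).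
have law U : (forall k, measurable_fun setT (U k)) -> exists m : {measure set mR -> \bar R},
    forall A, m A = P (E U `&` U j @^-1` A).
  move=> mU; unshelve eexists (pushforward (mrestr P (mE U mU)) (U j)); first exact: mU.
  by move=> A; rewrite setIC.
have [mu muE] := law V mV; have [nu nuE] := law W mW.
have EC U : [set w | forall k, C k (U k w)] = E U `&` U j @^-1` C j.
  by rewrite EE; apply/seteqP; split=> w /= h k; have := h k; case: eqVneq => // ->.
rewrite !EC -muE -nuE; apply: eq_measure_rays => // [A mA|x].
  rewrite muE fin_num_measure//; apply: measurableI; first exact: mE.
  by rewrite -[X in measurable X]setTI; exact: mV.
rewrite muE nuE !EE.
pose C' k : set mR := if k == j then [set` Interval -oo%O (BRight x)] else C k.
apply: (IH C') => k.
  by rewrite /C'; case: ifP => // _; exact: measurable_itv.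
rewrite /C'; case: eqVneq => [_ _|kj ks]; first by exists x.
by apply: rayC; rewrite inE negb_or kj.
Qed.

End RaysDetermineLaw.

(** * Positive dependence *)

Section CoinitialSequences.
Context {R : realType}.

(** A minimum gives a constant sequence. Otherwise running minima of a sequence approaching the
    infimum work; the infimum is extended-real because [I] may be unbounded below. *)
Lemma coinitial_seq (I : set R) : I !=set0 -> exists a_ : nat -> R,
  [/\ forall m, I (a_ m), {homo a_ : m m' / (m <= m')%N >-> m' <= m} &
      forall y, I y -> exists m, a_ m <= y].
Proof.
move=> I0; have [[l [Il lI]]|nomin] := pselect (exists l, I l /\ forall y, I y -> l <= y).
  by exists (fun=> l); split=> // y /lI ly; exists 0%N.
have [|u uI ucvg] := @ereal_inf_seq R (EFin @` I).
  by apply/set0P; case: I0 => x Ix; exists x%:E; exists x.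
have /choice[v /all_and2[Iv vu]] : forall i, exists x, I x /\ x%:E = u i.
  by move=> i; have [x] := uI i; exists x.
pose a_ := nat_rect (fun=> R) (v 0%N) (fun m am => Num.min am (v m.+1)).
have av m : a_ m <= v m by case: m => //= m; rewrite ge_min lexx orbT.
exists a_; split.
- by elim=> [|m IH] /=; [exact: Iv|rewrite minElt; case: ifP].
- apply: (@homo_leq _ a_ (fun x y => y <= x)) => // [y x z /[swap]|m /=].
    exact: le_trans.
  by rewrite ge_min lexx.
move=> y Iy; have [y' Iy' y'y] : exists2 y', I y' & y' < y.
  apply: contrapT => h; apply: nomin; exists y; split=> // y' Iy'.
  by rewrite leNgt; apply/negP => y'y; apply: h; exists y'.
have infy : (ereal_inf (EFin @` I) < y%:E)%E.
  apply: (@le_lt_trans _ _ y'%:E); last by rewrite lte_fin.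
  by apply: ereal_inf_lbound; exists y'.
have [m _ um] : \forall m \near \oo, (u m < y%:E)%E.
  exact: (ucvg _ (open_ereal_lt' infy)).
exists m; apply: (le_trans (av m)).
by have := um m (leqnn m); rewrite -vu lte_fin => /ltW.
Qed.

Lemma cofinal_seq (I : set R) : I !=set0 -> exists b_ : nat -> R,
  [/\ forall m, I (b_ m), {homo b_ : m m' / (m <= m')%N >-> m <= m'} &
      forall y, I y -> exists m, y <= b_ m].
Proof.
move=> [x Ix]; have [|a_ [Ia nia coa]] := @coinitial_seq [set x | I (- x)].
  by exists (- x) => /=; rewrite opprK.
exists (fun m => - a_ m); split=> [m|m m' mm'|y Iy].
- exact: Ia.
- by rewrite lerN2 nia.
- by have [|m am] := coa (- y); [rewrite /= opprK|exists m; rewrite lerNr].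
Qed.

(* Below z the sequence stays strictly, unless z is the minimum of I: then the
   part of I below z is a point, and the sequence is constantly z. *)
Lemma coinitial_seq_below (I : set R) z e : I z -> I e -> exists a_ : nat -> R,
  [/\ forall m, I (a_ m), forall m, a_ m <= z /\ a_ m <= e,
      {homo a_ : m m' / (m <= m')%N >-> m' <= m},
      forall y, I y -> exists m, a_ m <= y &
      (forall m, a_ m < z) \/ (forall y, I y -> z <= y)].
Proof.
move=> Iz Ie; have [[w [Iw wz]]|nw] := pselect (exists w, I w /\ w < z); last first.
  have zI y : I y -> z <= y.
    by move=> Iy; rewrite leNgt; apply/negP => yz; apply: nw; exists y.
  exists (fun=> z); split=> //; first by move=> m; split=> //; exact: zI.
    by move=> y /zI zy; exists 0%N.
  by right.
pose v := Num.min w e.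
have Iv : I v by rewrite /v minElt; case: ifP.
have vz : v < z by rewrite gt_min wz.
have [|a_ [Ia nia coa]] := @coinitial_seq [set x | I x /\ x <= v].
  by exists v; split.
exists a_; split=> // [m|m|y Iy|].
- by case: (Ia m).
- have [_ av] := Ia m; split; first exact: le_trans av (ltW vz).
  by apply: le_trans av _; rewrite ge_min lexx orbT.
- have [|m am] := coa (Num.min y v).
    by split; [rewrite minElt; case: ifP|rewrite ge_min lexx orbT].
  by exists m; apply: le_trans am _; rewrite ge_min lexx.
- by left=> m; have [_ av] := Ia m; exact: le_lt_trans av vz.
Qed.

End CoinitialSequences.

Section ClosedBoxes.
Context {R : realType} {n : nat}.
Notation mR := (measurableTypeR R).

Lemma measurable_closed_box (a b : 'I_n.+2 -> R) i : measurable (closed_box a b i : set mR).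
Proof. exact: measurable_itv. Qed.

Lemma closed_box_point (a b : 'I_n.+2 -> R) i : a i = b i -> is_point (closed_box a b i).
Proof. by move=> ab; exists (a i); rewrite /closed_box ab set_itv1. Qed.

Lemma closed_box_gt0 (I : set R) (f : n.+2.-tuple R -> R)
    (Q : R.-pker (n.+2.-tuple mR) ~> mR) a b :
  is_interval I -> measurable_fun setT (f : n.+2.-tuple mR -> R) ->
  (forall y, 0 <= f y) -> (forall y : n.+2.-tuple R, (forall i, I (tnth y i)) -> 0 < f y) ->
  box_in I a b -> (0 < box_law f Q (closed_box a b) (fun=> 1%R))%E.
Proof.
move=> hI mf f0 fI Iab; apply: (box_law_gt0 Q mf f0) => [i|i|y yab].
- exact: measurable_closed_box.
- have [_ _] := Iab i; rewrite le_eqVlt => /predU1P[ab|ab].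
    by left; exact: closed_box_point.
  by right; rewrite /closed_box lebesgue_measure_itv/= lte_fin ab -EFinB lte_fin subr_gt0.
- apply: fI => i; have [Ia Ib _] := Iab i.
  by apply: (hI _ _ Ia Ib); have := yab i; rewrite /closed_box/= in_itv.
Qed.

End ClosedBoxes.

Section DoubleExponential.
Context {R : realType}.

(** The Gumbel distribution function. It is strictly increasing with values in [0, 1], so positive
    dependence applies to it under any law of finite positive mass. *)
Definition double_exp (x : R) : R := expR (- expR (- x)).

Lemma double_exp_lt : {homo double_exp : x y / x < y}.
Proof. by move=> x y xy; rewrite ltr_expR ltrN2 ltr_expR ltrN2. Qed.

Lemma double_exp_le : {homo double_exp : x y / x <= y}.
Proof. exact/ltW_homo/double_exp_lt. Qed.

Lemma double_exp_ge0 x : 0 <= double_exp x. Proof. exact: expR_ge0. Qed.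

Lemma double_exp_le1 x : double_exp x <= 1.
Proof. by rewrite -expR0 ler_expR lerNl oppr0 expR_ge0. Qed.

Lemma double_exp01 x : 0 <= double_exp x <= 1.
Proof. by rewrite double_exp_ge0 double_exp_le1. Qed.

End DoubleExponential.

Section PositiveDependence.
Context {R : realType} {n : nat}.
Notation mR := (measurableTypeR R).

(** For nonnegative [h] this is [cond_mean] without the split into positive and negative parts. *)
Definition law_mean (M : (R -> R) -> \bar R) (h : R -> R) : R :=
  fine (M h) / fine (M (fun=> 1)).

(** Keeps the laws in the functional form that [cond_mean] takes while giving access to integration
    theory. *)
Definition is_integral (M : (R -> R) -> \bar R) := exists mu : {measure set mR -> \bar R},
  forall phi : R -> R, measurable_fun setT (phi : mR -> mR) -> (forall x, 0 <= phi x) ->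
  M phi = (\int[mu]_x (phi x)%:E)%E.

Section OneLaw.
Variable M : (R -> R) -> \bar R.
Hypotheses (iM : is_integral M) (M0 : (0 < M (fun=> 1%R))%E) (Moo : (M (fun=> 1%R) < +oo)%E).

Lemma law_ge0 h : measurable_fun setT (h : mR -> mR) -> (forall x, 0 <= h x) -> (0 <= M h)%E.
Proof.
by move=> mh h0; have [mu ->//] := iM; apply: integral_ge0 => x _; rewrite lee_fin.
Qed.

Lemma le_law h k : measurable_fun setT (h : mR -> mR) -> measurable_fun setT (k : mR -> mR) ->
  (forall x, 0 <= h x) -> (forall x, h x <= k x) -> (M h <= M k)%E.
Proof.
move=> mh mk h0 hk; have k0 x : 0 <= k x by exact: le_trans (hk x).
have [mu muE] := iM; rewrite !muE//; apply: ge0_le_integral => //.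
- by move=> x _; rewrite lee_fin.
- exact/measurable_EFinP.
- exact/measurable_EFinP.
- by move=> x _; rewrite lee_fin.
Qed.

Lemma lawD h k : measurable_fun setT (h : mR -> mR) -> measurable_fun setT (k : mR -> mR) ->
  (forall x, 0 <= h x) -> (forall x, 0 <= k x) -> M (fun x => h x + k x) = (M h + M k)%E.
Proof.
move=> mh mk h0 k0; have [mu muE] := iM; rewrite !muE//.
- by rewrite -ge0_integralD//; do ?exact/measurable_EFinP; move=> x _; rewrite lee_fin.
- exact: measurable_funD.
- by move=> x; rewrite addr_ge0.
Qed.

Lemma lawZ e h : 0 <= e -> measurable_fun setT (h : mR -> mR) ->
  (forall x, 0 <= h x) -> M (fun x => e * h x) = (e%:E * M h)%E.
Proof.
move=> e0 mh h0; have [mu muE] := iM; rewrite !muE//.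
- rewrite -ge0_integralZl// => [|x _]; last by rewrite lee_fin.
  exact/measurable_EFinP.
- exact: measurable_funM.
- by move=> x; rewrite mulr_ge0.
Qed.

Lemma law0 : M (fun=> 0) = 0%E.
Proof. by have [mu ->//] := iM; rewrite integral0. Qed.

Lemma law_fin c h : measurable_fun setT (h : mR -> mR) -> (forall x, 0 <= h x <= c) ->
  M h \is a fin_num.
Proof.
move=> mh hc; have h0 x : 0 <= h x by case/andP: (hc x).
have c0 : 0 <= c by apply: le_trans (h0 0) _; case/andP: (hc 0).
rewrite ge0_fin_numE; last exact: law_ge0.
apply: (@le_lt_trans _ _ (M (fun x => c * 1))).
  by apply: le_law => // x; rewrite mulr1; case/andP: (hc x).
rewrite (lawZ c0 (h := fun=> 1))// ?ler01//; exact: lte_mul_pinfty.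
Qed.

Lemma law1_fin : M (fun=> 1) \is a fin_num.
Proof. by apply: (@law_fin 1) => // x; rewrite ler01 lexx. Qed.

Lemma fine_law1_gt0 : 0 < fine (M (fun=> 1)).
Proof. by rewrite -lte_fin fineK// law1_fin. Qed.

Lemma law_meanE c h : measurable_fun setT (h : mR -> mR) -> (forall x, 0 <= h x <= c) ->
  M h = ((law_mean M h)%:E * M (fun=> 1%R))%E.
Proof.
move=> mh hc; rewrite -(fineK law1_fin) -EFinM divfK ?gt_eqF ?fine_law1_gt0//.
by rewrite fineK// (law_fin mh hc).
Qed.

Lemma law_mean_bounds h : measurable_fun setT (h : mR -> mR) -> (forall x, 0 <= h x <= 1) ->
  0 <= law_mean M h <= 1.
Proof.
move=> mh h01; have h0 x : 0 <= h x by case/andP: (h01 x).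
rewrite divr_ge0 ?fine_ge0//=; [|exact: law_ge0|exact: law_ge0].
rewrite ler_pdivrMr ?fine_law1_gt0// mul1r fine_le ?(law_fin mh h01) ?law1_fin//.
by apply: le_law => // x; case/andP: (h01 x).
Qed.

Lemma law_meanDZ e h k : 0 <= e ->
  measurable_fun setT (h : mR -> mR) -> measurable_fun setT (k : mR -> mR) ->
  (forall x, 0 <= h x <= 1) -> (forall x, 0 <= k x <= 1) ->
  law_mean M (fun x => h x + e * k x) = law_mean M h + e * law_mean M k.
Proof.
move=> e0 mh mk h01 k01.
have h0 x : 0 <= h x by case/andP: (h01 x).
have k0 x : 0 <= k x by case/andP: (k01 x).
rewrite /law_mean lawD//; last 2 first.
- exact: measurable_funM.
- by move=> x; rewrite mulr_ge0.
rewrite lawZ// fineD ?(law_fin mh h01)// ?fin_numM ?(law_fin mk k01)//.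
by rewrite fineM// ?(law_fin mk k01)// mulrDl mulrA.
Qed.

Lemma cond_mean_ge0 h : (forall x, 0 <= h x) -> cond_mean M h = law_mean M h.
Proof.
move=> h0; rewrite /cond_mean /law_mean.
rewrite (_ : (fun x => Num.max (h x) 0) = h); last by apply/funext => x; exact/max_idPl.
rewrite (_ : (fun x => Num.max (- h x) 0) = fun=> 0) ?law0 ?subr0//.
by apply/funext => x; apply/max_idPr; rewrite oppr_le0.
Qed.

Lemma cond_mean_exists_bounded c h : measurable_fun setT (h : mR -> mR) ->
  (forall x, 0 <= h x <= c) -> cond_mean_exists M h.
Proof.
move=> mh hc; split=> //; rewrite (_ : (fun x => `|h x|) = h); last first.
  by apply/funext => x; rewrite ger0_norm//; case/andP: (hc x).
by rewrite -ge0_fin_numE ?(law_fin mh hc)//; apply: law_ge0 => // x; case/andP: (hc x).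
Qed.

End OneLaw.

Variables (I : set R) (L : ('I_n.+2 -> R) -> ('I_n.+2 -> R) -> (R -> R) -> \bar R).
Hypothesis iL : forall a b, is_integral (L a b).
Hypothesis L_gt0 : forall a b, box_in I a b -> (0 < L a b (fun=> 1%R))%E.
Hypothesis hdep : forall h : R -> R, {homo h : x y / x < y} ->
  forall a b a' b' : 'I_n.+2 -> R, box_in I a b -> box_in I a' b' ->
  (forall i, a i <= a' i) -> (forall i, b i <= b' i) ->
  cond_mean_exists (L a b) h -> cond_mean_exists (L a' b') h ->
  cond_mean (L a b) h <= cond_mean (L a' b') h /\
  (a ord0 < a' ord0 \/ b ord0 < b' ord0 -> cond_mean (L a b) h < cond_mean (L a' b') h).

Section TwoBoxes.
Variables a b a' b' : 'I_n.+2 -> R.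
Hypotheses (Iab : box_in I a b) (Iab' : box_in I a' b').
Hypotheses (aa' : forall i, a i <= a' i) (bb' : forall i, b i <= b' i).
Hypotheses (foo : (L a b (fun=> 1%R) < +oo)%E) (foo' : (L a' b' (fun=> 1%R) < +oo)%E).

Lemma law_mean_lt : a ord0 < a' ord0 -> law_mean (L a b) double_exp < law_mean (L a' b') double_exp.
Proof.
move=> a0.
have md : measurable_fun setT (double_exp : mR -> mR).
  by apply: nondecreasing_measurable => //; exact: double_exp_le.
have [_] := hdep double_exp_lt Iab Iab' aa' bb'
  (cond_mean_exists_bounded (iL a b) (L_gt0 Iab) foo md double_exp01)
  (cond_mean_exists_bounded (iL a' b') (L_gt0 Iab') foo' md double_exp01).
rewrite !cond_mean_ge0//; do ?exact: double_exp_ge0.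
by apply; left.
Qed.

(* Positive dependence is only assumed for strictly increasing functions: h is
   perturbed into h + e * double_exp. *)
Lemma law_mean_le h : {homo h : x y / x <= y} -> (forall x, 0 <= h x <= 1) ->
  law_mean (L a b) h <= law_mean (L a' b') h.
Proof.
move=> ndh h01; apply/ler_addgt0Pr => e e0.
pose he x := h x + e * double_exp x.
have he_lt : {homo he : x y / x < y}.
  by move=> x y xy; rewrite ler_ltD// ?ndh 1?ltW// ltr_pM2l// double_exp_lt.
have h0 x : 0 <= h x by case/andP: (h01 x).
have he0 x : 0 <= he x by rewrite addr_ge0// mulr_ge0 ?double_exp_ge0// ltW.
have he2 x : 0 <= he x <= 1 + e.
  rewrite he0 lerD//; first by case/andP: (h01 x).
  by rewrite ger_pMr// double_exp_le1.
have mh : measurable_fun setT (h : mR -> mR) by exact: nondecreasing_measurable.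
have md : measurable_fun setT (double_exp : mR -> mR).
  by apply: nondecreasing_measurable => //; exact: double_exp_le.
have mhe : measurable_fun setT (he : mR -> mR).
  by apply: nondecreasing_measurable => //; exact/ltW_homo.
have [] := hdep he_lt Iab Iab' aa' bb'
  (cond_mean_exists_bounded (iL a b) (L_gt0 Iab) foo mhe he2)
  (cond_mean_exists_bounded (iL a' b') (L_gt0 Iab') foo' mhe he2).
rewrite !cond_mean_ge0// => le _.
have := law_meanDZ (iL a b) foo (ltW e0) mh md h01 double_exp01.
have := law_meanDZ (iL a' b') foo' (ltW e0) mh md h01 double_exp01.
have /andP[d0 _] := law_mean_bounds (iL a b) (L_gt0 Iab) foo md double_exp01.
have /andP[_ d1] := law_mean_bounds (iL a' b') (L_gt0 Iab') foo' md double_exp01.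
rewrite -/he => e1 e2.
apply: (@le_trans _ _ (law_mean (L a b) he)); first by rewrite e2 lerDl mulr_ge0// ltW.
by apply: le_trans le _; rewrite e1 lerD2l ger_pMr.
Qed.

End TwoBoxes.

End PositiveDependence.

(** * Closed truncations of the slices where Z_1 is attained *)

Section TopBoxes.
Context {R : realType} {n : nat}.
Notation mR := (measurableTypeR R).
Variables (I : set R) (f : n.+2.-tuple R -> R) (Q : R.-pker (n.+2.-tuple mR) ~> mR).
Hypothesis hI : is_interval I.
Hypothesis mf : measurable_fun setT (f : n.+2.-tuple mR -> R).
Hypothesis f0 : forall y, 0 <= f y.

Lemma measurable_top_signal_box y1 z1 (k i : 'I_n.+2) : measurable (top_signal_box I y1 z1 k i : set mR).
Proof.
rewrite /top_signal_box; case: ifP => _; first exact: measurable_set1.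
case: ifP => _; first exact: measurable_set1.
by apply: measurableI; [exact: is_interval_measurable|exact: measurable_itv].
Qed.

Lemma top_le_signal_law y1 z1 k h : k != ord0 -> (forall x, 0 <= h x) ->
  (box_law f Q (top_signal_box I y1 z1 k) h <= signal_law I f Q y1 z1 h)%E.
Proof.
move=> k0 h0; rewrite /signal_law (bigD1 k)//= leeDl//.
by apply: sume_ge0 => j _; exact: box_law_ge0.
Qed.

(** Lower corner of [top_signal_box] cut off at [a]: the competitors other than [k] range over
    [a, z]. Positive dependence speaks of closed boxes only, whereas [I] may be unbounded or open
    below. *)
Definition top_lower (y1 z : R) (k : 'I_n.+2) (a : R) (i : 'I_n.+2) : R :=
  if i == ord0 then y1 else if i == k then z else a.

Definition top_upper (y1 z : R) (i : 'I_n.+2) : R := if i == ord0 then y1 else z.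

(** The last clause makes [a, z] a point exactly when the part of [I] below z is one, so that a
    slice and its truncations treat each coordinate by the same kind of integration. *)
Definition below_in a z := [/\ I a, a <= z & a < z \/ (forall y, I y -> z <= y)].

Lemma top_box_in y1 z k a : I y1 -> I z -> below_in a z ->
  box_in I (top_lower y1 z k a) (top_upper y1 z).
Proof.
move=> Iy Iz [Ia az _] i; rewrite /top_lower /top_upper.
by case: ifP => // _; case: ifP.
Qed.

Lemma top_box_sub y1 z k a i : I z -> below_in a z ->
  closed_box (top_lower y1 z k a) (top_upper y1 z) i `<=` top_signal_box I y1 z k i.
Proof.
move=> Iz [Ia az _]; rewrite /closed_box /top_lower /top_upper /top_signal_box.
case: ifP => _; first by rewrite set_itv1.
case: ifP => _; first by rewrite set_itv1.
move=> x /=; rewrite !in_itv/= => /andP[ax xz]; split=> //.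
by apply: (hI Ia Iz); rewrite ax.
Qed.

Lemma top_box_point y1 z k a i : I z -> below_in a z ->
  is_point (closed_box (top_lower y1 z k a) (top_upper y1 z) i) <->
  is_point (top_signal_box I y1 z k i).
Proof.
move=> Iz [Ia az az']; rewrite /closed_box /top_lower /top_upper /top_signal_box.
case: ifP => _; first by rewrite set_itv1.
case: ifP => _; first by rewrite set_itv1.
case: az' => [az'|zI].
  split=> h; exfalso; move: h; apply: (not_point (x := a) (y := z));
    by rewrite /= ?in_itv/= ?lexx ?az ?lt_eqF.
have za : a = z by apply/eqP; rewrite eq_le az zI.
rewrite za set_itv1 (_ : I `&` _ = [set z])//.
apply/seteqP; split=> x /=; rewrite in_itv/=; last by move=> ->.
by move=> [/zI zx xz]; apply/eqP; rewrite eq_le xz zx.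
Qed.

Lemma top_box_le y1 z k a h : I z -> below_in a z ->
  measurable_fun setT (h : mR -> mR) -> (forall x, 0 <= h x) ->
  (box_law f Q (closed_box (top_lower y1 z k a) (top_upper y1 z)) h <=
   box_law f Q (top_signal_box I y1 z k) h)%E.
Proof.
move=> Iz az mh h0; apply: (le_box_law Q mf f0) => // i.
- exact: measurable_top_signal_box.
- exact: measurable_closed_box.
- exact: top_box_sub.
- exact: top_box_point.
Qed.

Lemma top_box_cvg y1 z k (a_ : nat -> R) h : I z -> (forall m, below_in (a_ m) z) ->
  {homo a_ : m m' / (m <= m')%N >-> m' <= m} -> (forall y, I y -> exists m, a_ m <= y) ->
  measurable_fun setT (h : mR -> mR) -> (forall x, 0 <= h x) ->
  box_law f Q (closed_box (top_lower y1 z k (a_ m)) (top_upper y1 z)) h @[m --> \oo] -->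
  box_law f Q (top_signal_box I y1 z k) h.
Proof.
move=> Iz az nia coa mh h0; have H := @box_law_cvg R n.+2 f Q mf f0 (top_signal_box I y1 z k)
  (fun m => closed_box (top_lower y1 z k (a_ m)) (top_upper y1 z)) h. apply: H => //.
- by move=> i; exact: measurable_top_signal_box.
- by move=> m i; exact: measurable_closed_box.
- by move=> m i; exact: top_box_sub.
- by move=> m i; exact: top_box_point.
- move=> i m m' mm' x; rewrite /closed_box /top_lower /top_upper.
  case: ifP => // _; case: ifP => // _; rewrite /= !in_itv/= => /andP[amx ->].
  by rewrite andbT (le_trans _ amx)// nia.
- move=> i x; rewrite /closed_box /top_lower /top_upper /top_signal_box.
  case: ifP => _; first by exists 0%N; rewrite set_itv1.
  case: ifP => _; first by exists 0%N; rewrite set_itv1.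
  move=> [/coa[m am] /=]; rewrite in_itv/= => xz; exists m; rewrite in_itv/=.
  by rewrite am.
Qed.

End TopBoxes.

Lemma is_integral_sum {R : realType} (J : Type) (s : seq J) (p : pred J)
    (M : J -> (R -> R) -> \bar R) : (forall j, is_integral (M j)) ->
  is_integral (fun h => \sum_(j <- s | p j) M j h)%E.
Proof.
move=> iM; elim: s => [|j s [mu muE]].
  by exists mzero => h mh h0; rewrite big_nil integral_measure_zero.
have [nu nuE] := iM j; case pj : (p j); last first.
  by exists mu => h mh h0; rewrite big_cons pj muE.
exists (measure_add nu mu) => h mh h0; rewrite big_cons pj muE// nuE//.
by rewrite ge0_integral_measure_add// => [x _|]; [rewrite lee_fin|exact/measurable_EFinP].
Qed.

(** * Dominance of the diagonal slices by boxes and by later slices *)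

Section Dominance.
Context {R : realType} {n : nat}.
Notation mR := (measurableTypeR R).
Variables (I : set R) (L : ('I_n.+2 -> R) -> ('I_n.+2 -> R) -> (R -> R) -> \bar R).
Variable B : R -> 'I_n.+2 -> (R -> R) -> \bar R.
Hypothesis iL : forall a b, is_integral (L a b).
Hypothesis L_gt0 : forall a b, box_in I a b -> (0 < L a b (fun=> 1%R))%E.
Hypothesis hdep : forall h : R -> R, {homo h : x y / x < y} ->
  forall a b a' b' : 'I_n.+2 -> R, box_in I a b -> box_in I a' b' ->
  (forall i, a i <= a' i) -> (forall i, b i <= b' i) ->
  cond_mean_exists (L a b) h -> cond_mean_exists (L a' b') h ->
  cond_mean (L a b) h <= cond_mean (L a' b') h /\
  (a ord0 < a' ord0 \/ b ord0 < b' ord0 -> cond_mean (L a b) h < cond_mean (L a' b') h).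
Hypothesis L_fin : forall a b : 'I_n.+2 -> R, (forall i, a i < b i) -> (L a b (fun=> 1%R) < +oo)%E.
Hypothesis L_perm : forall (sigma : {perm 'I_n.+2}) (a b : 'I_n.+2 -> R) (h : R -> R),
  sigma ord0 = ord0 -> (forall i, a i < b i) ->
  measurable_fun setT (h : mR -> mR) -> (forall x, 0 <= h x) ->
  L (a \o sigma) (b \o sigma) h = L a b h.
Hypothesis iB : forall z k, is_integral (B z k).
Hypothesis L_le_B : forall z k a h, I z -> below_in I a z ->
  measurable_fun setT (h : mR -> mR) -> (forall x, 0 <= h x) ->
  (L (top_lower z z k a) (top_upper z z) h <= B z k h)%E.
Hypothesis L_cvg_B : forall z k (a_ : nat -> R) h, I z -> (forall m, below_in I (a_ m) z) ->
  {homo a_ : m m' / (m <= m')%N >-> m' <= m} -> (forall y, I y -> exists m, a_ m <= y) ->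
  measurable_fun setT (h : mR -> mR) -> (forall x, 0 <= h x) ->
  L (top_lower z z k (a_ m)) (top_upper z z) h @[m --> \oo] --> B z k h.

Definition sum_top_law z h := (\sum_(k < n.+2 | k != ord0) B z k h)%E.

Hypothesis sum_top_fin : forall z, I z -> (sum_top_law z (fun=> 1%R) < +oo)%E.

Lemma top_le_sum z k h : k != ord0 -> measurable_fun setT (h : mR -> mR) ->
  (forall x, 0 <= h x) -> (B z k h <= sum_top_law z h)%E.
Proof.
move=> k0 mh h0; rewrite /sum_top_law (bigD1 k)//= leeDl//.
by apply: sume_ge0 => j _; exact: law_ge0.
Qed.

Lemma truncated_top_fin z k a : I z -> below_in I a z -> k != ord0 ->
  (L (top_lower z z k a) (top_upper z z) (fun=> 1%R) < +oo)%E.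
Proof.
move=> Iz az k0; apply: le_lt_trans (sum_top_fin Iz).
apply: le_trans (top_le_sum z k0 _ _) => //; first exact: L_le_B.
Qed.

(** The boxes that dominate all slices at z. Strict sides allow the signals to be permuted, so the
    competitor with the high lower edge need not be the one that attains Z_1 in the slice. *)
Definition lower_bound_box (z : R) (a b : 'I_n.+2 -> R) := [/\ forall i, a i < b i,
  forall i, z <= b i, z <= a ord0 & exists2 k, k != ord0 & z <= a k].

Lemma truncated_top_le_box z j c a b h : I z -> j != ord0 -> below_in I c z ->
  box_in I a b -> lower_bound_box z a b -> (forall i, c <= a i) ->
  {homo h : x y / x <= y} -> (forall x, 0 <= h x <= 1) ->
  law_mean (L (top_lower z z j c) (top_upper z z)) h <= law_mean (L a b) h.
Proof.
move=> Iz j0 cz Iab [ab zb za [k k0 zk]] ca ndh h01.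
have mh : measurable_fun setT (h : mR -> mR) by exact: nondecreasing_measurable.
have h0 x : 0 <= h x by case/andP: (h01 x).
(* The transposition moves the edge that is at least z onto coordinate [j], where the slice is
   pinned at z; afterwards all edges compare coordinatewise. *)
pose s := tperm j k; have s0 : s ord0 = ord0 by rewrite tpermD.
have -> : law_mean (L a b) h = law_mean (L (a \o s) (b \o s)) h.
  by rewrite /law_mean !L_perm.
apply: (law_mean_le iL L_gt0 hdep) => //.
- exact: top_box_in.
- by move=> i; exact: Iab.
- move=> i; rewrite /top_lower /=; case: eqVneq => [->|i0]; first by rewrite s0.
  by case: eqVneq => [->|//]; rewrite tpermL.
- by move=> i; rewrite /top_upper if_same /=.
- exact: truncated_top_fin.
- by apply: L_fin => i /=.
Qed.

Lemma coinitial_below z e : I z -> I e -> exists a_ : nat -> R,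
  [/\ forall m, below_in I (a_ m) z, forall m, a_ m <= e,
      {homo a_ : m m' / (m <= m')%N >-> m' <= m} & forall y, I y -> exists m, a_ m <= y].
Proof.
move=> Iz Ie; have [a_ [Ia_ a_le nia coa a_below]] := coinitial_seq_below Iz Ie.
exists a_; split=> // m; last by case: (a_le m).
split=> //; first by case: (a_le m).
by case: a_below => [lt|?]; [left|right].
Qed.

(** Each slice is exhausted by truncations that lie below the box. The bound is left unnormalized
    because the slices have different masses and are summed before dividing. *)
Lemma sum_top_le_box z a b h : I z -> box_in I a b -> lower_bound_box z a b ->
  {homo h : x y / x <= y} -> (forall x, 0 <= h x <= 1) ->
  (sum_top_law z h <= (law_mean (L a b) h)%:E * sum_top_law z (fun=> 1%R))%E.
Proof.
move=> Iz Iab zab ndh h01.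
have mh : measurable_fun setT (h : mR -> mR) by exact: nondecreasing_measurable.
have h0 x : 0 <= h x by case/andP: (h01 x).
rewrite /sum_top_law ge0_sume_distrr; last by move=> j _; apply: law_ge0.
apply: lee_sum => j j0.
(* A common lower bound of the edges of the box; truncations starting below it are dominated from
   the first one on. *)
have [e Ie ea] : exists2 e, I e & forall i, e <= a i.
  exists (\big[Num.min/a ord0]_i a i).
    by apply: (big_ind I) => [|x y Ix Iy|i _];
      [by case: (Iab ord0)|rewrite minElt; case: ifP|by case: (Iab i)].
  by move=> i; exact: bigmin_le_cond.
have [a_ [below a_le nia coa]] := coinitial_below Iz Ie.
have cvgh := @L_cvg_B z j a_ h Iz below nia coa mh h0.
apply: (cvge_le _ cvgh) => //; apply: nearW => m.
rewrite (law_meanE (iL _ _) (L_gt0 (top_box_in j Iz Iz (below m)))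
  (truncated_top_fin Iz (below m) j0) mh h01).
apply: lee_pmul => //.
- rewrite lee_fin; have /andP[//] := law_mean_bounds (iL _ _)
    (L_gt0 (top_box_in j Iz Iz (below m))) (truncated_top_fin Iz (below m) j0) mh h01.
- exact: law_ge0.
- rewrite lee_fin; apply: truncated_top_le_box => // i.
  exact: le_trans (a_le m) (ea i).
- exact: L_le_B.
Qed.

Lemma sum_top_gt0 z : I z -> (0 < sum_top_law z (fun=> 1%R))%E.
Proof.
move=> Iz; have k0 : lift ord0 ord0 != ord0 :> 'I_n.+2 by [].
have [a_ [below _ _ _]] := coinitial_below Iz Iz.
apply: lt_le_trans (top_le_sum z k0 _ _) => //.
by apply: lt_le_trans (@L_le_B z (lift ord0 ord0) (a_ 0%N) _ Iz (below 0%N) _ _) => //;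
  apply: L_gt0; exact: top_box_in.
Qed.

Lemma integral_sum_top z : is_integral (sum_top_law z).
Proof. by apply: is_integral_sum => k; exact: iB. Qed.

(** Between the law at z and slice [j] at z' stands the box whose lower corner is that of a
    truncation at z and whose upper edges are all z'. It dominates every slice at z, and it lies
    below the truncation of slice [j] at z' without any permutation. *)
Lemma sum_top_mono z z' h : I z -> I z' -> z < z' ->
  {homo h : x y / x <= y} -> (forall x, 0 <= h x <= 1) ->
  law_mean (sum_top_law z) h <= law_mean (sum_top_law z') h.
Proof.
move=> Iz Iz' zz' ndh h01.
have mh : measurable_fun setT (h : mR -> mR) by exact: nondecreasing_measurable.
have h0 x : 0 <= h x by case/andP: (h01 x).
have iS := integral_sum_top.
set c := law_mean (sum_top_law z) h.
have /andP[c0 c1] := law_mean_bounds (iS z) (sum_top_gt0 Iz) (sum_top_fin Iz) mh h01.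
rewrite -/c in c0 c1.
suff : (c%:E * sum_top_law z' (fun=> 1%R) <= sum_top_law z' h)%E.
  rewrite (law_meanE (iS z') (sum_top_gt0 Iz') (sum_top_fin Iz') mh h01).
  have := sum_top_gt0 Iz'; rewrite -(fineK (law1_fin (iS z') (sum_top_fin Iz'))) -!EFinM.
  by rewrite lte_fin lee_fin => S0; rewrite ler_pM2r.
rewrite /sum_top_law ge0_sume_distrr; last by move=> j _; apply: law_ge0.
apply: lee_sum => j j0.
(* Truncation levels that exhaust the slice at z' but never exceed z, so that the lower corner of
   the inserted box stays at or below z. *)
have [a_ [below a_le nia coa]] := coinitial_below Iz' Iz.
have cvg1 := @L_cvg_B z' j a_ (fun=> 1) Iz' below nia coa (measurable_cst _) (fun=> ler01).
apply: (cvge_le _ (cvgeZl _ cvg1)) => //; apply: nearW => m.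
pose a := top_lower z z j (a_ m); pose b := fun _ : 'I_n.+2 => z'.
have Ia m' : I (a_ m') by case: (below m').
have az i : a i <= z by rewrite /a /top_lower; case: ifP => // _; case: ifP.
have Iab : box_in I a b.
  move=> i; split=> //; last exact: le_trans (az i) (ltW zz').
  by rewrite /a /top_lower; case: ifP => // _; case: ifP.
have zab : lower_bound_box z a b.
  split=> [i|i||]; first exact: le_lt_trans (az i) zz'.
  - exact: ltW.
  - by rewrite /a /top_lower eqxx.
  - by exists j => //; rewrite /a /top_lower (negbTE j0) eqxx.
have cL : c <= law_mean (L a b) h.
  have := sum_top_le_box Iz Iab zab ndh h01.
  rewrite (law_meanE (iS z) (sum_top_gt0 Iz) (sum_top_fin Iz) mh h01) -/c.
  have := sum_top_gt0 Iz; rewrite -(fineK (law1_fin (iS z) (sum_top_fin Iz))) -!EFinM.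
  by rewrite lte_fin lee_fin => S0; rewrite ler_pM2r.
apply: le_trans (@L_le_B z' j (a_ m) h Iz' (below m) mh h0).
rewrite (law_meanE (iL _ _) (L_gt0 (top_box_in j Iz' Iz' (below m)))
  (truncated_top_fin Iz' (below m) j0) mh h01).
apply: lee_wpmul2r; first exact: law_ge0.
rewrite lee_fin (le_trans cL)//; apply: (law_mean_le iL L_gt0 hdep) => //.
- exact: top_box_in.
- move=> i; rewrite /a /top_lower; case: ifP => _; first exact: ltW.
  by case: ifP => _ //; exact: ltW.
- by move=> i; rewrite /top_upper if_same.
- by apply: L_fin; case: zab.
- exact: truncated_top_fin.
Qed.

End Dominance.

Section LawMeanComparison.
Context {R : realType}.
Notation mR := (measurableTypeR R).
Variables M M' : (R -> R) -> \bar R.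
Hypotheses (iM : is_integral M) (M0 : (0 < M (fun=> 1%R))%E) (Moo : (M (fun=> 1%R) < +oo)%E).
Hypotheses (iM' : is_integral M') (M'0 : (0 < M' (fun=> 1%R))%E) (M'oo : (M' (fun=> 1%R) < +oo)%E).
Variable h : R -> R.
Hypotheses (mh : measurable_fun setT (h : mR -> mR)) (h01 : forall x, 0 <= h x <= 1).

Lemma law_le_mean_cross : (M h <= (law_mean M' h)%:E * M (fun=> 1%R))%E ->
  (M h * M' (fun=> 1%R) <= M' h * M (fun=> 1%R))%E.
Proof.
move=> le; rewrite (law_meanE iM' M'0 M'oo mh h01) [leRHS]muleAC.
by apply: lee_wpmul2r; [exact: ltW|exact: le].
Qed.

Lemma law_mean_le_cross : law_mean M h <= law_mean M' h ->
  (M h * M' (fun=> 1%R) <= M' h * M (fun=> 1%R))%E.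
Proof.
move=> le; apply: law_le_mean_cross; rewrite (law_meanE iM M0 Moo mh h01).
by apply: lee_wpmul2r; [exact: ltW|rewrite lee_fin].
Qed.

End LawMeanComparison.

(** * Strict positive dependence excludes point masses *)

Section StrictDominance.
Context {R : realType} {n : nat}.
Notation mR := (measurableTypeR R).
Variables (I : set R) (L : ('I_n.+2 -> R) -> ('I_n.+2 -> R) -> (R -> R) -> \bar R).
Hypothesis iL : forall a b, is_integral (L a b).
Hypothesis L_gt0 : forall a b, box_in I a b -> (0 < L a b (fun=> 1%R))%E.
Hypothesis hdep : forall h : R -> R, {homo h : x y / x < y} ->
  forall a b a' b' : 'I_n.+2 -> R, box_in I a b -> box_in I a' b' ->
  (forall i, a i <= a' i) -> (forall i, b i <= b' i) ->
  cond_mean_exists (L a b) h -> cond_mean_exists (L a' b') h ->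
  cond_mean (L a b) h <= cond_mean (L a' b') h /\
  (a ord0 < a' ord0 \/ b ord0 < b' ord0 -> cond_mean (L a b) h < cond_mean (L a' b') h).
Hypothesis L_fin : forall a b : 'I_n.+2 -> R, (forall i, a i < b i) -> (L a b (fun=> 1%R) < +oo)%E.

(** Beyond [t] the test function is at most 1, and that region is null; elsewhere it is at most its
    value at [t]. *)
Lemma law_mean_tail_le (M : (R -> R) -> \bar R) t : is_integral M ->
  (0 < M (fun=> 1%R))%E -> (M (fun=> 1%R) < +oo)%E ->
  M \1_(`]t, +oo[%classic) = 0%E -> law_mean M double_exp <= double_exp t.
Proof.
move=> iM M0 Moo Mt.
have md : measurable_fun setT (double_exp : mR -> mR).
  by apply: nondecreasing_measurable => //; exact: double_exp_le.
have mt : measurable_fun setT (\1_(`]t, +oo[%classic) : mR -> mR).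
  by apply: measurable_indic; exact: measurable_itv.
have := @le_law R M iM double_exp (fun x => \1_(`]t, +oo[%classic) x + double_exp t * 1) md _ _ _.
rewrite lawD//; last by move=> x; rewrite mulr_ge0// double_exp_ge0.
rewrite lawZ ?double_exp_ge0// Mt add0e.
rewrite (law_meanE iM M0 Moo md double_exp01) -(fineK (law1_fin iM Moo)) -!EFinM.
have := fine_law1_gt0 iM M0 Moo => m0 H.
rewrite -(ler_pM2r m0) -lee_fin; apply: H.
- exact: measurable_funD.
- exact: double_exp_ge0.
- move=> x; rewrite mulr1 indicE; case: (boolP (x \in _)) => [_|/negP xt].
    by rewrite (le_trans (double_exp_le1 x))// lerDl double_exp_ge0.
  rewrite add0r double_exp_le// leNgt; apply/negP => tx; apply: xt.
  by rewrite inE/= in_itv/= tx.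
Qed.

Lemma law_mean_point_ge (M : (R -> R) -> \bar R) v : is_integral M ->
  (0 < M (fun=> 1%R))%E -> (M (fun=> 1%R) < +oo)%E ->
  M \1_(~` [set v]) = 0%E -> double_exp v <= law_mean M double_exp.
Proof.
move=> iM M0 Moo Mv.
have md : measurable_fun setT (double_exp : mR -> mR).
  by apply: nondecreasing_measurable => //; exact: double_exp_le.
have mv : measurable_fun setT (\1_(~` [set v]) : mR -> mR).
  by apply: measurable_indic; apply: measurableC; exact: measurable_set1.
have := @le_law R M iM (fun x => double_exp v * 1) (fun x => \1_(~` [set v]) x + double_exp x) _ _ _ _.
rewrite lawD//; last exact: double_exp_ge0.
rewrite lawZ ?double_exp_ge0// Mv add0e.
rewrite (law_meanE iM M0 Moo md double_exp01) -(fineK (law1_fin iM Moo)) -!EFinM.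
have := fine_law1_gt0 iM M0 Moo => m0 H.
rewrite -(ler_pM2r m0) -lee_fin; apply: H.
- exact: measurable_cst.
- exact: measurable_funD.
- by move=> x; rewrite mulr1 double_exp_ge0.
- move=> x; rewrite mulr1 indicE; case: (boolP (x \in _)) => [_|/negP xv].
    by rewrite (le_trans (double_exp_le1 v))// lerDl double_exp_ge0.
  rewrite add0r (_ : x = v)//; apply: contrapT => xv'; apply: xv.
  by rewrite inE.
Qed.

(* If the law were concentrated at v, then, by strict positive dependence, raising
   y_1 from z to c should raise the conditional mean. *)
Lemma no_concentration z c d e j v : I z -> I c -> I d -> I e -> e < z -> z < c -> c < d ->
  j != ord0 ->
  (L (top_lower z z j e) (top_upper z z) (fun=> 1%R) < +oo)%E ->
  (L (top_lower c z j e) (top_upper c z) (fun=> 1%R) < +oo)%E ->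
  L (top_lower z z j e) (top_upper z z) \1_(~` [set v]) = 0%E ->
  (forall t, v < t -> exists b, [/\ I b, z < b &
     L (top_lower c z j e) (top_upper d b) \1_(`]t, +oo[%classic) = 0%E]) ->
  False.
Proof.
move=> Iz Ic Id Ie ez zc cd j0 foo foo' Lv Lt.
have below : below_in I e z by split=> //; [exact: ltW|left].
have Ibox y : I y -> box_in I (top_lower y z j e) (top_upper y z).
  by move=> Iy; exact: top_box_in.
have := law_mean_lt iL L_gt0 hdep (Ibox _ Iz) (Ibox _ Ic) _ _ foo foo' _.
set m1 := law_mean _ _; set m2 := law_mean _ _ => m12.
have {}m12 : m1 < m2.
  apply: m12 => [i|i|]; rewrite /top_lower /top_upper ?eqxx//; case: ifP => //; by move=> _; exact: ltW.
have vm1 : double_exp v <= m1 by apply: law_mean_point_ge => //; exact: L_gt0 (Ibox _ Iz).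
(* The box with y_1 in [c, d] and the competitors up to [b] dominates the law at y_1 = c, so the
   latter inherits the null tail. Letting [t] decrease to [v] then contradicts the strict increase
   from z to c. *)
have m2t t : v < t -> m2 <= double_exp t.
  move=> /Lt[b [Ib zb Lb]].
  have ab i : top_lower c z j e i < top_upper d b i.
    rewrite /top_lower /top_upper; case: ifP => // _; case: ifP => // _.
    exact: lt_trans ez zb.
  have Iab : box_in I (top_lower c z j e) (top_upper d b).
    move=> i; split; last exact: ltW.
      by rewrite /top_lower; case: ifP => // _; case: ifP.
    by rewrite /top_upper; case: ifP.
  apply: law_mean_tail_le => //; first exact: L_gt0 (Ibox _ Ic).
  have nd1 : {homo (\1_(`]t, +oo[%classic) : R -> R) : x y / x <= y}.
    move=> x y xy; rewrite !indicE ler_nat; case: (boolP (x \in _)) => // /set_mem/=.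
    by rewrite in_itv/= andbT => tx; rewrite mem_set//= in_itv/= (lt_le_trans tx).
  have h01 x : 0 <= (\1_(`]t, +oo[%classic) x : R) <= 1.
    by rewrite indicE; case: (_ \in _); rewrite ?lexx ?ler01.
  have mt : measurable_fun setT (\1_(`]t, +oo[%classic) : mR -> mR).
    by apply: measurable_indic; exact: measurable_itv.
  have := law_mean_le iL L_gt0 hdep (Ibox _ Ic) Iab _ _ foo' (L_fin ab) nd1 h01.
  rewrite {2}/law_mean Lb mul0r => H.
  rewrite (law_meanE (iL _ _) (L_gt0 (Ibox _ Ic)) foo' mt h01).
  have -> : law_mean (L (top_lower c z j e) (top_upper c z)) \1_(`]t, +oo[%classic) = 0.
    apply/eqP; rewrite eq_le (andP (law_mean_bounds (iL _ _) (L_gt0 (Ibox _ Ic)) foo' mt h01)).1 andbT.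
    apply: H => // i; rewrite /top_upper; case: ifP => // _; exact: ltW.
  by rewrite mul0e.
have : m2 <= double_exp v.
  have cd' : double_exp (v + m.+1%:R^-1) @[m --> \oo] --> double_exp v.
    have : v + m.+1%:R^-1 @[m --> \oo] --> v.
      by rewrite -[X in _ --> X]addr0; apply: cvgD; [exact: cvg_cst|exact: cvg_harmonic].
    move=> vm; rewrite /double_exp.
    apply: continuous_cvg; first exact: continuous_expR.
    apply: cvgN; apply: continuous_cvg; first exact: continuous_expR.
    exact: cvgN.
  rewrite -(cvg_lim (@Rhausdorff R) cd'); apply: limr_ge; first by apply: cvgP cd'.
  apply: nearW => m; apply: m2t.
  by rewrite ltrDl invr_gt0 ltr0n.
by move=> m2v; have := lt_le_trans m12 m2v; rewrite ltNge vm1.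
Qed.

End StrictDominance.

(** * Stochastic order of finite measures *)

Section StochasticOrder.
Context {R : realType}.
Notation mR := (measurableTypeR R).
Implicit Types mu nu : {measure set mR -> \bar R}.

(** First-order stochastic dominance of the normalized measures, cross-multiplied by the total
    masses. *)
Definition stochastic_le mu nu := forall h : R -> R,
  {homo h : x y / x <= y} -> (forall x, 0 <= h x <= 1) ->
  (\int[mu]_x (h x)%:E * nu setT <= \int[nu]_x (h x)%:E * mu setT)%E.

Lemma truncation_cvg mu (h : R -> R) : measurable_fun setT (h : mR -> mR) ->
  (forall x, 0 <= h x) ->
  (\int[mu]_x (Num.min (h x) m.+1%:R)%:E)%E @[m --> \oo] --> (\int[mu]_x (h x)%:E)%E.
Proof.
move=> mh h0.
have := @cvg_monotone_convergence _ _ _ mu setT measurableT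
  (fun m x => (Num.min (h x) m.+1%:R)%:E) _ _ _.
rewrite (_ : (\int[mu]_x limn _)%E = (\int[mu]_x (h x)%:E)%E); last first.
  apply: eq_integral => x _; apply/cvg_lim => //; apply: cvg_near_cst.
  exists (Num.truncn (h x)) => // m /= hm; congr EFin; apply/min_idPl.
  by rewrite (le_trans (ltW (truncnS_gt _)))// ler_nat.
apply=> [m|m x _|x _ m m' mm'].
- by apply/measurable_EFinP; exact: measurable_minr.
- by rewrite lee_fin le_min h0 ler0n.
- by rewrite lee_fin le_min ge_min lexx/= ge_min ler_nat ltnS mm' orbT.
Qed.

Arguments truncation_cvg : clear implicits.

(** Truncation at m + 1 and division by m + 1 give a test function with values in [0, 1]; monotone
    convergence removes the truncation. *)
Lemma stochastic_le_ge0 mu nu (h : R -> R) : (mu setT < +oo)%E -> (nu setT < +oo)%E ->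
  stochastic_le mu nu -> {homo h : x y / x <= y} -> (forall x, 0 <= h x) ->
  (\int[mu]_x (h x)%:E * nu setT <= \int[nu]_x (h x)%:E * mu setT)%E.
Proof.
move=> muoo nuoo munu ndh h0.
have mh : measurable_fun setT (h : mR -> mR) by exact: nondecreasing_measurable.
have mufin : mu setT \is a fin_num by rewrite ge0_fin_numE.
have nufin : nu setT \is a fin_num by rewrite ge0_fin_numE.
apply: (lee_cvg_to (cvgeZr nufin (truncation_cvg mu _ mh h0)) (cvgeZr mufin (truncation_cvg nu _ mh h0))).
apply: nearW => m.
have m0 : 0 < m.+1%:R :> R by rewrite ltr0n.
pose k x := Num.min (h x) m.+1%:R / m.+1%:R.
have k01 x : 0 <= k x <= 1.
  rewrite /k divr_ge0 ?ler_pdivrMr ?mul1r ?ge_min ?lexx ?orbT// ?(ltW m0)//.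
  by rewrite le_min h0 ltW.
have ndk : {homo k : x y / x <= y}.
  move=> x y xy; rewrite /k ler_pM2r ?invr_gt0// le_min !ge_min lexx orbT andbT.
  by rewrite ndh.
have hE (m' : {measure set mR -> \bar R}) :
    (\int[m']_x (Num.min (h x) m.+1%:R)%:E = m.+1%:R%:E * \int[m']_x (k x)%:E)%E.
  rewrite -ge0_integralZl//.
  - by apply: eq_integral => x _; rewrite -EFinM /k mulrC divfK// gt_eqF.
  - by apply/measurable_EFinP; exact: nondecreasing_measurable.
  - by move=> x _; rewrite lee_fin; case/andP: (k01 x).
rewrite !hE -!muleA; apply: lee_wpmul2l; first by rewrite lee_fin ltW.
exact: munu.
Qed.

(** One minus the rescaled truncation is nondecreasing. Needed for the negative part of a utility,
    which may be unbounded. *)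
Lemma stochastic_le_anti mu nu (h : R -> R) : (mu setT < +oo)%E -> (nu setT < +oo)%E ->
  stochastic_le mu nu -> {homo h : x y /~ x <= y} -> (forall x, 0 <= h x) ->
  (\int[nu]_x (h x)%:E * mu setT <= \int[mu]_x (h x)%:E * nu setT)%E.
Proof.
move=> muoo nuoo munu nih h0.
have mh : measurable_fun setT (h : mR -> mR) by apply: nonincreasing_measurable => // x y /nih.
have mufin : mu setT \is a fin_num by rewrite ge0_fin_numE.
have nufin : nu setT \is a fin_num by rewrite ge0_fin_numE.
apply: (lee_cvg_to (cvgeZr mufin (truncation_cvg nu _ mh h0)) (cvgeZr nufin (truncation_cvg mu _ mh h0))).
apply: nearW => m.
have m0 : 0 < m.+1%:R :> R by rewrite ltr0n.
pose k x := 1 - Num.min (h x) m.+1%:R / m.+1%:R.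
have k01 x : 0 <= k x <= 1.
  rewrite /k subr_ge0 gerBl divr_ge0 ?ler_pdivrMr ?mul1r ?ge_min ?lexx ?orbT// ?(ltW m0)//.
  by rewrite le_min h0 ltW.
have ndk : {homo k : x y / x <= y}.
  move=> x y xy; rewrite /k lerD2l lerN2 ler_pM2r ?invr_gt0// le_min !ge_min lexx orbT andbT.
  by rewrite nih.
have mk : measurable_fun setT (k : mR -> mR) by exact: nondecreasing_measurable.
have kfin (m' : {measure set mR -> \bar R}) : (m' setT < +oo)%E -> (\int[m']_x (k x)%:E)%E \is a fin_num.
  move=> m'oo; rewrite ge0_fin_numE; last first.
    by apply: integral_ge0 => x _; rewrite lee_fin; case/andP: (k01 x).
  apply: le_lt_trans m'oo; rewrite -[leRHS]mul1e -integral_cst//.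
  apply: ge0_le_integral => // [x _||x _].
  - by rewrite lee_fin; case/andP: (k01 x).
  - exact/measurable_EFinP.
  - by rewrite lee_fin; case/andP: (k01 x).
have hE (m' : {measure set mR -> \bar R}) : (m' setT < +oo)%E ->
    (\int[m']_x (Num.min (h x) m.+1%:R)%:E = m.+1%:R%:E * (m' setT - \int[m']_x (k x)%:E))%E.
  move=> m'oo; have -> : (m' setT - \int[m']_x (k x)%:E = \int[m']_x (1 - k x)%:E)%E.
    have -> : m' setT = (\int[m']_x ((1 - k x)%:E + (k x)%:E))%E.
      rewrite -[LHS]mul1e -integral_cst//; apply: eq_integral => x _.
      by rewrite -EFinD subrK.
    rewrite ge0_integralD// ?addeK ?kfin//.
    - by move=> x _; rewrite lee_fin subr_ge0; case/andP: (k01 x).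
    - by apply/measurable_EFinP; exact: measurable_funB.
    - by move=> x _; rewrite lee_fin; case/andP: (k01 x).
    - exact/measurable_EFinP.
  rewrite -ge0_integralZl//.
  - by apply: eq_integral => x _; rewrite -EFinM /k opprB addrC subrK mulrC divfK// gt_eqF.
  - by apply/measurable_EFinP; exact: measurable_funB.
  - by move=> x _; rewrite lee_fin subr_ge0; case/andP: (k01 x).
rewrite !hE// -!muleA; apply: lee_wpmul2l; first by rewrite lee_fin ltW.
have := munu _ ndk k01.
rewrite -(fineK mufin) -(fineK nufin) -(fineK (kfin _ muoo)) -(fineK (kfin _ nuoo)).
rewrite -!EFinB -!EFinM !lee_fin !mulrBl => le.
by rewrite [_ * fine (mu _)]mulrC lerB.
Qed.

End StochasticOrder.

Lemma integral_restricted_law {d d'} {T : measurableType d} {T' : measurableType d'}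
    {R : realType} (P : {measure set T -> \bar R}) (Z : T -> T') (D : set T)
    (mu : {measure set T' -> \bar R}) (F : T' -> \bar R) :
  measurable_fun setT Z -> measurable D ->
  (forall A, measurable A -> mu A = P (Z @^-1` A `&` D)) ->
  measurable_fun setT F -> (forall x, 0 <= F x)%E ->
  (\int[mu]_x F x = \int[P]_(w in D) F (Z w))%E.
Proof.
move=> mZ mD muE mF F0.
have mFZ (G : T' -> \bar R) : measurable_fun setT G -> measurable_fun D (fun w => G (Z w)).
  by move=> mG; apply: measurable_funTS; exact: measurableT_comp.
have pM : positive_functional (fun G : T' -> \bar R => \int[P]_(w in D) G (Z w))%E.
  split.
  - by move=> G G0; exact: integral_ge0.
  - by move=> G H mG mH G0 H0; rewrite ge0_integralD//; exact: mFZ.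
  - by move=> c G mG G0 c0; rewrite ge0_integralZl//; exact: mFZ.
  - move=> G mG G0 nG.
    by apply: (@cvg_monotone_convergence _ _ _ P D mD (fun m w => G m (Z w))) => // m; exact: mFZ.
have [nu nuE] := functional_measure pM.
rewrite nuE//; apply: eq_measure_integral => A mA _; rewrite muE//.
rewrite -[RHS]mul1e -integral_cst// integral_mkcond.
transitivity (\int[nu]_x (\1_A x)%:E)%E.
  rewrite -nuE//; last by apply/measurable_EFinP; exact: measurable_indic.
  rewrite -integral_indic//.
  by rewrite -[X in measurable X]setTI; exact: mZ.
by apply: eq_integral => x _; rewrite patchE indicE; case: ifP.
Qed.

Lemma lte_sum_fin {R : realType} (J : finType) (p : pred J) (F G : J -> \bar R) :
  (exists j, p j) -> (forall j, p j -> 0 <= F j)%E -> (\sum_(j | p j) F j < +oo)%E ->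
  (forall j, p j -> F j < +oo -> F j < G j)%E ->
  (\sum_(j | p j) F j < \sum_(j | p j) G j)%E.
Proof.
move=> [j pj] F0 Foo FG.
have Fj k : p k -> (F k < +oo)%E.
  move=> pk; apply: le_lt_trans Foo; rewrite (bigD1 k)//= leeDl//.
  by apply: sume_ge0 => i /andP[/F0].
rewrite (bigD1 j)//= [ltRHS](bigD1 j)//=; apply: lte_leD.
- rewrite ge0_fin_numE; last by apply: sume_ge0 => i /andP[/F0].
  apply: le_lt_trans Foo; rewrite [leRHS](bigD1 j)//= leeDr//; exact: F0.
- by apply: FG => //; exact: Fj.
- by apply: lee_sum => i /andP[pi _]; apply/ltW/FG => //; exact: Fj.
Qed.

(** * Dominance for the laws of the model *)

Section ModelLaws.
Context {R : realType} {n : nat} {d : measure_display} {T : measurableType d}.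
Notation mR := (measurableTypeR R).
Variables (P : probability T R) (X Y : 'I_n.+2 -> {RV P >-> R}) (I : set R).
Variables (f : n.+2.-tuple R -> R) (Q : R.-pker (n.+2.-tuple mR) ~> mR).
Hypothesis hsym : symmetric_model X Y.
Hypothesis hI : is_interval I.
Hypothesis hf : is_joint_density Y f.
Hypothesis hfpos : forall y : n.+2.-tuple R, (forall i, I (tnth y i)) -> 0 < f y.
Hypothesis hQ : is_cond_law X Y Q.
Hypothesis hdep : positive_dependence I f Q.
Hypothesis hfin : forall y z, I y -> I z -> (signal_law I f Q y z (fun=> 1%R) < +oo)%E.

Let mf : measurable_fun setT (f : n.+2.-tuple mR -> R). Proof. by case: hf. Qed.
Let f0 y : 0 <= f y. Proof. by case: hf. Qed.

Let mX i : measurable_fun setT (X i : T -> mR). Proof. exact: (@measurable_funPT _ _ _ _ (X i)). Qed.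
Let mY i : measurable_fun setT (Y i : T -> mR). Proof. exact: (@measurable_funPT _ _ _ _ (Y i)). Qed.

Definition signal_cell (a b : 'I_n.+2 -> R) : set T := [set w | forall i, a i <= Y i w < b i].

Lemma measurable_signal_cell a b : measurable (signal_cell a b).
Proof.
rewrite (_ : signal_cell a b = \bigcap_(i in [set: 'I_n.+2]) (Y i @^-1` [set` `[a i, b i[])).
  apply: fin_bigcap_measurable => // i _; rewrite -[X in measurable X]setTI.
  by apply: mY => //; exact: measurable_itv.
apply/seteqP; split=> w h i; last have := h i Logic.I; first move=> _; rewrite /= in_itv/=; exact.
Qed.

Lemma box_law_is_integral a b : is_integral (box_law f Q (closed_box a b)).
Proof. exact: (box_law_measure Q mf f0 (measurable_closed_box a b)). Qed.

Lemma top_law_is_integral y z k : is_integral (box_law f Q (top_signal_box I y z k)).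
Proof. exact: (box_law_measure Q mf f0 (measurable_top_signal_box hI y z k)). Qed.

Lemma cell_law a b (mu : {measure set mR -> \bar R}) : (forall i, a i < b i) ->
  (forall phi : R -> R, measurable_fun setT (phi : mR -> mR) -> (forall x, 0 <= phi x) ->
    box_law f Q (closed_box a b) phi = (\int[mu]_x (phi x)%:E)%E) ->
  forall A, measurable A -> mu A = P (X ord0 @^-1` A `&` signal_cell a b).
Proof.
move=> ab muE A mA.
transitivity (box_law f Q (closed_box a b) \1_A).
  have mA1 : measurable_fun setT (\1_A : mR -> mR) by exact: measurable_indic.
  have A0 x : 0 <= \1_A x :> R by [].
  by rewrite (muE _ mA1 A0) integral_indic// setIT.
exact/esym/(prob_value_half_open hf hQ mA ab).
Qed.

Lemma cell_law_integral a b (h : R -> R) : (forall i, a i < b i) ->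
  measurable_fun setT (h : mR -> mR) -> (forall x, 0 <= h x) ->
  box_law f Q (closed_box a b) h = (\int[P]_(w in signal_cell a b) (h (X ord0 w))%:E)%E.
Proof.
move=> ab mh h0; have [mu muE] := box_law_is_integral a b.
rewrite (muE _ mh h0).
apply: (@integral_restricted_law _ _ T mR R P (X ord0) (signal_cell a b) mu (EFin \o h)) => //.
- exact: measurable_signal_cell.
- exact: cell_law ab muE.
- exact/measurable_EFinP.
Qed.

Lemma cell_law_mass a b : (forall i, a i < b i) ->
  box_law f Q (closed_box a b) (fun=> 1%R) = P (signal_cell a b).
Proof.
move=> ab; have mc := measurable_signal_cell a b.
rewrite (cell_law_integral ab (measurable_cst _) (fun=> ler01)).
by rewrite (integral_cst P mc 1%:E) mul1e.
Qed.

Lemma prob_value_perm (sigma : {perm 'I_n.+2}) (A : set mR) (a b : 'I_n.+2 -> R) :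
  sigma ord0 = ord0 -> measurable A ->
  P (X ord0 @^-1` A `&` signal_cell (a \o sigma) (b \o sigma)) =
  P (X ord0 @^-1` A `&` signal_cell a b).
Proof.
move=> s0 mA; pose tau := (sigma^-1)%g.
have t0 : tau ord0 = ord0 by rewrite /tau -[in LHS]s0 permK.
(* [None] indexes the value and [Some i] the signals, so that they form a single family whose joint
   law is determined by rays. *)
pose V (k : option 'I_n.+2) : T -> mR := if k is Some i then Y i else X ord0.
pose W (k : option 'I_n.+2) : T -> mR := if k is Some i then Y (tau i) else X ord0.
pose C (k : option 'I_n.+2) : set mR := if k is Some i then [set` `[a i, b i[] else A.
have := @joint_rays_determine_law R _ T P (option 'I_n.+2) V W _ _ _ C.
have -> : [set w | forall k, C k (V k w)] = X ord0 @^-1` A `&` signal_cell a b.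
  apply/seteqP; split=> w /=.
    move=> h; split; first exact: (h None).
    by move=> i; have := h (Some i); rewrite /= in_itv.
  by move=> [Aw h] [i|//]; have := h i; rewrite /= in_itv.
have -> : [set w | forall k, C k (W k w)] =
    X ord0 @^-1` A `&` signal_cell (a \o sigma) (b \o sigma).
  apply/seteqP; split=> w /=.
    move=> h; split; first exact: (h None).
    by move=> i; have := h (Some (sigma i)); rewrite /= in_itv/= /tau permK.
  by move=> [Aw h] [i|//]; have := h (tau i); rewrite /= in_itv/= /tau permKV.
move=> H; apply/esym/H => {H}.
- by case=> [i|]; [exact: mY|exact: mX].
- by case=> [i|]; [exact: mY|exact: mX].
- move=> y; have := hsym tau (y None) (fun i => y (Some i)); rewrite t0 => H.
  apply: etrans (etrans (esym H) _); congr (P _); apply/seteqP; split=> w /=.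
  + by move=> h; split; [exact: (h None)|move=> i; exact: (h (Some i))].
  + by move=> [h1 h2] [i|] //=; exact: h2.
  + by move=> [h1 h2] [i|] //=; exact: h2.
  + by move=> h; split; [exact: (h None)|move=> i; exact: (h (Some i))].
- case=> [i|//]; exact: measurable_itv.
Qed.

Lemma box_law_perm (sigma : {perm 'I_n.+2}) (a b : 'I_n.+2 -> R) (h : R -> R) :
  sigma ord0 = ord0 -> (forall i, a i < b i) ->
  measurable_fun setT (h : mR -> mR) -> (forall x, 0 <= h x) ->
  box_law f Q (closed_box (a \o sigma) (b \o sigma)) h = box_law f Q (closed_box a b) h.
Proof.
move=> s0 ab mh h0.
have [mu muE] := box_law_is_integral (a \o sigma) (b \o sigma).
have [nu nuE] := box_law_is_integral a b.
rewrite (muE _ mh h0) (nuE _ mh h0); apply: eq_measure_integral => A mA _.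
have abs i : (a \o sigma) i < (b \o sigma) i by exact: ab.
by rewrite (cell_law abs muE mA) (cell_law ab nuE mA) prob_value_perm.
Qed.

Let L a b := box_law f Q (closed_box a b).
Let B z k := box_law f Q (top_signal_box I z z k).

Let L_gt0 a b : box_in I a b -> (0 < L a b (fun=> 1%R))%E.
Proof. exact: (closed_box_gt0 Q hI mf f0 hfpos). Qed.

Let L_fin (a b : 'I_n.+2 -> R) : (forall i, a i < b i) -> (L a b (fun=> 1%R) < +oo)%E.
Proof. by move=> ab; rewrite /L (cell_law_mass ab) ltey_eq fin_num_measure//;
  exact: measurable_signal_cell. Qed.

Let L_le_B z k a h (Iz : I z) (az : below_in I a z) :=
  @top_box_le R n I f Q hI mf f0 z z k a h Iz az.

Let L_cvg_B z k a_ h (Iz : I z) (az : forall m, below_in I (a_ m) z) :=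
  @top_box_cvg R n I f Q hI mf f0 z z k a_ h Iz az.

Let iB z k : is_integral (B z k) := top_law_is_integral z z k.

Let S_fin z (Iz : I z) := hfin Iz Iz.

Let S_gt0 z : I z -> (0 < signal_law I f Q z z (fun=> 1%R))%E.
Proof. exact: (sum_top_gt0 L_gt0 iB L_le_B). Qed.

Let iS z : is_integral (signal_law I f Q z z).
Proof. exact: (integral_sum_top iB). Qed.

Let S_le_box := sum_top_le_box box_law_is_integral L_gt0 hdep L_fin box_law_perm iB L_le_B L_cvg_B S_fin.

Let S_mono := sum_top_mono box_law_is_integral L_gt0 hdep L_fin box_law_perm iB L_le_B L_cvg_B S_fin.

(** What the study of bids uses of the conditional laws. The last clause compares them with [P] on a
    cell, for unbounded [h] because share gaps are unbounded. *)
Lemma signal_measures : exists mu : R -> {measure set mR -> \bar R},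
  [/\ forall z (h : R -> R), measurable_fun setT (h : mR -> mR) -> (forall x, 0 <= h x) ->
        signal_law I f Q z z h = (\int[mu z]_x (h x)%:E)%E,
      forall z, I z -> (0 < mu z setT)%E /\ (mu z setT < +oo)%E,
      forall z z', I z -> I z' -> z < z' -> stochastic_le (mu z) (mu z') &
      forall z a b (h : R -> R), I z -> box_in I a b -> lower_bound_box z a b ->
        {homo h : x y / x <= y} -> (forall x, 0 <= h x) ->
        (\int[mu z]_x (h x)%:E * P (signal_cell a b) <=
         (\int[P]_(w in signal_cell a b) (h (X ord0 w))%:E) * mu z setT)%E].
Proof.
have /choice[mu muE] := iS.
have m1 z : signal_law I f Q z z (fun=> 1%R) = mu z setT.
  by rewrite (muE z _ (measurable_cst _) (fun=> ler01)) (integral_cst (mu z) measurableT 1%:E) mul1e.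
have mean0 z h : (forall x, 0 <= h x) -> measurable_fun setT (h : mR -> mR) ->
    (0 <= signal_law I f Q z z h)%E.
  by move=> h0 mh; exact: law_ge0.
exists mu; split.
- exact: muE.
- by move=> z Iz; rewrite -m1; split; [exact: S_gt0|exact: S_fin].
- move=> z z' Iz Iz' zz' h ndh h01.
  have mh : measurable_fun setT (h : mR -> mR) by exact: nondecreasing_measurable.
  have h0 x : 0 <= h x by case/andP: (h01 x).
  rewrite -!muE// -!m1.
  have := S_mono Iz Iz' zz' ndh h01.
  rewrite -/(signal_law I f Q z z) -/(signal_law I f Q z' z') => le.
  exact: (law_mean_le_cross (iS z) (S_gt0 Iz) (S_fin Iz) (iS z') (S_gt0 Iz') (S_fin Iz') mh h01 le).
- move=> z a b h Iz Iab zab ndh h0.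
  have ab : forall i, a i < b i by case: zab.
  have [nu nuE] := box_law_is_integral a b.
  have nu1 : nu setT = P (signal_cell a b).
    by rewrite (cell_law ab nuE measurableT) setTI.
  have mh : measurable_fun setT (h : mR -> mR) by exact: nondecreasing_measurable.
  rewrite -nu1 -(cell_law_integral ab mh h0) (nuE _ mh h0).
  apply: stochastic_le_ge0 => //.
  + by rewrite -m1; exact: S_fin.
  + by rewrite nu1 ltey_eq fin_num_measure//; exact: measurable_signal_cell.
  move=> k ndk k01.
  have mk : measurable_fun setT (k : mR -> mR) by exact: nondecreasing_measurable.
  have k0 x : 0 <= k x by case/andP: (k01 x).
  rewrite -(muE z _ mk k0) -(nuE _ mk k0) -m1.
  have -> : nu setT = box_law f Q (closed_box a b) (fun=> 1%R).
    by rewrite nu1 cell_law_mass.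
  have le := S_le_box Iz Iab zab ndk k01.
  exact: (law_le_mean_cross (box_law_is_integral a b) (L_gt0 Iab) (L_fin ab) mk k01 le).
Qed.

Lemma top_signal_box_mass z (k i : 'I_n.+2) : I z ->
  is_point (top_signal_box I z z k i) \/
  (0 < (lebesgue_measure (top_signal_box I z z k i : set mR) : \bar R))%E.
Proof.
move=> Iz; rewrite /top_signal_box; case: ifP => _; first by left; exists z.
case: ifP => _; first by left; exists z.
have [[a [Ia az]]|na] := pselect (exists a, I a /\ a < z).
  right; apply: (@lt_le_trans _ _ (lebesgue_measure (`[a, z]%classic : set mR))).
    by rewrite lebesgue_measure_itv/= lte_fin az -EFinB lte_fin subr_gt0.
  apply: le_measure; rewrite ?inE//.
  - by apply: measurableI; [exact: is_interval_measurable|exact: measurable_itv].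
  - move=> x /=; rewrite !in_itv/= => /andP[ax xz]; split=> //.
    by apply: (hI Ia Iz); rewrite ax.
left; exists z; apply/seteqP; split=> x /=; rewrite in_itv/=; last by move=> ->.
move=> [Ix xz]; apply/eqP; rewrite eq_le xz leNgt/=; apply/negP => zx.
by apply: na; exists x.
Qed.

Lemma signal_law_lt z (phi psi : R -> R) : I z ->
  measurable_fun setT (phi : mR -> mR) -> measurable_fun setT (psi : mR -> mR) ->
  (forall x, 0 <= phi x) -> (forall x, 0 <= psi x) ->
  (forall y : n.+2.-tuple R, (forall i, I (tnth y i)) ->
    (\int[Q y]_x (phi x)%:E < \int[Q y]_x (psi x)%:E)%E) ->
  (signal_law I f Q z z phi < +oo)%E ->
  (signal_law I f Q z z phi < signal_law I f Q z z psi)%E.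
Proof.
move=> Iz mphi mpsi phi0 psi0 lt phioo.
have inI k y : in_box (top_signal_box I z z k) y -> forall i : 'I_n.+2, I (tnth y i).
  move=> Dy i; have := Dy i; rewrite /top_signal_box.
  by case: ifP => _; [move=> ->|case: ifP => _; [move=> ->|case]].
apply: lte_sum_fin.
- by exists (lift ord0 ord0).
- by move=> k _; apply: box_law_ge0.
- exact: phioo.
move=> k k0 kfin; apply: (box_law_lt mf f0) => //.
- by move=> i; exact: measurable_top_signal_box.
- by move=> i; exact: top_signal_box_mass.
- by move=> y /inI; exact: hfpos.
- by move=> y /inI; exact: lt.
Qed.

(** Nullity passes from the sum of slices to a truncation of one slice, and the tails on
    full-dimensional boxes can be stated as probabilities. *)
Lemma signal_law_not_concentrated z c c' e v : I z -> I c -> I c' -> I e ->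
  e < z -> z < c -> c < c' -> signal_law I f Q z z \1_(~` [set v]) = 0%E ->
  (forall t, v < t -> exists b, [/\ I b, z < b &
     P (X ord0 @^-1` `]t, +oo[%classic `&`
        signal_cell (top_lower c z (lift ord0 ord0) e) (top_upper c' b)) = 0%E]) ->
  False.
Proof.
move=> Iz Ic Ic' Ie ez zc cc' Sv Pt.
have j0 : lift ord0 ord0 != ord0 :> 'I_n.+2 by [].
have below : below_in I e z by split=> //; [exact: ltW|left].
have mv : measurable_fun setT (\1_(~` [set v]) : mR -> mR).
  by apply: measurable_indic; apply: measurableC; exact: measurable_set1.
have v0 x : 0 <= \1_(~` [set v]) x :> R by [].
have fin y : I y -> (box_law f Q (closed_box (top_lower y z (lift ord0 ord0) e)
    (top_upper y z)) (fun=> 1%R) < +oo)%E.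
  move=> Iy; apply: le_lt_trans (hfin Iy Iz).
  have H1 := @top_le_signal_law R n I f Q f0 y z _ (fun=> 1%R) j0 (fun=> ler01).
  apply: (le_trans _ H1).
  exact: (@top_box_le R n I f Q hI mf f0 y z (lift ord0 ord0) e (fun=> 1%R) Iz below
    (measurable_cst _) (fun=> ler01)).
apply: (no_concentration box_law_is_integral L_gt0 hdep L_fin Iz Ic Ic' Ie ez zc cc' j0
  (fin _ Iz) (fin _ Ic)).
  apply/eqP; rewrite eq_le; apply/andP; split; last first.
    exact: (law_ge0 (box_law_is_integral _ _) mv v0).
  rewrite -[leRHS]Sv.
  apply: le_trans (@top_le_signal_law R n I f Q f0 z z _ _ j0 v0).
  exact: (@top_box_le R n I f Q hI mf f0 z z (lift ord0 ord0) e _ Iz below mv v0).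
move=> t /Pt[b [Ib zb Pb]]; exists b; split=> //.
have ab (i : 'I_n.+2) : top_lower c z (lift ord0 ord0) e i < top_upper c' b i.
  rewrite /top_lower /top_upper; case: ifP => // _; case: ifP => // _.
  exact: lt_trans ez zb.
have mt : measurable (`]t, +oo[%classic : set mR) by exact: measurable_itv.
have E := prob_value_half_open hf hQ (a := top_lower c z (lift ord0 ord0) e)
  (b := top_upper c' b) mt ab.
exact: (etrans (esym E) Pb).
Qed.

End ModelLaws.

(** * Bids *)

Section Concave.
Context {R : realType}.
Variable u : R -> R.
Hypothesis cu : concave u.
Hypothesis iu : {homo u : x y / x < y}.

Lemma concave_three_points s t r : s < t -> t < r ->
  (t - s) * (u r - u t) <= (r - t) * (u t - u s).
Proof.
move=> st tr; have sr : 0 < r - s by rewrite subr_gt0 (lt_trans st).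
have /cu : 0 <= (r - t) / (r - s) <= 1.
  by rewrite divr_ge0 ?subr_ge0 ?(ltW tr) ?(ltW (lt_trans st tr))//= ler_pdivrMr// mul1r lerD2l lerN2 ltW.
move=> /(_ s r).
have -> : (r - t) / (r - s) * s + (1 - (r - t) / (r - s)) * r = t.
  by field; rewrite gt_eqF.
have -> : (r - t) / (r - s) * u s + (1 - (r - t) / (r - s)) * u r =
    ((r - t) * u s + (t - s) * u r) / (r - s).
  by field; rewrite gt_eqF.
rewrite ler_pdivrMr// => H; nra.
Qed.

Lemma concave_slopes s t s' t' : s < t -> t <= s' -> s' < t' ->
  (t - s) * (u t' - u s') <= (t' - s') * (u t - u s).
Proof.
move=> st; rewrite le_eqVlt => /predU1P[<-|ts'] s't'; first exact: concave_three_points.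
have h1 := concave_three_points st ts'; have h2 := concave_three_points ts' s't'.
have ts'0 : 0 < s' - t by rewrite subr_gt0.
rewrite -(ler_pM2l ts'0); apply: (@le_trans _ _ ((t' - s') * ((t - s) * (u s' - u t)))).
  by rewrite mulrCA [leRHS]mulrCA ler_pM2l// subr_gt0.
by rewrite [leRHS]mulrCA ler_pM2l// subr_gt0.
Qed.

(** [m] is the right derivative at [w0], as the supremum of the slopes to its right. Every slope to
    the left bounds these from above, and the slope towards w0 + 1 makes it positive. Increments on
    either side of [w0] are bounded, since two net gains will be compared with each other. *)
Lemma concave_supergradient w0 : exists m, [/\ 0 < m,
  forall s t, w0 <= s -> s <= t -> u t - u s <= m * (t - s) &
  forall s t, s <= t -> t <= w0 -> m * (t - s) <= u t - u s].
Proof.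
pose A := [set v | exists t, w0 < t /\ v = (u t - u w0) / (t - w0)].
have A1 : A (u (w0 + 1) - u w0).
  by exists (w0 + 1); rewrite ltrDl ltr01 addrAC subrr add0r divr1.
have ubA s t : s < t -> t <= w0 -> ubound A ((u t - u s) / (t - s)).
  move=> st tw _ [r [wr ->]].
  rewrite ler_pdivrMr ?subr_gt0// mulrAC ler_pdivlMr ?subr_gt0//.
  by have := concave_slopes st tw wr; rewrite mulrC [leRHS]mulrC.
have hsA : has_sup A.
  split; first by eexists; exact: A1.
  by eexists; apply: (ubA (w0 - 1) w0) => //; rewrite gtrBl.
exists (sup A); split.
- apply: lt_le_trans (ub_le_sup hsA.2 A1).
  by rewrite subr_gt0 iu// ltrDl.
- move=> s t ws; rewrite le_eqVlt => /predU1P[->|st]; first by rewrite !subrr mulr0.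
  rewrite -ler_pdivrMr ?subr_gt0//; move: ws; rewrite le_eqVlt => /predU1P[ws|ws].
    by subst s; apply: (ub_le_sup hsA.2); exists t.
  apply: (@le_trans _ _ ((u s - u w0) / (s - w0))).
    rewrite ler_pdivrMr ?subr_gt0// mulrAC ler_pdivlMr ?subr_gt0//.
    by have := concave_three_points ws st; rewrite mulrC [leRHS]mulrC.
  by apply: (ub_le_sup hsA.2); exists s.
- move=> s t; rewrite le_eqVlt => /predU1P[->|st] tw; first by rewrite !subrr mulr0.
  rewrite -ler_pdivlMr ?subr_gt0//; apply: sup_le_ub; first by case: hsA.
  exact: ubA.
Qed.

End Concave.

(** * Net gains and differences of payments *)

Section NetGain.
Context {R : realType}.
Implicit Types a b p x y : R.

Lemma pos_part_ge0 x : 0 <= pos_part x. Proof. by rewrite /pos_part le_max lexx. Qed.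

Lemma pos_part_le : {homo @pos_part R : x y / x <= y}.
Proof. by move=> x y xy; rewrite /pos_part ge_max !le_max lexx/= xy orbT. Qed.

Lemma pos_part_lip x y : x <= y -> pos_part y - pos_part x <= y - x.
Proof. by rewrite /pos_part => xy; case: (leP 0 x); case: (leP 0 y); lra. Qed.

Lemma net_gain_mono a s t : 0 <= a < 1 -> s < t -> s - a * pos_part s < t - a * pos_part t.
Proof.
move=> /andP[a0 a1] st; have := pos_part_lip (ltW st); have := pos_part_le (ltW st).
set p := pos_part s; set q := pos_part t => pq qp.
have : a * (q - p) <= a * (t - s) by rewrite ler_wpM2l.
have : a * (t - s) < t - s by rewrite gtr_pMl// subr_gt0.
lra.
Qed.

Lemma net_gain_lt_value a b : 0 <= a < 1 -> {homo net_gain a b : x y / x < y}.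
Proof. by move=> a01 x y xy; apply: net_gain_mono => //; rewrite ltrD2r. Qed.

Lemma net_gain_le_value a b : 0 <= a < 1 -> {homo net_gain a b : x y / x <= y}.
Proof. by move=> a01; apply/ltW_homo/net_gain_lt_value. Qed.

Lemma net_gain_lt_price a b b' x : 0 <= a < 1 -> b < b' -> net_gain a b' x < net_gain a b x.
Proof. by move=> a01 bb'; apply: net_gain_mono => //; rewrite ltrD2l ltrN2. Qed.

Lemma net_gain_le_price a b b' x : 0 <= a < 1 -> b <= b' -> net_gain a b' x <= net_gain a b x.
Proof. by move=> a01; rewrite le_eqVlt => /predU1P[->//|/(net_gain_lt_price x a01)/ltW]. Qed.

Lemma net_gain_le_share a a' b x : a <= a' -> net_gain a' b x <= net_gain a b x.
Proof. by move=> aa'; rewrite /net_gain lerD2l lerN2 ler_wpM2r// pos_part_ge0. Qed.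

Lemma net_gain_lt_share a a' b x : a < a' -> b < x -> net_gain a' b x < net_gain a b x.
Proof.
move=> aa' bx; rewrite /net_gain ltrD2l ltrN2 ltr_pM2r//.
by rewrite /pos_part lt_max subr_gt0 bx orbT.
Qed.

Lemma net_gain_loss a b x : x <= b -> net_gain a b x = x - b.
Proof.
move=> xb; rewrite /net_gain /pos_part; have -> : Num.max 0 (x - b) = 0.
  by apply/max_idPl; rewrite subr_le0.
by rewrite mulr0 subr0.
Qed.

(* The difference of the total payments net of the price difference p - p'. *)
Definition share_gap a a' p p' x := a' * pos_part (x - p') - a * pos_part (x - p).

Lemma net_gain_share_gap a a' p p' x :
  net_gain a p x - net_gain a' p' x = share_gap a a' p p' x - (p - p').
Proof. by rewrite /net_gain /share_gap; ring. Qed.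

Section ShareGap.
Variables a a' p p' : R.
Hypotheses (a0 : 0 <= a) (aa' : a <= a') (pp' : p' <= p).

Lemma share_gap_le : {homo share_gap a a' p p' : x y / x <= y}.
Proof.
move=> x y xy; rewrite /share_gap lerBlDr addrAC lerBrDr.
(* As p' <= p, the profit at price p' grows at least as fast in the value as the profit at price
   p. *)
have d1 : 0 <= pos_part (y - p) - pos_part (x - p) <= pos_part (y - p') - pos_part (x - p').
  rewrite subr_ge0 pos_part_le ?lerD2r//=.
  have pp := pp'; rewrite /pos_part; case: (leP 0 (y - p)); case: (leP 0 (x - p));
    case: (leP 0 (y - p')); case: (leP 0 (x - p')); lra.
have a'0 : 0 <= a' by exact: le_trans aa'.
move/andP: d1 => [d0 d1].
have := ler_wpM2l a'0 d1; have := ler_wpM2r d0 aa'.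
rewrite !mulrBr; lra.
Qed.

Lemma share_gap_ge0 x : 0 <= share_gap a a' p p' x.
Proof.
rewrite /share_gap subr_ge0; apply: ler_pM => //; first exact: pos_part_ge0.
by apply: pos_part_le; rewrite lerD2l lerN2.
Qed.

End ShareGap.

Lemma concave_share_gap (u : R -> R) a a' p p' : concave u -> {homo u : x y / x < y} ->
  0 <= a -> a < a' -> a' < 1 -> p' <= p ->
  exists m, 0 < m /\ forall x, u (net_gain a p x) - u (net_gain a' p' x) <=
    m * (share_gap a a' p p' x - (p - p')).
Proof.
move=> cu iu a0 aa' a'1 pp'.
have a01 : 0 <= a < 1 by rewrite a0 (lt_trans aa').
have a'01 : 0 <= a' < 1 by rewrite (le_trans a0 (ltW aa')).
have d0 : 0 < a' - a by rewrite subr_gt0.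
(* the value at which the two net gains agree *)
pose c := p + (1 - a') * (p - p') / (a' - a).
have pc : p <= c by rewrite lerDl divr_ge0 ?(ltW d0)// mulr_ge0 ?subr_ge0 ?(ltW a'1).
have gap_c : share_gap a a' p p' c = p - p'.
  rewrite /share_gap /pos_part (max_idPr _) ?subr_ge0 ?(le_trans pp')//.
  rewrite (max_idPr _) ?subr_ge0// /c; field.
  by rewrite gt_eqF.
have eq_c : net_gain a p c = net_gain a' p' c.
  by apply/eqP; rewrite -subr_eq0 net_gain_share_gap gap_c subrr.
have [m [m0 right left]] := concave_supergradient cu iu (net_gain a p c).
exists m; split=> // x; rewrite -net_gain_share_gap.
have ngap y : y <= c -> net_gain a p y <= net_gain a' p' y.
  move=> yc; rewrite -subr_le0 net_gain_share_gap subr_le0 -gap_c.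
  by apply: share_gap_le => //; exact: ltW.
(* Above [c] both net gains exceed the common value and the first is the larger, so the slope of [u]
   between them is at most [m]. Below [c] both lie under it and the first is the smaller, so the
   slope is at least [m] and the signs reverse. *)
have [cx|xc] := leP c x.
  apply: right; first by rewrite eq_c net_gain_le_value.
  rewrite -subr_ge0 net_gain_share_gap subr_ge0 -gap_c.
  by apply: share_gap_le => //; exact: ltW.
have xc' := ltW xc.
have : net_gain a' p' x <= net_gain a p c by rewrite eq_c net_gain_le_value.
by move=> /(left _ _ (ngap x xc')); rewrite !mulrBr; lra.
Qed.

End NetGain.

Section AlmostEverywhere.
Context {d : measure_display} {T : measurableType d} {R : realType}.
Variable m : {measure set T -> \bar R}.

Lemma ae_imply (A B : T -> Prop) : (forall x, A x -> B x) ->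
  {ae m, forall x, A x} -> {ae m, forall x, B x}.
Proof. by move=> AB; apply: filterS. Qed.

Lemma ae_imply2 (A B C : T -> Prop) : (forall x, A x -> B x -> C x) ->
  {ae m, forall x, A x} -> {ae m, forall x, B x} -> {ae m, forall x, C x}.
Proof. by move=> ABC; apply: filterS2. Qed.

Lemma integral_zero_le0 (g : T -> R) : m.-integrable setT (EFin \o g) ->
  (\int[m]_x (g x)%:E = 0)%E -> {ae m, forall x, g x <= 0} -> {ae m, forall x, g x = 0}.
Proof.
move=> ig g0 gle.
have mg : measurable_fun setT (EFin \o g) by case/integrableP: ig.
have : ae_eq m setT (EFin \o g) (cst 0%E).
  apply/ae_eq_integral_abs => //.
  transitivity (\int[m]_x - (g x)%:E)%E.
    apply: ae_eq_integral => //.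
    - exact: measurableT_comp.
    - exact: measurableT_comp.
    - by apply: filterS gle => x gx _ /=; rewrite ler0_norm.
  rewrite integralN ?g0 ?oppe0//.
  exact: (integrable_add_def measurableT ig).
by apply: filterS => x /= /(_ Logic.I)[].
Qed.

End AlmostEverywhere.

(** * Bids as zeros of the expected utility *)

Section Bids.
Context {R : realType}.
Notation mR := (measurableTypeR R).
Variables (I : set R) (u : R -> R) (M : R -> (R -> R) -> \bar R).
Variables (mu : R -> {measure set mR -> \bar R}) (p : R -> R -> R).
Hypothesis cu : concave u.
Hypothesis iu : {homo u : x y / x < y}.
Hypothesis u0 : u 0 = 0.
Hypothesis MmuE : forall z (h : R -> R), measurable_fun setT (h : mR -> mR) ->
  (forall x, 0 <= h x) -> M z h = (\int[mu z]_x (h x)%:E)%E.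
Hypothesis mu_mass : forall z, I z -> (0 < mu z setT)%E /\ (mu z setT < +oo)%E.
Hypothesis gain_exists : forall a b z, 0 <= a < 1 -> I z ->
  cond_mean_exists (M z) (fun x => u (net_gain a b x)).
Hypothesis bid : forall a z, 0 <= a < 1 -> I z -> forall b,
  cond_mean (M z) (fun x => u (net_gain a b x)) = 0 <-> b = p a z.
Hypothesis mu_mono : forall z z', I z -> I z' -> z < z' -> stochastic_le (mu z) (mu z').
Hypothesis upos : forall z, I z ->
  (M z (fun x => Num.max (- u x)%R 0%R) < M z (fun x => Num.max (u x) 0%R))%E.

Let iu_le : {homo u : x y / x <= y}. Proof. exact/ltW_homo. Qed.

Lemma utility_gain_le a b : 0 <= a < 1 -> {homo (fun x => u (net_gain a b x)) : x y / x <= y}.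
Proof. by move=> a01 x y xy; apply/iu_le/net_gain_le_value. Qed.

Lemma measurable_utility_gain a b : 0 <= a < 1 ->
  measurable_fun setT ((fun x => u (net_gain a b x)) : mR -> mR).
Proof. by move=> a01; apply: nondecreasing_measurable => //; exact: utility_gain_le. Qed.

Lemma integrable_utility_gain a b z : 0 <= a < 1 -> I z ->
  (mu z).-integrable setT (fun x => (u (net_gain a b x))%:E).
Proof.
move=> a01 Iz; have mg := measurable_utility_gain b a01.
apply/integrableP; split; first exact/measurable_EFinP.
have [_ _] := gain_exists b a01 Iz; rewrite MmuE//; exact: measurableT_comp.
Qed.

Lemma cond_mean_integral z (g : R -> R) : I z -> measurable_fun setT (g : mR -> mR) ->
  (mu z).-integrable setT (EFin \o g) ->
  cond_mean (M z) g = fine (\int[mu z]_x (g x)%:E) / fine (mu z setT).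
Proof.
move=> Iz mg ig.
have m1 : M z (fun=> 1) = mu z setT.
  by rewrite MmuE// ?integral_cst ?mul1e// => x; exact: ler01.
have pE : M z (fun x => Num.max (g x) 0) = (\int[mu z]_x (EFin \o g)^\+ x)%E.
  rewrite MmuE; last by move=> x; rewrite le_max lexx orbT.
    by apply: eq_integral => x _; rewrite funeposE EFin_max.
  exact: measurable_maxr.
have nE : M z (fun x => Num.max (- g x) 0) = (\int[mu z]_x (EFin \o g)^\- x)%E.
  rewrite MmuE; last by move=> x; rewrite le_max lexx orbT.
    by apply: eq_integral => x _; rewrite funenegE EFin_max.
  by apply: measurable_maxr => //; exact: measurableT_comp.
rewrite /cond_mean m1 pE nE; congr (_ / _).
rewrite [in RHS]integralE.
by rewrite (fineB (integrable_pos_fin_num measurableT ig) (integrable_neg_fin_num measurableT ig)).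
Qed.

Let mu_fin z : I z -> mu z setT \is a fin_num.
Proof. by move=> Iz; rewrite ge0_fin_numE//; case: (mu_mass Iz). Qed.

Let mu_gt0 z : I z -> 0 < fine (mu z setT).
Proof. by move=> Iz; rewrite -lte_fin fineK ?mu_fin//; case: (mu_mass Iz). Qed.

Lemma bidP a z b : 0 <= a < 1 -> I z ->
  (\int[mu z]_x (u (net_gain a b x))%:E = 0)%E <-> b = p a z.
Proof.
move=> a01 Iz; rewrite -(bid a01 Iz b).
have ig := integrable_utility_gain b a01 Iz.
rewrite (cond_mean_integral Iz (measurable_utility_gain b a01) ig).
have fin := integrable_fin_num measurableT ig.
split=> [->|/eqP]; first by rewrite mul0r.
rewrite mulf_eq0 invr_eq0 [X in _ || X]gt_eqF ?mu_gt0// orbF => /eqP f0.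
by rewrite -(fineK fin) f0.
Qed.

(** If [b] were below the bid, the expected utility at [b] would be nonnegative as well, hence zero,
    and uniqueness of the zero would make [b] the bid. *)
Lemma bid_le a z b : 0 <= a < 1 -> I z ->
  (\int[mu z]_x (u (net_gain a b x))%:E <= 0)%E -> p a z <= b.
Proof.
move=> a01 Iz le0; rewrite leNgt; apply/negP => bp.
suff : b = p a z by move=> bE; move: bp; rewrite bE ltxx.
apply/(bidP b a01 Iz)/eqP; rewrite eq_le le0/=.
rewrite -(iffRL (bidP _ a01 Iz) erefl); apply: le_integral => //.
- exact: integrable_utility_gain.
- exact: integrable_utility_gain.
- by move=> x _; rewrite lee_fin; apply/iu_le/net_gain_le_price => //; exact: ltW.
Qed.

Lemma bid_ge a z b : 0 <= a < 1 -> I z ->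
  (0 <= \int[mu z]_x (u (net_gain a b x))%:E)%E -> b <= p a z.
Proof.
move=> a01 Iz ge0; rewrite leNgt; apply/negP => bp.
suff : b = p a z by move=> bE; move: bp; rewrite bE ltxx.
apply/(bidP b a01 Iz)/eqP; rewrite eq_le ge0 andbT.
rewrite -[leRHS](iffRL (bidP _ a01 Iz) erefl); apply: le_integral => //.
- exact: integrable_utility_gain.
- exact: integrable_utility_gain.
- by move=> x _; rewrite lee_fin; apply/iu_le/net_gain_le_price => //; exact: ltW.
Qed.

Lemma bid_share_le a a' z : 0 <= a -> a <= a' -> a' < 1 -> I z -> p a' z <= p a z.
Proof.
move=> a0 aa' a'1 Iz.
have a01 : 0 <= a < 1 by rewrite a0 (le_lt_trans aa').
have a'01 : 0 <= a' < 1 by rewrite (le_trans a0 aa') a'1.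
apply: bid_le => //; rewrite -[leRHS](iffRL (bidP _ a01 Iz) erefl); apply: le_integral => //.
- exact: integrable_utility_gain.
- exact: integrable_utility_gain.
- by move=> x _; rewrite lee_fin; apply/iu_le/net_gain_le_share.
Qed.

Lemma ae_indic_eq0 z (A : set mR) : measurable A -> {ae mu z, forall x, ~ A x} ->
  M z \1_A = 0%E.
Proof.
move=> mA nA; rewrite MmuE; last 2 first.
- exact: measurable_indic.
- by [].
rewrite integral_indic// setIT.
have [B [mB B0 sB]] := nA.
apply/eqP; rewrite eq_le measure_ge0 andbT -B0; apply: le_measure; rewrite ?inE//.
by move=> x Ax; apply: sB => /=; exact.
Qed.

(* A bidder who never gains is compensated nowhere. *)
Lemma no_gain_revealed a z : 0 <= a < 1 -> I z -> {ae mu z, forall x, x <= p a z} ->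
  M z \1_(~` [set p a z]) = 0%E.
Proof.
move=> a01 Iz xp; apply: ae_indic_eq0; first by apply: measurableC; exact: measurable_set1.
have := integral_zero_le0 (integrable_utility_gain (p a z) a01 Iz) (iffRL (bidP _ a01 Iz) erefl) _.
have h : {ae mu z, forall x, u (net_gain a (p a z) x) <= 0}.
  by apply: ae_imply xp => x xp; rewrite -u0; apply: iu_le; rewrite net_gain_loss// subr_le0.
move=> /(_ h); apply: ae_imply2 xp => x xp ux /=; apply.
apply/eqP; rewrite eq_le xp leNgt/=; apply/negP => xltp.
have : u (net_gain a (p a z) x) < u 0 by apply: iu; rewrite net_gain_loss// subr_lt0.
by rewrite ux u0 ltxx.
Qed.

(** At a common price the larger share strictly hurts wherever the value exceeds the price. Both
    expected utilities vanish, so the value almost surely never does. *)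
Lemma bid_share_eq_revealed a a' z : 0 <= a -> a < a' -> a' < 1 -> I z -> p a' z = p a z ->
  M z \1_(~` [set p a z]) = 0%E.
Proof.
move=> a0 aa' a'1 Iz pE.
have a01 : 0 <= a < 1 by rewrite a0 (lt_trans aa').
have a'01 : 0 <= a' < 1 by rewrite (le_trans a0 (ltW aa')) a'1.
apply: no_gain_revealed => //.
pose g x := u (net_gain a' (p a z) x) - u (net_gain a (p a z) x).
have i1 := integrable_utility_gain (p a z) a01 Iz.
have i2 := integrable_utility_gain (p a z) a'01 Iz.
have ig : (mu z).-integrable setT (EFin \o g).
  by have := integrableB measurableT i2 i1; apply: eq_integrable => // x _.
have g0 : (\int[mu z]_x (g x)%:E = 0)%E.
  have := integralB measurableT i2 i1.
  rewrite (iffRL (bidP _ a01 Iz) erefl) (iffRL (bidP _ a'01 Iz) (esym pE)) subee// => <-.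
have gle x : g x <= 0 by rewrite subr_le0; apply/iu_le/net_gain_le_share/ltW.
have := integral_zero_le0 ig g0 (aeW (mu z) gle); apply: ae_imply => x gx.
rewrite leNgt; apply/negP => px.
have : g x < 0 by rewrite subr_lt0; apply/iu/net_gain_lt_share.
by rewrite gx ltxx.
Qed.

Lemma bid_mono a z z' : 0 <= a < 1 -> I z -> I z' -> z <= z' -> p a z <= p a z'.
Proof.
move=> a01 Iz Iz'; rewrite le_eqVlt => /predU1P[->//|zz'].
apply: bid_ge => //.
pose g x := u (net_gain a (p a z) x).
have ig : (mu z).-integrable setT (EFin \o g) by exact: integrable_utility_gain.
have ig' : (mu z').-integrable setT (EFin \o g) by exact: integrable_utility_gain.
(* The utility is signed and unbounded, while the stochastic order handles nonnegative functions;
   its positive part is nondecreasing and its negative part nonincreasing. *)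
have gp : {homo (fun x => Num.max (g x) 0) : x y / x <= y}.
  move=> x y xy; rewrite ge_max !le_max lexx orbT andbT.
  by rewrite (utility_gain_le _ a01 xy).
have gn : {homo (fun x => Num.max (- g x) 0) : x y /~ x <= y}.
  move=> x y xy; rewrite ge_max !le_max lexx orbT andbT lerN2.
  by rewrite (utility_gain_le _ a01 xy).
have m0 (h : R -> R) x : 0 <= Num.max (h x) 0 by rewrite le_max lexx orbT.
have [_ zoo] := mu_mass Iz; have [_ z'oo] := mu_mass Iz'.
have := stochastic_le_ge0 zoo z'oo (mu_mono Iz Iz' zz') gp (m0 g).
have := stochastic_le_anti zoo z'oo (mu_mono Iz Iz' zz') gn (m0 (fun x => - g x)).
have pE z0 : (\int[mu z0]_x (Num.max (g x) 0)%:E = \int[mu z0]_x (EFin \o g)^\+ x)%E.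
  by apply: eq_integral => x _; rewrite funeposE EFin_max.
have nE z0 : (\int[mu z0]_x (Num.max (- g x) 0)%:E = \int[mu z0]_x (EFin \o g)^\- x)%E.
  by apply: eq_integral => x _; rewrite funenegE EFin_max.
rewrite !pE !nE.
have -> : (\int[mu z']_x (g x)%:E = \int[mu z']_x (EFin \o g)^\+ x - \int[mu z']_x (EFin \o g)^\- x)%E.
  exact: (integralE (mu z') setT (EFin \o g)).
have : (\int[mu z]_x (EFin \o g)^\+ x - \int[mu z]_x (EFin \o g)^\- x = 0)%E.
  rewrite -(integralE (mu z) setT (EFin \o g)).
  exact: (iffRL (bidP (p a z) a01 Iz) erefl).
rewrite -(fineK (integrable_pos_fin_num measurableT ig)) -(fineK (integrable_neg_fin_num measurableT ig)).
rewrite -(fineK (integrable_pos_fin_num measurableT ig')) -(fineK (integrable_neg_fin_num measurableT ig')).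
rewrite -(fineK (mu_fin Iz)) -(fineK (mu_fin Iz')) -!EFinB -!EFinM !lee_fin => -[/eqP].
rewrite subr_eq0 => /eqP ->.
have h0 := mu_gt0 Iz => h1 h2.
rewrite subr_ge0 -(ler_pM2r h0).
exact: le_trans h1 h2.
Qed.

(** Without a share, price 0 leaves the winner the value itself, of positive expected utility; a bid
    of at most 0 would make that utility at most 0. *)
Lemma bid0_gt0 z : I z -> 0 < p 0 z.
Proof.
move=> Iz; rewrite ltNge; apply/negP => p0.
have a01 : 0 <= (0 : R) < 1 by rewrite lexx ltr01.
have ng0 x : net_gain 0 0 x = x by rewrite /net_gain mul0r !subr0.
have iu1 := integrable_utility_gain 0 a01 Iz.
have mu1 := measurable_utility_gain 0 a01.
have le0 : (\int[mu z]_x (u (net_gain 0 0 x))%:E <= 0)%E.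
  rewrite -[leRHS](iffRL (bidP _ a01 Iz) erefl); apply: le_integral => //.
  - exact: integrable_utility_gain.
  - by move=> x _; rewrite lee_fin; apply/iu_le/net_gain_le_price.
have := upos Iz.
have mu2 : measurable_fun setT (u : mR -> mR) by exact: nondecreasing_measurable.
rewrite !MmuE; do ?by move=> x; rewrite le_max lexx orbT.
- move: le0; rewrite [in X in X -> _]integralE leNgt => /negP nlt lt; apply: nlt.
  have pE : (\int[mu z]_x (fun x => (u (net_gain 0 0 x))%:E)^\+ x = \int[mu z]_x (Num.max (u x) 0)%:E)%E.
    by apply: eq_integral => x _; rewrite funeposE EFin_max ng0.
  have nE : (\int[mu z]_x (fun x => (u (net_gain 0 0 x))%:E)^\- x = \int[mu z]_x (Num.max (- u x) 0)%:E)%E.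
    by apply: eq_integral => x _; rewrite funenegE EFin_max ng0.
  by rewrite pE nE sube_gt0.
- exact: measurable_maxr.
- by apply: measurable_maxr => //; exact: measurableT_comp.
Qed.

Lemma share_gap_mean a a' z : 0 <= a -> a < a' -> a' < 1 -> I z ->
  ((p a z - p a' z)%:E * mu z setT <=
   \int[mu z]_x (share_gap a a' (p a z) (p a' z) x)%:E)%E.
Proof.
move=> a0 aa' a'1 Iz.
have a01 : 0 <= a < 1 by rewrite a0 (lt_trans aa').
have a'01 : 0 <= a' < 1 by rewrite (le_trans a0 (ltW aa')) a'1.
have pp := bid_share_le a0 (ltW aa') a'1 Iz.
set dlt := p a z - p a' z; set h := share_gap _ _ _ _.
have h0 x : 0 <= h x by apply: share_gap_ge0 => //; exact: ltW.
have mh : measurable_fun setT (h : mR -> mR).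
  by apply: nondecreasing_measurable => //; apply: share_gap_le => //; exact: ltW.
(* An infinite mean of the gap makes the bound trivial; a finite one makes the gap integrable, so
   that the integrals below can be split. *)
have [->|hoo] := eqVneq (\int[mu z]_x (h x)%:E)%E +oo%E; first by rewrite leey.
have ih : (mu z).-integrable setT (EFin \o h).
  apply/integrableP; split; first exact/measurable_EFinP.
  under eq_integral do rewrite /= ger0_norm//.
  by rewrite ltey.
have [m [m0 mle]] := concave_share_gap cu iu a0 aa' a'1 pp.
have i1 := integrable_utility_gain (p a z) a01 Iz.
have i2 := integrable_utility_gain (p a' z) a'01 Iz.
have ic : (mu z).-integrable setT (cst dlt%:E).
  apply/integrableP; split; first exact: measurable_cst.
  rewrite /= integral_cst// lte_mul_pinfty//.
  by case: (mu_mass Iz).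
have iB := integrableB measurableT ih ic.
have : (\int[mu z]_x ((u (net_gain a (p a z) x))%:E - (u (net_gain a' (p a' z) x))%:E) <=
    \int[mu z]_x (m%:E * ((h x)%:E - dlt%:E)))%E.
  apply: le_integral => //.
  - exact: (integrableB measurableT i1 i2).
  - exact: (integrableZl measurableT m iB).
  - by move=> x _; rewrite -!EFinB -EFinM lee_fin; exact: mle.
rewrite (integralB measurableT i1 i2) (integralZl measurableT iB) (integralB measurableT ih ic).
rewrite (iffRL (bidP _ a01 Iz) erefl) (iffRL (bidP _ a'01 Iz) erefl) subee//.
rewrite integral_cst// pmule_rge0 ?lte_fin// sube_ge0//.
by rewrite fin_numM ?mu_fin.
Qed.

End Bids.

(** * The total revenue as a limit over grids *)

Section MonotoneContinuity.
Context {R : realType}.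

(** For [F] nondecreasing on the interval from [a] to [b] this is continuity at [x], phrased through
    one witness on each side. *)
Definition approachable (F : R -> R) a b x := forall e, 0 < e ->
  (exists t, [/\ a < t, t < x & F x - F t <= e]) /\
  (exists t, [/\ x < t, t < b & F t - F x <= e]).

(* A jump at x leaves a rational strictly between F x and the values of F on one side. *)
Lemma countable_not_approachable (F : R -> R) a b :
  (forall x y, a < x -> x <= y -> y < b -> F x <= F y) ->
  countable [set x | a < x < b /\ ~ approachable F a b x].
Proof.
move=> ndF; set J := [set x | _].
(* The boolean records the side of the jump. If x < y shared a code, the value at one of them would
   lie both above and below the rational. *)
pose code x (c : bool * rat) := if c.1
  then ratr c.2 < F x /\ forall t, a < t -> t < x -> F t < ratr c.2
  else F x < ratr c.2 /\ forall t, x < t -> t < b -> ratr c.2 < F t.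
have /choice[c cP] : forall x, exists c, J x -> code x c.
  move=> x; have [[xab nap]|nJ] := pselect (J x); last by exists (true, 0).
  have [e [e0 ne]] : exists e, 0 < e /\ ~ ((exists t, [/\ a < t, t < x & F x - F t <= e]) /\
      (exists t, [/\ x < t, t < b & F t - F x <= e])).
    apply: contrapT => h; apply: nap => e e0; apply: contrapT => h'.
    by apply: h; exists e.
  have [nl|nr] := pselect (exists t, [/\ a < t, t < x & F x - F t <= e]); last first.
    have [|q] := @rat_in_itvoo R (F x - e) (F x); first by rewrite gtrBl.
    rewrite in_itv/= => /andP[q1 q2].
    exists (true, q) => _; split=> // t at' tx; apply: lt_trans q1.
    by rewrite ltrBrDr addrC -ltrBrDr ltNge; apply/negP => h; apply: nr; exists t.
  have [nr|nr] := pselect (exists t, [/\ x < t, t < b & F t - F x <= e]).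
    by exfalso; apply: ne.
  have [|q] := @rat_in_itvoo R (F x) (F x + e); first by rewrite ltrDl.
  rewrite in_itv/= => /andP[q1 q2].
  exists (false, q) => _; split=> // t xt tb; apply: lt_trans q2 _.
  by rewrite -ltrBrDl ltNge; apply/negP => h; apply: nr; exists t.
apply/countable_injP; exists (pickle \o c) => x y /set_mem Jx /set_mem Jy /=.
move/(pcan_inj pickleK) => cxy.
wlog xy : x y Jx Jy cxy / x < y.
  by move=> H; have [/H|/H|//] := ltgtP x y; [exact|move=> h; apply/esym/h].
have := cP _ Jx; have := cP _ Jy; rewrite /code cxy.
move: Jx Jy => [/andP[ax xb] _] [/andP[ay yb] _].
case: (c y).1 => -[h1 h2] [h3 h4]; exfalso.
  by have := lt_trans h3 (h2 _ ax xy); rewrite ltxx.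
by have := lt_trans h1 (h4 _ xy yb); rewrite ltxx.
Qed.

End MonotoneContinuity.

Section WinningEvent.
Context {R : realType} {n : nat} {d : measure_display} {T : measurableType d}.
Notation mR := (measurableTypeR R).
Variables (P : probability T R) (Y : 'I_n.+2 -> {RV P >-> R}).

Let mY i : measurable_fun setT (Y i : T -> mR). Proof. exact: (@measurable_funPT _ _ _ _ (Y i)). Qed.

Lemma le_Z1 w i : i != ord0 -> Y i w <= Z1 Y w.
Proof. by move=> i0; apply: (le_bigmax_cond _ (fun i => Y i w)). Qed.

Lemma Z1_attained w : exists2 k, k != ord0 & Z1 Y w = Y k w.
Proof.
rewrite /Z1; apply: (big_ind (fun v => exists2 k, k != ord0 & v = Y k w)).
- by exists (lift ord0 ord0).
- by move=> x y [k k0 ->] [j j0 ->]; rewrite maxElt; case: ifP => _; [exists j|exists k].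
- by move=> i i0; exists i.
Qed.

Lemma Z1_lt w b : Z1 Y w < b <-> forall i, i != ord0 -> Y i w < b.
Proof.
split=> [zb i i0|h]; first exact: le_lt_trans (le_Z1 w i0) zb.
by have [k k0 ->] := Z1_attained w; exact: h.
Qed.

Lemma measurable_Z1 : measurable_fun setT (Z1 Y : T -> mR).
Proof.
rewrite /Z1; elim: (index_enum _) => [|i s IH].
  rewrite [X in measurable_fun _ X](_ : _ = (Y (lift ord0 ord0) : T -> mR)); first exact: mY.
  by apply/funext => w; rewrite big_nil.
case: (boolP (i != ord0)) => i0.
  rewrite [X in measurable_fun _ X](_ : _ = fun w => Num.max (Y i w)
      (\big[Num.max/Y (lift ord0 ord0) w]_(i <- s | i != ord0) Y i w)).
    by apply: measurable_maxr => //; exact: mY.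
  by apply/funext => w; rewrite big_cons i0.
rewrite [X in measurable_fun _ X](_ : _ = fun w =>
    (\big[Num.max/Y (lift ord0 ord0) w]_(i <- s | i != ord0) Y i w))//.
by apply/funext => w; rewrite big_cons (negbTE i0).
Qed.

Lemma measurable_win : measurable (win Y).
Proof.
have mtrue : measurable [set true] by [].
by have := measurable_fun_ltr measurable_Z1 (mY ord0) measurableT mtrue; rewrite setTI.
Qed.

Lemma negligible_countable (i : 'I_n.+2) (A : set R) :
  (forall c, P [set w | Y i w = c] = 0%E) -> countable A -> P.-negligible [set w | A (Y i w)].
Proof.
move=> Y0 /countable_injP[c cinj].
apply: (@negligibleS _ _ _ _ (\bigcup_m [set w | A (Y i w) /\ c (Y i w) = m])).
  by move=> w Aw; exists (c (Y i w)).
apply: negligible_bigcup => m.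
have [[x [Ax cx]]|nx] := pselect (exists x, A x /\ c x = m).
  apply: (@negligibleS _ _ _ _ [set w | Y i w = x]).
    move=> w [Aw cw]; apply: cinj; rewrite ?inE//; first by rewrite cw.
  apply/negligibleP; last exact: Y0.
  have mx : measurable ([set x] : set mR) by exact: measurable_set1.
  by have := mY i measurableT mx; rewrite setTI.
rewrite (_ : [set w | _] = set0); first exact: negligible_set0.
by rewrite -subset0 => w Aw; apply: nx; exists (Y i w).
Qed.

End WinningEvent.

(** * Winning cells and grid sums *)

Section Cells.
Context {R : realType} {n : nat} {d : measure_display} {T : measurableType d}.
Notation mR := (measurableTypeR R).
Variables (P : probability T R) (X Y : 'I_n.+2 -> {RV P >-> R}) (I : set R).
Hypothesis hI : is_interval I.
Hypothesis hYI : forall i w, I (Y i w).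
Hypothesis Y_atomless : forall i c, P [set w | Y i w = c] = 0%E.
Variables (a0 a1 : R) (p0 p1 : R -> R).
Hypotheses (a0_ge0 : 0 <= a0) (a01 : a0 <= a1) (a1_lt1 : a1 < 1).
Hypothesis p10 : forall z, I z -> p1 z <= p0 z.
Hypothesis p0_mono : forall z z', I z -> I z' -> z <= z' -> p0 z <= p0 z'.
Hypothesis p1_mono : forall z z', I z -> I z' -> z <= z' -> p1 z <= p1 z'.
Hypothesis gap_box : forall z a b, I z -> box_in I a b -> lower_bound_box z a b ->
  ((p0 z - p1 z)%:E * P (signal_cell Y a b) <=
   \int[P]_(w in signal_cell Y a b) (share_gap a0 a1 (p0 z) (p1 z) (X ord0 w))%:E)%E.

Let mX i : measurable_fun setT (X i : T -> mR). Proof. exact: (@measurable_funPT _ _ _ _ (X i)). Qed.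
Let mY i : measurable_fun setT (Y i : T -> mR). Proof. exact: (@measurable_funPT _ _ _ _ (Y i)). Qed.

Let Z := Z1 Y.
Let Z_in w : I (Z w). Proof. by have [k _] := Z1_attained Y w; rewrite /Z => ->. Qed.

(** The level [b] separates Z_1 from Y_1, which ensures a win; [e] and [c] keep the underlying boxes
    of signals bounded inside [I]. *)
Definition winning_cell (e a b c : R) : set T :=
  [set w | [/\ forall i, i != ord0 -> e <= Y i w, a <= Z w < b & b <= Y ord0 w < c]].

(** The cell is split by the first competitor [k] whose signal reaches [a]: those before stay below
    [a], those after only below [b]. The pieces are disjoint boxes, each with a competitor at or
    above [a], as dominance over the slices at [a] requires. *)
Definition cell_lower (e a b : R) (k i : 'I_n.+2) : R :=
  if i == ord0 then b else if i == k then a else e.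

Definition cell_upper (a b c : R) (k i : 'I_n.+2) : R :=
  if i == ord0 then c else if (i < k)%N then a else b.

Definition nonzero_indices : seq 'I_n.+2 := [seq k <- enum 'I_n.+2 | k != ord0].

Let idxP k : (k \in nonzero_indices) = (k != ord0).
Proof. by rewrite mem_filter mem_enum andbT. Qed.

Lemma winning_cellE e a b c : e <= a -> a <= b -> winning_cell e a b c =
  \big[setU/set0]_(k <- nonzero_indices) signal_cell Y (cell_lower e a b k) (cell_upper a b c k).
Proof.
move=> ea ab; rewrite -bigcup_seq; apply/seteqP; split=> w /=.
  move=> [eY /andP[aZ Zb] bY].
  have [j j0 Zj] := Z1_attained Y w.
  have jP : (j != ord0) && (a <= Y j w) by rewrite j0 -Zj.
  case: (@arg_minnP _ j (fun i : 'I_n.+2 => (i != ord0) && (a <= Y i w)) val jP) => k /andP[k0 aYk] kmin.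
  exists k => /=; first by rewrite idxP.
  have Yb i : i != ord0 -> Y i w < b by move/(Z1_lt Y w b).1: Zb; apply.
  move=> i; rewrite /cell_lower /cell_upper; case: eqVneq => [->//|i0].
  case: eqVneq => [->|ik]; first by rewrite ltnn aYk Yb.
  case: ltnP => ik'; last by rewrite eY// Yb.
  rewrite eY//= ltNge; apply/negP => aYi.
  by have := kmin i; rewrite i0 aYi => /(_ isT); rewrite leqNgt ik'.
move=> [k /=]; rewrite idxP => k0 h.
have hk := h k; rewrite /cell_lower /cell_upper (negbTE k0) eqxx ltnn in hk.
have h' i : i != ord0 -> e <= Y i w < b.
  move=> i0; have := h i; rewrite /cell_lower /cell_upper (negbTE i0).
  case: eqVneq => [->|ik]; first by rewrite ltnn => /andP[aY ->]; rewrite (le_trans ea).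
  by case: ifP => // _ /andP[-> ya]; rewrite (lt_le_trans ya).
split.
- by move=> i /h' /andP[].
- rewrite (le_trans _ (le_Z1 Y w k0)); last by case/andP: hk.
  by apply/(Z1_lt Y w b) => i /h' /andP[].
- by have := h ord0; rewrite /cell_lower /cell_upper eqxx.
Qed.

Lemma winning_cell_disjoint e a b c : trivIset [set` nonzero_indices]
  (fun k => signal_cell Y (cell_lower e a b k) (cell_upper a b c k)).
Proof.
move=> k j /=; rewrite !idxP => k0 j0 [w []] /=.
wlog kj : k j k0 j0 / (k <= j)%N.
  by move=> H hk hj; have [/H|/ltnW/H] := leqP k j; [exact|move=> h; exact/esym/h].
move=> hk hj; apply/val_inj/eqP; rewrite eqn_leq kj leqNgt; apply/negP => kltj.
have := hk k; have := hj k; rewrite /cell_lower /cell_upper (negbTE k0) eqxx ltnn kltj.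
by move=> /andP[_ ya] /andP[ay _]; have := lt_le_trans ya ay; rewrite ltxx.
Qed.

Lemma measurable_winning_cell e a b c : e <= a -> a <= b -> measurable (winning_cell e a b c).
Proof.
move=> ea ab; rewrite winning_cellE//; apply: bigsetU_measurable => k _.
exact: measurable_signal_cell.
Qed.

Lemma winning_cell_win e a b c : winning_cell e a b c `<=` win Y.
Proof. by move=> w [_ /andP[_ Zb] /andP[bY _]]; exact: lt_le_trans Zb bY. Qed.

Let gap z w := share_gap a0 a1 (p0 z) (p1 z) (X ord0 w).

Lemma gap_ge0 z w : I z -> 0 <= gap z w.
Proof. by move=> Iz; apply: share_gap_ge0 => //; exact: p10. Qed.

Lemma measurable_gap z : I z -> measurable_fun setT (gap z : T -> mR).
Proof.
move=> Iz; apply: (measurableT_comp (f := share_gap a0 a1 (p0 z) (p1 z) : mR -> mR)) => //.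
by apply: nondecreasing_measurable => //; apply: share_gap_le => //; exact: p10.
Qed.

Lemma gap_winning_cell e a b c : I e -> I c -> e < a -> a < b -> b < c ->
  (\int[P]_(w in winning_cell e a b c) (p0 a - p1 a)%:E <=
   \int[P]_(w in winning_cell e a b c) (gap a w)%:E)%E.
Proof.
move=> Ie Ic ea ab bc.
have Ia : I a by apply: (hI Ie Ic); rewrite (ltW ea) (ltW (lt_trans ab bc)).
have Ib : I b by apply: (hI Ie Ic); rewrite (ltW bc) (ltW (lt_trans ea ab)).
have mc k := measurable_signal_cell Y (cell_lower e a b k) (cell_upper a b c k).
have un : uniq nonzero_indices by rewrite filter_uniq// enum_uniq.
rewrite (@winning_cellE e a b c (ltW ea) (ltW ab)) !ge0_integral_bigsetU//; last 5 first.
- exact: winning_cell_disjoint.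
- by apply: measurable_funTS; apply/measurable_EFinP; exact: measurable_gap.
- by move=> w _; rewrite lee_fin gap_ge0.
- exact: winning_cell_disjoint.
- by move=> w _; rewrite lee_fin subr_ge0 p10.
rewrite big_seq [leRHS]big_seq; apply: lee_sum => k; rewrite idxP => k0.
rewrite integral_cst//; apply: gap_box => //.
- move=> i; split.
  + by rewrite /cell_lower; case: ifP => // _; case: ifP.
  + by rewrite /cell_upper; case: ifP => // _; case: ifP.
  + rewrite /cell_lower /cell_upper; case: ifP => _; first exact: ltW.
    case: eqVneq => [->|_]; first by rewrite ltnn ltW.
    by case: ifP => _; rewrite ltW// (lt_trans ea).
- split.
  + move=> i; rewrite /cell_lower /cell_upper; case: ifP => // _.
    case: eqVneq => [->|_]; first by rewrite ltnn.
    by case: ifP => _ //; rewrite (lt_trans ea).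
  + move=> i; rewrite /cell_upper; case: ifP => _; first by rewrite (ltW (lt_trans ab bc)).
    by case: ifP => // _; exact: ltW.
  + by rewrite /cell_lower eqxx ltW.
  + by exists k => //; rewrite /cell_lower (negbTE k0) eqxx.
Qed.

Definition payment_gain w : R :=
  p1 (Z w) + a1 * pos_part (X ord0 w - p1 (Z w)) - (p0 (Z w) + a0 * pos_part (X ord0 w - p0 (Z w))).

Hypothesis gain_int : P.-integrable (win Y) (EFin \o payment_gain).
Hypothesis price_int : P.-integrable (win Y) (fun w => (p0 (Z w))%:E).

(** Replacing the prices at z by those at Z_1 >= z raises the payment under [a1], since a price
    increase costs at most the same amount in profit share. Under [a0] the profit share only falls,
    and the price itself leaves the error p0 (Z w) - p0 z. *)
Lemma gap_le_gain z w : I z -> z <= Z w ->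
  gap z w - (p0 z - p1 z) <= payment_gain w + (p0 (Z w) - p0 z).
Proof.
move=> Iz zZ; rewrite /gap /share_gap /payment_gain.
have h0 := p0_mono Iz (Z_in w) zZ; have h1 := p1_mono Iz (Z_in w) zZ.
have q0 : pos_part (X ord0 w - p0 (Z w)) <= pos_part (X ord0 w - p0 z).
  by apply: pos_part_le; rewrite lerD2l lerN2.
have q1 : pos_part (X ord0 w - p1 z) - pos_part (X ord0 w - p1 (Z w)) <= p1 (Z w) - p1 z.
  apply: le_trans (pos_part_lip _) _; first by rewrite lerD2l lerN2.
  by lra.
have q1' : 0 <= pos_part (X ord0 w - p1 z) - pos_part (X ord0 w - p1 (Z w)).
  by rewrite subr_ge0; apply: pos_part_le; rewrite lerD2l lerN2.
have r0 := ler_wpM2l a0_ge0 q0.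
have r1 : a1 * (pos_part (X ord0 w - p1 z) - pos_part (X ord0 w - p1 (Z w))) <= p1 (Z w) - p1 z.
  by apply: le_trans q1; rewrite ler_piMl// ltW.
move: r1; rewrite mulrBr; lra.
Qed.

Lemma gain_winning_cell e a b c : I e -> I c -> e < a -> a < b -> b < c ->
  (0 <= \int[P]_(w in winning_cell e a b c) (payment_gain w + (p0 (Z w) - p0 a))%:E)%E.
Proof.
move=> Ie Ic ea ab bc.
have Ia : I a by apply: (hI Ie Ic); rewrite (ltW ea) (ltW (lt_trans ab bc)).
set C := winning_cell e a b c.
have mC : measurable C by apply: measurable_winning_cell; exact: ltW.
have Cw : C `<=` win Y by exact: winning_cell_win.
have mwin := measurable_win Y.
have i1 := integrableS mwin mC Cw gain_int.
have i2 := integrableS mwin mC Cw price_int.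
have ic (k : R) : P.-integrable C (fun=> k%:E) by exact: finite_measure_integrable_cst.
have i3 : P.-integrable C (fun w => (payment_gain w + (p0 (Z w) - p0 a))%:E).
  have := integrableD mC i1 (integrableB mC i2 (ic (p0 a))).
  by apply: eq_integrable.
(* Added back so that the integrand dominates the nonnegative gap; its integral cancels at the
   end. *)
set dlt := p0 a - p1 a.
have i4 : P.-integrable C (fun w => (payment_gain w + (p0 (Z w) - p0 a) + dlt)%:E).
  by have := integrableD mC i3 (ic dlt); apply: eq_integrable.
have le1 := gap_winning_cell Ie Ic ea ab bc; rewrite -/C -/dlt in le1.
have le2 : (\int[P]_(w in C) (gap a w)%:E <=
    \int[P]_(w in C) (payment_gain w + (p0 (Z w) - p0 a) + dlt)%:E)%E.
  apply: ge0_le_integral => //.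
  - by move=> w _; rewrite lee_fin gap_ge0.
  - by apply: measurable_funTS; apply/measurable_EFinP; exact: measurable_gap.
  - by case/integrableP: i4.
  - move=> w [_ /andP[aZ _] _]; rewrite lee_fin -lerBlDr; exact: gap_le_gain.
have := le_trans le1 le2.
rewrite (_ : \int[P]_(w in C) (payment_gain w + (p0 (Z w) - p0 a) + dlt)%:E =
    \int[P]_(w in C) (payment_gain w + (p0 (Z w) - p0 a))%:E + \int[P]_(w in C) dlt%:E)%E; last first.
  by rewrite -(integralD mC i3 (ic dlt)).
have fc := integrable_fin_num mC (ic dlt).
by rewrite -(fineK fc) -(fineK (integrable_fin_num mC i3)) -EFinD !lee_fin lerDr.
Qed.


(** Contains all winning cells of the grids on [e, c]; on the winning event, finer grids eventually
    reach each of its points. *)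
Definition winning_region (e c : R) : set T :=
  [set w | [/\ e < Z w, Y ord0 w < c & forall i, i != ord0 -> e <= Y i w]].

Lemma winning_cell_region e a b c : e < a -> winning_cell e a b c `<=` winning_region e c.
Proof. by move=> ea w [eY /andP[aZ _] /andP[_ Yc]]; split=> //; exact: lt_le_trans ea aZ. Qed.

Section Grid.
Variables e c : R.
Hypotheses (Ie : I e) (Ic : I c) (ec : e < c).

(** There are m + 3 steps while the cells use only the nodes 1 to m + 2: thus every cell starts
    strictly above [e] and ends strictly below [c]. *)
Let grid m j := e + j%:R * ((c - e) / m.+3%:R).
Let cell m (i : 'I_m.+1) := winning_cell e (grid m i.+1) (grid m i.+2) c.
Let G m (i : 'I_m.+1) w := payment_gain w + (p0 (Z w) - p0 (grid m i.+1)).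
Let approx m w := \sum_(i < m.+1) \1_(cell i) w * G i w.

Let step_gt0 m : 0 < (c - e) / m.+3%:R :> R. Proof. by rewrite divr_gt0 ?subr_gt0// ltr0n. Qed.

Let grid_lt m j k : (j < k)%N -> grid m j < grid m k.
Proof. by move=> jk; rewrite ltrD2l ltr_pM2r// ltr_nat. Qed.

Let grid0 m j : (0 < j)%N -> e < grid m j.
Proof. by move=> j0; rewrite ltrDl mulr_gt0// ltr0n. Qed.

Let grid_end m : grid m m.+3 = c.
Proof. by rewrite /grid mulrCA divff ?pnatr_eq0// mulr1 addrC subrK. Qed.

Let grid_c m (i : 'I_m.+1) : grid m i.+2 < c.
Proof. by rewrite -[ltRHS](grid_end m); apply: grid_lt; rewrite !ltnS -ltnS ltn_ord. Qed.

Let grid_in m (i : 'I_m.+1) : I (grid m i.+1).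
Proof. by apply: (hI Ie Ic); rewrite ltW ?grid0//= ltW// (lt_trans _ (grid_c i))// grid_lt. Qed.

Let mcell m (i : 'I_m.+1) : measurable (cell i).
Proof. by apply: measurable_winning_cell; rewrite ltW ?grid0// grid_lt. Qed.

Let cell_unique m (i j : 'I_m.+1) w : cell i w -> cell j w -> i = j.
Proof.
wlog ij : i j / (i <= j)%N.
  by move=> H hi hj; have [/H|/ltnW/H] := leqP i j; [exact|move=> h; exact/esym/h].
move=> [_ /andP[_ Zi] _] [_ /andP[jZ _] _]; apply/val_inj/eqP; rewrite eqn_leq ij leqNgt.
apply/negP => iltj; have := le_lt_trans jZ Zi; rewrite ltNge => /negP; apply.
have [->//|ne] := eqVneq i.+2 j.+1; apply/ltW/grid_lt.
by rewrite ltn_neqAle ne ltnS.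
Qed.

Let approx_in m (i : 'I_m.+1) w : cell i w -> approx m w = G i w.
Proof.
move=> iw; rewrite /approx (bigD1 i)//= indicE mem_set// mul1r big1 ?addr0// => j ji.
rewrite indicE memNset ?mul0r// => jw.
by move: ji; rewrite (cell_unique jw iw) eqxx.
Qed.

Let approx_out m w : (forall i : 'I_m.+1, ~ cell i w) -> approx m w = 0.
Proof. by move=> h; rewrite /approx big1// => i _; rewrite indicE memNset ?mul0r. Qed.

Let approx_bound m w : `|approx m w| <= `|payment_gain w| + (p0 c - p0 e).
Proof.
have p0ec : p0 e <= p0 c by apply: p0_mono => //; exact: ltW.
have [[i iw]|ni] := pselect (exists i : 'I_m.+1, cell i w); last first.
  rewrite approx_out ?normr0; last by move=> i iw; apply: ni; exists i.
  by apply: addr_ge0 => //; rewrite subr_ge0.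
rewrite (approx_in iw); apply: le_trans (ler_normD _ _) _; rewrite lerD2l.
have [_ /andP[iZ Zi] _] := iw.
have q1 : p0 (grid m i.+1) <= p0 (Z w) by exact: p0_mono.
have q2 : p0 (Z w) <= p0 c by apply: p0_mono => //; rewrite ltW// (lt_trans Zi).
have q3 : p0 e <= p0 (grid m i.+1) by apply: p0_mono => //; rewrite ltW ?grid0.
by rewrite ger0_norm ?subr_ge0// lerB.
Qed.

Let approx_cvg w : win Y w -> (e < Z w < c -> approachable p0 e c (Z w)) ->
  approx m w @[m --> \oo] --> payment_gain w * \1_(winning_region e c) w.
Proof.
move=> ww app; have [rw|nr] := pselect (winning_region e c w); last first.
  rewrite indicE memNset// mulr0 (_ : approx ^~ w = fun=> 0); first exact: cvg_cst.
  apply/funext => m; apply: approx_out => i iw; apply: nr.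
  by apply: winning_cell_region iw; exact: grid0.
rewrite indicE mem_set// mulr1; have [eZ Yc eY] := rw.
have ZY : Z w < Y ord0 w by [].
have {}app : approachable p0 e c (Z w) by apply: app; rewrite eZ (lt_trans ZY).
apply/cvgrPdist_le => eps eps0; have [[t [et tZ tle]] _] := app _ eps0.
(* A mesh of at most [eta] makes the node before Z_1 a positive one, keeps the node after Z_1 below
   Y_1, and puts the left end of the cell beyond [t], where [p0] is within [eps] of its value at
   Z_1. *)
pose eta := Num.min (Z w - t) (Num.min (Y ord0 w - Z w) (Z w - e)).
have eta0 : 0 < eta by rewrite !lt_min !subr_gt0 tZ ZY eZ.
exists (Num.truncn ((c - e) / eta)) => // m /= mbig.
set h := (c - e) / m.+3%:R.
have hm : h <= eta.
  rewrite /h ler_pdivrMr ?ltr0n// mulrC -ler_pdivrMr//.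
  rewrite (le_trans (ltW (truncnS_gt _)))// ler_nat.
  by rewrite (leq_ltn_trans mbig)// ltnS ltnW.
have [h1 [h2 h3]] : h <= Z w - t /\ h <= Y ord0 w - Z w /\ h <= Z w - e.
  by move: hm; rewrite /eta !le_min => /andP[-> /andP[-> ->]].
have h0 : 0 < h by exact: step_gt0.
(* Node [k] is the last one at or below Z_1. Cells start at node 1, so the cell containing [w] has
   index k - 1. *)
have /andP[k1 k2] := truncn_itv (ltW (divr_gt0 (lt_le_trans h0 h3) h0)).
set k := Num.truncn _ in k1 k2.
rewrite ler_pdivlMr// in k1; rewrite ltr_pdivrMr// in k2.
have kZ : grid m k <= Z w by rewrite /grid -/h; lra.
have Zk : Z w < grid m k.+1 by rewrite /grid -/h; lra.
have kpos : (0 < k)%N.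
  rewrite lt0n; apply/eqP => k0; move: Zk; rewrite k0 /grid -/h mul1r; lra.
have kY : grid m k.+1 <= Y ord0 w.
  have -> : grid m k.+1 = grid m k + h by rewrite /grid -/h -[k.+1]addn1 natrD mulrDl mul1r addrA.
  by lra.
have km : (k.-1 < m.+1)%N.
  suff : (k.+1 < m.+3)%N by rewrite prednK// !ltnS.
  rewrite -(ltr_nat R) -(ltr_pM2r h0) -(ltrD2l e).
  rewrite -[X in X < _]/(grid m k.+1) -[X in _ < X]/(grid m m.+3) grid_end.
  exact: le_lt_trans kY Yc.
have kE : k.-1.+1 = k by rewrite prednK.
have iw : cell (Ordinal km) w.
  rewrite /cell /= kE; split=> //; first by rewrite kZ.
  by rewrite kY.
rewrite (approx_in iw) /G /= kE opprD addNKr normrN ger0_norm.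
  apply: le_trans tle; rewrite lerD2l lerN2; apply: p0_mono => //.
  - by apply: (hI Ie Ic); rewrite (ltW et) ltW// (lt_trans tZ)// (lt_trans ZY).
  - by have := grid_in (Ordinal km); rewrite /= kE.
  - have -> : grid m k = grid m k.+1 - h by rewrite /grid -/h -[k.+1]addn1 natrD mulrDl mul1r; lra.
    lra.
rewrite subr_ge0; apply: p0_mono => //.
by have := grid_in (Ordinal km); rewrite /= kE.
Qed.

Let mwin := measurable_win Y.

Let integrable_G m (i : 'I_m.+1) : P.-integrable (win Y) (EFin \o G i).
Proof.
have := integrableD mwin gain_int (integrableB mwin price_int
  (finite_measure_integrable_cst P (p0 (grid m i.+1)) mwin)).
by apply: eq_integrable.
Qed.

Let integral_cell m (i : 'I_m.+1) :
  (\int[P]_(w in win Y) (\1_(cell i) w * G i w)%:E = \int[P]_(w in cell i) (G i w)%:E)%E.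
Proof.
have Cw : cell i `<=` win Y by exact: winning_cell_win.
rewrite -[in RHS](setIidr Cw) integral_mkcondr; apply: eq_integral => w _.
rewrite patchE indicE; case: ifPn => _; first by rewrite mul1r.
by rewrite mul0r.
Qed.

Let integrable_cell m (i : 'I_m.+1) :
  P.-integrable (win Y) (fun w => (\1_(cell i) w * G i w)%:E).
Proof.
apply: le_integrable (integrable_G i) => //.
  apply/measurable_EFinP; apply: measurable_funM.
    by apply: measurable_funTS; apply: measurable_indic; exact: mcell.
  by apply/measurable_EFinP; case/integrableP: (integrable_G i).
move=> w _ /=; rewrite lee_fin normrM ler_piMl// indicE.
by case: (_ \in _); rewrite ?normr1 ?normr0.
Qed.

Let integral_approx m : (0 <= \int[P]_(w in win Y) (approx m w)%:E)%E.
Proof.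
rewrite /approx.
rewrite (_ : \int[P]_(w in win Y) _ =
    \sum_(i < m.+1) \int[P]_(w in win Y) (\1_(cell i) w * G i w)%:E)%E.
  apply: sume_ge0 => i _; rewrite integral_cell.
  apply: gain_winning_cell; [exact: Ie|exact: Ic|exact: grid0|exact: grid_lt|exact: grid_c].
rewrite -integral_sum//.
by apply: eq_integral => w _; rewrite sumEFin.
Qed.

Lemma measurable_winning_region : measurable (winning_region e c).
Proof.
rewrite (_ : winning_region e c = (Z @^-1` `]e, +oo[ `&` Y ord0 @^-1` `]-oo, c[) `&`
   \bigcap_(i in [set i | i != ord0]) (Y i @^-1` `[e, +oo[)).
  apply: measurableI; first apply: measurableI.
  - rewrite -[X in measurable X]setTI; apply: measurable_Z1 => //; exact: measurable_itv.
  - rewrite -[X in measurable X]setTI; apply: mY => //; exact: measurable_itv.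
  - apply: fin_bigcap_measurable => [|i _]; first exact: finite_finset.
    rewrite -[X in measurable X]setTI; by apply: mY => //; exact: measurable_itv.
apply/seteqP; split=> w /=.
  move=> [eZ Yc eY]; rewrite !in_itv/= eZ Yc; split=> // i /eY.
  by rewrite /= in_itv/= andbT.
rewrite !in_itv/= andbT => -[[eZ Yc] eY]; split=> // i /eY.
by rewrite /= in_itv/= andbT.
Qed.

Lemma gain_region :
  (0 <= \int[P]_(w in win Y) (payment_gain w * \1_(winning_region e c) w)%:E)%E.
Proof.
have mg : measurable_fun (win Y) payment_gain.
  by apply/measurable_EFinP; case/integrableP: gain_int.
have ibound : P.-integrable (win Y) (fun w => (`|payment_gain w| + (p0 c - p0 e))%:E).
  have := integrableD mwin (integrable_norm gain_int)
    (finite_measure_integrable_cst P (p0 c - p0 e) mwin).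
  by apply: eq_integrable.
pose J := [set z | e < z < c /\ ~ approachable p0 e c z].
(* Z_1 equals one of finitely many atomless signals, so it almost surely avoids the countable set of
   jumps. *)
have J0 : P.-negligible [set w | J (Z w)].
  apply: (@negligibleS _ _ _ _ (\bigcup_m [set w | exists i : 'I_n.+2, val i = m /\ J (Y i w)])).
    move=> w Jw; have [k _ Zk] := Z1_attained Y w; exists (val k) => //=; exists k.
    by split=> //; rewrite -Zk.
  apply: negligible_bigcup => m.
  have [mn|nm] := ltnP m n.+2; last first.
    rewrite (_ : [set w | _] = set0); first exact: negligible_set0.
    by rewrite -subset0 => w [i [im _]]; move: nm; rewrite -im leqNgt ltn_ord.
  apply: (@negligibleS _ _ _ _ [set w | J (Y (Ordinal mn) w)]).
    by move=> w [i [im Jw]]; rewrite /= (_ : Ordinal mn = i)//; exact/val_inj.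
  apply: negligible_countable; first exact: Y_atomless.
  apply: countable_not_approachable => x y ex xy yc; apply: p0_mono => //.
    by apply: (hI Ie Ic); rewrite (ltW ex) ltW// (le_lt_trans xy).
  by apply: (hI Ie Ic); rewrite (ltW yc) ltW// (lt_le_trans ex).
have mapprox m : measurable_fun (win Y) (fun w => (approx m w)%:E).
  apply/measurable_EFinP; rewrite /approx; apply: measurable_sum => i; apply/measurable_EFinP.
  by case/integrableP: (integrable_cell i).
have mlim : measurable_fun (win Y) (fun w => (payment_gain w * \1_(winning_region e c) w)%:E).
  apply/measurable_EFinP; apply: measurable_funM => //.
  by apply: measurable_funTS; apply: measurable_indic; exact: measurable_winning_region.
have aecvg : \forall w \ae P, win Y w ->
    (approx m w)%:E @[m --> \oo] --> (payment_gain w * \1_(winning_region e c) w)%:E.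
  have [B [mB B0 sB]] := J0; exists B; split=> // w /= nw; apply: sB => /=.
  have napp : ~ (e < Z w < c -> approachable p0 e c (Z w)).
    by move=> app; apply: nw => ww; apply/cvg_EFin; [exact: nearW|exact: approx_cvg].
  by split; [apply: contrapT => nZ; apply: napp|move=> app; apply: napp].
have aebound : \forall w \ae P, forall m, win Y w ->
    (`|(approx m w)%:E| <= (`|payment_gain w| + (p0 c - p0 e))%:E)%E.
  by apply: aeW => w m ww; rewrite lee_fin; exact: approx_bound.
have [_ _ cv] := dominated_convergence mwin mapprox mlim aecvg ibound aebound.
by apply: (cvge_ge _ cv); apply: nearW => m; exact: integral_approx.
Qed.

End Grid.

(** The regions over an increasing sequence of intervals [a_m, b_m] in [I] exhaust the winning event
    up to a null set, and the gain itself dominates. *)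
Lemma gain_win : (exists x y, [/\ I x, I y & x < y]) ->
  (0 <= \int[P]_(w in win Y) (payment_gain w)%:E)%E.
Proof.
move=> [x [y [Ix Iy xy]]]; have mwin := measurable_win Y.
have [|a_ [Ia nia coa]] := @coinitial_seq R [set t | I t /\ t <= x]; first by exists x.
have [|b_ [Ib ndb cob]] := @cofinal_seq R [set t | I t /\ y <= t]; first by exists y.
have ab m : a_ m < b_ m.
  by apply: (le_lt_trans (Ia m).2); apply: lt_le_trans xy _; exact: (Ib m).2.
have coaI t : I t -> exists m, a_ m <= t.
  move=> It; have [tx|xt] := leP t x; first exact: coa.
  by exists 0%N; apply: le_trans (Ia 0%N).2 (ltW xt).
have cobI t : I t -> exists m, t <= b_ m.
  move=> It; have [yt|ty] := leP y t; first exact: cob.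
  by exists 0%N; apply: le_trans (ltW ty) (Ib 0%N).2.
have mg : measurable_fun (win Y) payment_gain.
  by apply/measurable_EFinP; case/integrableP: gain_int.
(* The endpoints belonging to [I], at most two, told apart by being a minimum or not. Off this null
   set every signal is eventually strictly inside the intervals. *)
pose A := [set t | I t /\ ((forall s, I s -> t <= s) \/ (forall s, I s -> s <= t))].
have cA : countable A.
  apply/countable_injP; exists (fun t => `[< forall s, I s -> t <= s >] : nat).
  move=> t t' /set_mem[It ht] /set_mem[It' ht'].
  have [lt|nlt] := asboolP (forall s, I s -> t <= s);
    have [lt'|nlt'] := asboolP (forall s, I s -> t' <= s) => // _.
    by apply/eqP; rewrite eq_le lt// lt'.
  by case: ht => // gt; case: ht' => // gt'; apply/eqP; rewrite eq_le gt'// gt.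
have Y0 i : P.-negligible [set w | A (Y i w)] by apply: negligible_countable.
have [B [mB B0 sB]] : P.-negligible [set w | exists i, A (Y i w)].
  apply: (@negligibleS _ _ _ _ (\bigcup_m [set w | exists i : 'I_n.+2, val i = m /\ A (Y i w)])).
    by move=> w [i Aw]; exists (val i) => //=; exists i.
  apply: negligible_bigcup => m.
  have [mn|nm] := ltnP m n.+2; last first.
    rewrite (_ : [set w | _] = set0); first exact: negligible_set0.
    by rewrite -subset0 => w [i [im _]]; move: nm; rewrite -im leqNgt ltn_ord.
  apply: (@negligibleS _ _ _ _ [set w | A (Y (Ordinal mn) w)]) => //.
  by move=> w [i [im Jw]]; rewrite /= (_ : Ordinal mn = i)//; exact/val_inj.
have mf m : measurable_fun (win Y)
    (fun w => (payment_gain w * \1_(winning_region (a_ m) (b_ m)) w)%:E).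
  apply/measurable_EFinP; apply: measurable_funM => //.
  by apply: measurable_funTS; apply: measurable_indic; exact: measurable_winning_region.
have mlim : measurable_fun (win Y) (fun w => (payment_gain w)%:E) by exact/measurable_EFinP.
have aecvg : \forall w \ae P, win Y w ->
    (payment_gain w * \1_(winning_region (a_ m) (b_ m)) w)%:E @[m --> \oo] --> (payment_gain w)%:E.
  exists B; split=> // w /= nw; apply: sB => /=; apply: contrapT => nA; apply: nw => ww.
  have nAi i : ~ A (Y i w) by move=> h; apply: nA; exists i.
  have lowY i : exists m, a_ m < Y i w.
    have [t [It tY]] : exists t, I t /\ t < Y i w.
      apply: contrapT => h; apply: (nAi i); split=> //; left=> s Is.
      by rewrite leNgt; apply/negP => sY; apply: h; exists s.
    by have [m am] := coaI t It; exists m; exact: le_lt_trans tY.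
  have [k k0 Zk] := Z1_attained Y w.
  have /choice[g gP] := lowY.
  have [t [It tY]] : exists t, I t /\ Y ord0 w < t.
    apply: contrapT => h; apply: (nAi ord0); split=> //; right=> s Is.
    by rewrite leNgt; apply/negP => sY; apply: h; exists s.
  have [m0 bm] := cobI t It.
  apply: cvg_near_cst; exists (maxn m0 (\max_i g i)) => // m /=; rewrite geq_max => /andP[m0m gm].
  rewrite indicE mem_set ?mulr1//; split.
  + rewrite /Z Zk; apply: le_lt_trans (gP k); apply: nia; apply: leq_trans gm.
    exact: leq_bigmax.
  + by apply: lt_le_trans tY _; apply: le_trans bm _; exact: ndb.
  + move=> i _; apply: ltW; apply: le_lt_trans (gP i); apply: nia; apply: leq_trans gm.
    exact: leq_bigmax.
have aebound : \forall w \ae P, forall m, win Y w ->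
    (`|(payment_gain w * \1_(winning_region (a_ m) (b_ m)) w)%:E| <= `|(payment_gain w)%:E|)%E.
  apply: aeW => w m ww; rewrite lee_fin normrM ler_piMr// indicE.
  by case: (_ \in _); rewrite ?normr1 ?normr0.
have [_ _ cv] := dominated_convergence mwin mf mlim aecvg (integrable_abse gain_int) aebound.
apply: (cvge_ge _ cv); apply: nearW => m.
by apply: gain_region => //; [case: (Ia m)|case: (Ib m)].
Qed.

End Cells.

(** * Revenues *)

Section Revenue.
Context {R : realType} {n : nat} {d : measure_display} {T : measurableType d}.
Notation mR := (measurableTypeR R).
Variables (P : probability T R) (X Y : 'I_n.+2 -> {RV P >-> R}) (I : set R).
Variables (s : R -> R -> R -> R) (revealed : R -> Prop).
Hypothesis hI : is_interval I.
Hypothesis hYI : forall i w, I (Y i w).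
Hypothesis Y_atomless : forall i c, P [set w | Y i w = c] = 0%E.
Hypothesis cell_gt0 : forall a b, (forall i, a i < b i) -> box_in I a b ->
  (0 < P (signal_cell Y a b))%E.
Hypothesis s_share_le : forall a a' z, 0 <= a -> a <= a' -> a' < 1 -> I z -> s a' z z <= s a z z.
Hypothesis s_share_eq : forall a a' z, 0 <= a -> a < a' -> a' < 1 -> I z ->
  s a' z z = s a z z -> revealed z.
Hypothesis s_mono : forall a z z', 0 <= a < 1 -> I z -> I z' -> z <= z' -> s a z z <= s a z' z'.
Hypothesis s0_gt0 : forall z, I z -> 0 < s 0 z z.
Hypothesis gap_box : forall a a' z l r, 0 <= a -> a < a' -> a' < 1 -> I z ->
  box_in I l r -> lower_bound_box z l r ->
  ((s a z z - s a' z z)%:E * P (signal_cell Y l r) <=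
   \int[P]_(w in signal_cell Y l r) (share_gap a a' (s a z z) (s a' z z) (X ord0 w))%:E)%E.
Hypothesis unbounded_gain : forall a e z c c', 0 <= a < 1 -> I e -> I z -> I c -> I c' ->
  e < z -> z < c -> c < c' ->
  (forall t, s a z z < t -> exists b, [/\ I b, z < b &
     P (X ord0 @^-1` `]t, +oo[%classic `&`
        signal_cell Y (top_lower c z (lift ord0 ord0) e) (top_upper c' b)) = 0%E]) -> False.
Hypothesis price_int : forall a, 0 <= a < 1 -> P.-integrable (win Y) (EFin \o price Y s a).
Hypothesis share_int : forall a, 0 <= a < 1 -> P.-integrable (win Y) (EFin \o share X Y s a).

Let mX i : measurable_fun setT (X i : T -> mR). Proof. exact: (@measurable_funPT _ _ _ _ (X i)). Qed.

Let Z_in w : I (Z1 Y w). Proof. by have [k _ ->] := Z1_attained Y w. Qed.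

(** If [I] had a single point, it would be an atom of each signal. *)
Lemma signal_interval_nontrivial : exists x y, [/\ I x, I y & x < y].
Proof.
apply: contrapT => nxy.
have [w0 _] : exists w0 : T, setT w0.
  apply: contrapT => h; have := @probability_setT _ _ _ P.
  rewrite (_ : setT = set0) ?measure0; last by rewrite -subset0 => w _; apply: h; exists w.
  by move=> /eqP; rewrite eq_sym onee_eq0.
have := Y_atomless ord0 (Y ord0 w0); rewrite (_ : [set w | _] = setT).
  by rewrite probability_setT => /eqP; rewrite onee_eq0.
apply/seteqP; split=> // w _ /=; apply/eqP; rewrite eq_le !leNgt; apply/andP; split;
  by apply/negP => lt; apply: nxy; do 2 eexists; split; [| |exact: lt].
Qed.

Lemma win_gt0 : (0 < P (win Y))%E.
Proof.
have [x [y [Ix Iy xy]]] := signal_interval_nontrivial.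
pose m := (x + y) / 2; have xm : x < m by rewrite /m; lra.
have my : m < y by rewrite /m; lra.
have Im : I m by apply: (hI Ix Iy); rewrite !ltW.
pose l (i : 'I_n.+2) := if i == ord0 then m else x.
pose r (i : 'I_n.+2) := if i == ord0 then y else m.
have lr i : l i < r i by rewrite /l /r; case: ifP.
have Ilr : box_in I l r.
  by move=> i; split; [rewrite /l; case: ifP|rewrite /r; case: ifP|exact: ltW].
apply: lt_le_trans (cell_gt0 lr Ilr) _; apply: le_measure; rewrite ?inE.
- exact: measurable_signal_cell.
- exact: measurable_win.
move=> w h; rewrite /win/=; have := h ord0; rewrite /l /r eqxx => /andP[my' _].
apply: lt_le_trans my'; apply/Z1_lt => i i0.
by have := h i; rewrite /r (negbTE i0) => /andP[].
Qed.

Let win_fin : P (win Y) \is a fin_num.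
Proof. by rewrite fin_num_measure//; exact: measurable_win. Qed.

Let fine_win_gt0 : 0 < fine (P (win Y)).
Proof. by rewrite fine_gt0// win_gt0 ltey_eq win_fin. Qed.

Lemma mean_if_winB g g' : P.-integrable (win Y) (EFin \o g) ->
  P.-integrable (win Y) (EFin \o g') ->
  mean_if_win Y g' - mean_if_win Y g = mean_if_win Y (fun w => g' w - g w).
Proof.
move=> ig ig'; have mwin := measurable_win Y.
rewrite /mean_if_win -mulrBl -fineB; [|exact: integrable_fin_num..].
by congr (fine _ / _); rewrite -integralB_EFin.
Qed.

Lemma mean_if_win_ge0 g : (0 <= \int[P]_(w in win Y) (g w)%:E)%E -> 0 <= mean_if_win Y g.
Proof. by move=> g0; rewrite divr_ge0// fine_ge0. Qed.

Lemma mean_if_win_lt g g' : P.-integrable (win Y) (EFin \o g) ->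
  P.-integrable (win Y) (EFin \o g') -> (forall w, win Y w -> g w <= g' w) ->
  ~ {ae P, forall w, win Y w -> g w = g' w} -> mean_if_win Y g < mean_if_win Y g'.
Proof.
move=> ig ig' gg' nae; have mwin := measurable_win Y.
rewrite -subr_gt0 mean_if_winB//.
have id : P.-integrable (win Y) (fun w => (g' w - g w)%:E).
  by have := integrableB mwin ig' ig; apply: eq_integrable.
have d0 w : win Y w -> (0 <= (g' w - g w)%:E)%E by move=> ww; rewrite lee_fin subr_ge0 gg'.
rewrite /mean_if_win divr_gt0// lt_neqAle fine_ge0 ?integral_ge0// andbT.
apply/negP => /eqP E; have := congr1 EFin (esym E).
rewrite fineK; last exact: integrable_fin_num.
move=> int0; apply: nae.
have : ae_eq P (win Y) (fun w => (g' w - g w)%:E) (cst 0%E).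
  apply/ae_eq_integral_abs => //; first by case/integrableP: id.
  by rewrite -[RHS]int0; apply: eq_integral => w /set_mem ww; rewrite gee0_abs// d0.
move=> ae; apply: filterS ae => w h ww; have /= [] := h ww.
by move/eqP; rewrite subr_eq0 => /eqP.
Qed.

Lemma mean_if_win_le g g' : P.-integrable (win Y) (EFin \o g) ->
  P.-integrable (win Y) (EFin \o g') -> (forall w, win Y w -> g w <= g' w) ->
  mean_if_win Y g <= mean_if_win Y g'.
Proof.
move=> ig ig' gg'; rewrite -subr_ge0 mean_if_winB//; apply: mean_if_win_ge0.
by apply: integral_ge0 => w ww; rewrite lee_fin subr_ge0 gg'.
Qed.

Lemma win_not_negligible : ~ {ae P, forall w, ~ win Y w}.
Proof.
move=> [B [mB B0 sB]]; have := win_gt0; rewrite ltNge => /negP; apply.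
rewrite -B0; apply: le_measure; rewrite ?inE//; first exact: measurable_win.
by move=> w ww; apply: sB => /=; exact.
Qed.

Lemma auction_revenue_le a a' : 0 <= a -> a < a' -> a' < 1 ->
  auction_revenue Y s a' <= auction_revenue Y s a.
Proof.
move=> a0 aa' a'1; apply: mean_if_win_le => [||w _].
- by apply: price_int; rewrite (le_trans a0 (ltW aa')).
- by apply: price_int; rewrite a0 (lt_trans aa').
- by apply: s_share_le => //; exact: ltW.
Qed.

Lemma auction_revenue_lt a a' : ~ {ae P, forall w, win Y w -> revealed (Z1 Y w)} ->
  0 <= a -> a < a' -> a' < 1 -> auction_revenue Y s a' < auction_revenue Y s a.
Proof.
move=> nr a0 aa' a'1; apply: mean_if_win_lt => [||w _|].
- by apply: price_int; rewrite (le_trans a0 (ltW aa')).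
- by apply: price_int; rewrite a0 (lt_trans aa').
- by apply: s_share_le => //; exact: ltW.
apply: contra_not nr; apply: filterS => w h ww.
exact: (s_share_eq a0 aa' a'1 (Z_in w) (h ww)).
Qed.

(* If the winner never gained then near a continuity point z of the bid function the
   value would be bounded by the bid at z, uniformly in the winner's own signal. *)
Lemma winner_may_gain a : 0 <= a < 1 ->
  ~ {ae P, forall w, win Y w -> X ord0 w <= price Y s a w}.
Proof.
move=> a01 [B [mB B0 sB]].
have [x [y [Ix Iy xy]]] := signal_interval_nontrivial.
have Ibetween t : x < t < y -> I t by move=> /andP[xt ty]; apply: (hI Ix Iy); rewrite !ltW.
pose J := [set t | x < t < y /\ ~ approachable (fun z => s a z z) x y t].
have cJ : countable J.
  apply: countable_not_approachable => t t' xt tt' t'y; apply: s_mono => //.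
    by apply: Ibetween; rewrite xt (le_lt_trans tt').
  by apply: Ibetween; rewrite (lt_le_trans xt).
(* The jumps are countable, hence Lebesgue null, and cannot fill the interval from x to y. *)
have [z [zxy app]] : exists z, x < z < y /\ approachable (fun z => s a z z) x y z.
  apply: contrapT => h; have /countable_lebesgue_measure0 : countable (`]x, y[%classic : set R).
    apply: sub_countable cJ; apply: subset_card_le => t /=; rewrite in_itv/= => txy; split=> // app.
    by apply: h; exists t.
  rewrite lebesgue_measure_itv/= lte_fin xy -EFinB => /eqP.
  by rewrite eqe subr_eq0 gt_eqF.
have [xz zy] := andP zxy.
pose c := (z + y) / 2; have zc : z < c by rewrite /c; lra.
have cy : c < y by rewrite /c; lra.
have Ic : I c by apply: Ibetween; rewrite (lt_trans xz).
have Iz := Ibetween z zxy.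
apply: (@unbounded_gain a x z c y) => // t vt.
have tv : 0 < t - s a z z by rewrite subr_gt0.
have [_ [b [zb b_y sb]]] := app _ tv.
have Ib : I b by apply: Ibetween; rewrite (lt_trans xz).
(* Capping at [c] forces Z_1 < c <= Y_1 on the cell, so that it lies inside the winning event. *)
exists (Num.min b c); split; first by rewrite /Num.min; case: ifP.
  by rewrite lt_min zb.
have Im : I (Num.min b c) by rewrite /Num.min; case: ifP.
have st : s a (Num.min b c) (Num.min b c) <= t.
  apply: (@le_trans _ _ (s a b b)); first by apply: s_mono => //; rewrite ge_min lexx.
  by rewrite -(lerD2r (- s a z z)).
apply/eqP; rewrite eq_le measure_ge0 andbT -B0; apply: le_measure; rewrite ?inE//.
  apply: measurableI; last exact: measurable_signal_cell.
  by rewrite -[X in measurable X]setTI; apply: mX => //; exact: measurable_itv.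
move=> w [/=]; rewrite in_itv/= andbT => tX h; apply: sB => /= le.
have Zm : Z1 Y w < Num.min b c.
  apply/Z1_lt => i i0; have := h i; rewrite /top_upper (negbTE i0).
  by move=> /andP[].
have ww : win Y w.
  rewrite /win/=; apply: lt_le_trans Zm _.
  have := h ord0; rewrite /top_lower eqxx => /andP[cY _].
  by rewrite ge_min cY orbT.
have := le ww; rewrite leNgt => /negP; apply; apply: le_lt_trans tX; apply: le_trans st.
by apply: s_mono => //; exact: ltW.
Qed.

(** A larger share also lowers the price, so the second payment never falls; it rises strictly
    wherever the value exceeds the price, which has positive probability among wins. *)
Lemma posc_revenue_lt a a' : 0 <= a -> a < a' -> a' < 1 ->
  posc_revenue X Y s a < posc_revenue X Y s a'.
Proof.
move=> a0 aa' a'1.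
have a01 : 0 <= a < 1 by rewrite a0 (lt_trans aa').
have a'01 : 0 <= a' < 1 by rewrite (le_trans a0 (ltW aa')).
have sle w : s a' (Z1 Y w) (Z1 Y w) <= s a (Z1 Y w) (Z1 Y w) by apply: s_share_le => //; exact: ltW.
apply: mean_if_win_lt => [||w _|].
- exact: share_int.
- exact: share_int.
- by rewrite -subr_ge0; apply: share_gap_ge0 a0 (ltW aa') (sle w) _.
move=> ae; apply: (winner_may_gain a01); apply: filterS ae => w h ww.
rewrite leNgt; apply/negP => pX; have := h ww; rewrite /share /price => E.
have p0 : 0 < pos_part (X ord0 w - s a (Z1 Y w) (Z1 Y w)).
  by rewrite /pos_part lt_max subr_gt0 pX orbT.
have : a * pos_part (X ord0 w - s a (Z1 Y w) (Z1 Y w)) <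
    a' * pos_part (X ord0 w - s a' (Z1 Y w) (Z1 Y w)).
  apply: (@lt_le_trans _ _ (a' * pos_part (X ord0 w - s a (Z1 Y w) (Z1 Y w)))).
    by rewrite ltr_pM2r.
  by rewrite ler_wpM2l ?(le_trans a0 (ltW aa'))//; apply: pos_part_le; rewrite lerD2l lerN2.
by rewrite E ltxx.
Qed.

Lemma posc_revenue_gt0 a : 0 < a < 1 -> 0 < posc_revenue X Y s a.
Proof.
move=> /andP[a0 a1]; apply: le_lt_trans (posc_revenue_lt (lexx 0) a0 a1).
by apply: mean_if_win_ge0; apply: integral_ge0 => w _; rewrite lee_fin /share mul0r.
Qed.

Let total_int a : 0 <= a < 1 ->
  P.-integrable (win Y) (EFin \o (fun w => price Y s a w + share X Y s a w)).
Proof.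
move=> a01; have := integrableD (measurable_win Y) (price_int a01) (share_int a01).
by apply: eq_integrable => //; exact: measurable_win.
Qed.

Lemma total_revenue_le a a' : 0 <= a -> a < a' -> a' < 1 ->
  total_revenue X Y s a <= total_revenue X Y s a'.
Proof.
move=> a0 aa' a'1.
have a01 : 0 <= a < 1 by rewrite a0 (lt_trans aa').
have a'01 : 0 <= a' < 1 by rewrite (le_trans a0 (ltW aa')).
rewrite -subr_ge0 /total_revenue mean_if_winB; [|exact: total_int..].
apply: mean_if_win_ge0.
apply: (@gain_win _ _ _ _ P X Y I hI hYI Y_atomless a a' (fun z => s a z z) (fun z => s a' z z)
  a0 (ltW aa') a'1).
- by move=> z Iz; apply: s_share_le => //; exact: ltW.
- by move=> z z'; exact: s_mono.
- by move=> z z'; exact: s_mono.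
- by move=> z l r; exact: gap_box.
- by have := integrableB (measurable_win Y) (total_int a'01) (total_int a01);
    apply: eq_integrable => //; exact: measurable_win.
- exact: price_int.
- exact: signal_interval_nontrivial.
Qed.

Lemma total_revenue0_gt0 : 0 < total_revenue X Y s 0.
Proof.
have c01 : 0 <= (0 : R) < 1 by rewrite lexx ltr01.
have p0 w : 0 < price Y s 0 w + share X Y s 0 w.
  by rewrite /share mul0r addr0; exact: s0_gt0.
apply: (@le_lt_trans _ _ (mean_if_win Y (fun=> 0))).
  by apply: mean_if_win_ge0; rewrite integral0_eq.
apply: mean_if_win_lt => [||w _|].
- exact: integrable0.
- exact: total_int.
- exact: ltW.
move=> ae; apply: win_not_negligible; apply: filterS ae => w h /h E.
by have := p0 w; rewrite -E ltxx.
Qed.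

End Revenue.

Section Equilibrium.
Context {R : realType} {n : nat} {d : measure_display} {T : measurableType d}.
Notation mR := (measurableTypeR R).
Variables (P : probability T R) (Y : 'I_n.+2 -> {RV P >-> R}) (I : set R).
Variables (f : n.+2.-tuple R -> R) (Q : R.-pker (n.+2.-tuple mR) ~> mR).
Variable u : R -> R.
Hypothesis hI : is_interval I.
Hypothesis hf : is_joint_density Y f.
Hypothesis hfpos : forall y : n.+2.-tuple R, (forall i, I (tnth y i)) -> 0 < f y.
Hypothesis hu_incr : {homo u : x y / x < y}.
Hypothesis hu_int : forall y : n.+2.-tuple R, (forall i, I (tnth y i)) ->
  (Q y).-integrable setT (EFin \o u).
Hypothesis hu_pos : forall y : n.+2.-tuple R, (forall i, I (tnth y i)) ->
  (0 < \int[Q y]_x (u x)%:E)%E.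

(** Positive expected utility given each signal vector passes to the slice law, a mixture of these
    conditional laws. Finiteness of the negative part keeps the strict inequality. *)
Lemma signal_utility_gt0 z : I z ->
  (signal_law I f Q z z (fun x => Num.max (- u x)%R 0%R) < +oo)%E ->
  (signal_law I f Q z z (fun x => Num.max (- u x)%R 0%R) <
   signal_law I f Q z z (fun x => Num.max (u x) 0%R))%E.
Proof.
move=> Iz fin.
have mu : measurable_fun setT (u : mR -> mR).
  by apply: nondecreasing_measurable => //; exact/ltW_homo.
have mN : measurable_fun setT ((fun x => Num.max (- u x) 0) : mR -> mR).
  by apply: measurable_maxr => //; exact: measurableT_comp.
have mP : measurable_fun setT ((fun x => Num.max (u x) 0) : mR -> mR).
  exact: measurable_maxr.
apply: (signal_law_lt hI hf hfpos Iz mN mP) fin => [x|x|y Iy].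
- by rewrite le_max lexx orbT.
- by rewrite le_max lexx orbT.
have iu := hu_int Iy; have up := hu_pos Iy.
have := integrable_neg_fin_num measurableT iu; move: up; rewrite integralE.
rewrite (_ : (\int[Q y]_x _^\+ x)%E = (\int[Q y]_x (Num.max (u x) 0%R)%:E)%E); last first.
  by apply: eq_integral => x _; rewrite funeposE/= -EFin_max.
rewrite (_ : (\int[Q y]_x _^\- x)%E = (\int[Q y]_x (Num.max (- u x)%R 0%R)%:E)%E); last first.
  by apply: eq_integral => x _; rewrite funenegE/= -EFin_max.
by move=> up fin; rewrite -sube_gt0.
Qed.

End Equilibrium.

Theorem proposition1 (R : realType) (n : nat)
  (d : measure_display) (T : measurableType d) (P : probability T R)
  (X Y : 'I_n.+2 -> {RV P >-> R}) (I : set R)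
  (f : n.+2.-tuple R -> R)
  (Q : R.-pker (n.+2.-tuple (measurableTypeR R)) ~> (measurableTypeR R))
  (u : R -> R) (s : R -> R -> R -> R)
  (hsym : symmetric_model X Y)
  (hI : is_interval I)
  (hYI : forall i w, I (Y i w))
  (hf : is_joint_density Y f)
  (hfpos : forall y : n.+2.-tuple R, (forall i, I (tnth y i)) -> 0 < f y)
  (hQ : is_cond_law X Y Q)
  (hdep : positive_dependence I f Q)
  (hu_concave : concave u)
  (hu_incr : {homo u : x y / x < y})
  (hu0 : u 0 = 0)
  (hu_int : forall y : n.+2.-tuple R, (forall i, I (tnth y i)) ->
     (Q y).-integrable setT (EFin \o u))
  (hu_pos : forall y : n.+2.-tuple R, (forall i, I (tnth y i)) ->
     (0 < \int[Q y]_x (u x)%:E)%E)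
  (hgain_exists : forall alpha b y1 z1 : R, 0 <= alpha < 1 -> I y1 -> I z1 ->
     cond_mean_exists (signal_law I f Q y1 z1) (fun x => u (net_gain alpha b x)))
  (hs : is_bid_function I f Q u s)
  (hprice_int : forall alpha : R, 0 <= alpha < 1 ->
     P.-integrable (win Y) (EFin \o price Y s alpha))
  (hshare_int : forall alpha : R, 0 <= alpha < 1 ->
     P.-integrable (win Y) (EFin \o share X Y s alpha)) :
  (* (i) *)
  ((forall alpha alpha' : R, 0 <= alpha -> alpha < alpha' -> alpha' < 1 ->
      auction_revenue Y s alpha' <= auction_revenue Y s alpha) /\
   (~ {ae P, forall w, win Y w -> value_revealed I f Q (Z1 Y w)} ->
    forall alpha alpha' : R, 0 <= alpha -> alpha < alpha' -> alpha' < 1 ->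
      auction_revenue Y s alpha' < auction_revenue Y s alpha) /\
   (forall alpha : R, 0 < alpha < 1 -> 0 < posc_revenue X Y s alpha) /\
   (forall alpha alpha' : R, 0 <= alpha -> alpha < alpha' -> alpha' < 1 ->
      posc_revenue X Y s alpha < posc_revenue X Y s alpha')) /\
  (* (ii) *)
  ((forall alpha alpha' : R, 0 <= alpha -> alpha < alpha' -> alpha' < 1 ->
      total_revenue X Y s alpha <= total_revenue X Y s alpha' /\
      0 < total_revenue X Y s alpha) /\
   (forall alpha : R, 0 <= alpha < 1 ->
      total_revenue X Y s 0 <= total_revenue X Y s alpha)).
Proof.
have gain0 z : I z -> cond_mean_exists (signal_law I f Q z z) u.
  move=> Iz; have := @hgain_exists 0 0 z z _ Iz Iz; rewrite lexx ltr01 => /(_ isT).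
  rewrite (_ : (fun x => u (net_gain 0 0 x)) = u)//.
  by apply/funext => x; rewrite /net_gain mul0r !subr0.
have hfin y z : I y -> I z -> (signal_law I f Q y z (fun=> 1%R) < +oo)%E.
  by move=> Iy Iz; have [|//] := @hgain_exists 0 0 y z _ Iy Iz; rewrite lexx ltr01.
have [mu [muE mu_mass mu_mono mu_cell]] := signal_measures hsym hI hf hfpos hQ hdep hfin.
have gain_exists a b z : 0 <= a < 1 -> I z ->
    cond_mean_exists (signal_law I f Q z z) (fun x => u (net_gain a b x)).
  by move=> a01 Iz; exact: hgain_exists.
have bid a z : 0 <= a < 1 -> I z -> forall b,
    cond_mean (signal_law I f Q z z) (fun x => u (net_gain a b x)) = 0 <-> b = s a z z.
  by move=> a01 Iz; exact: hs.
have mu_u : measurable_fun setT (u : measurableTypeR R -> measurableTypeR R).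
  by apply: nondecreasing_measurable => //; exact/ltW_homo.
have upos z : I z -> (signal_law I f Q z z (fun x => Num.max (- u x)%R 0%R) <
    signal_law I f Q z z (fun x => Num.max (u x) 0%R))%E.
  move=> Iz; apply: (signal_utility_gt0 hI hf hfpos hu_incr hu_int hu_pos Iz).
  have [_ _] := gain0 z Iz; apply: le_lt_trans.
  rewrite !muE//; last 3 first.
  - exact: measurableT_comp.
  - by apply: measurable_maxr => //; exact: measurableT_comp.
  - by move=> x; rewrite le_max lexx orbT.
  apply: ge0_le_integral => //.
  - by move=> x _; rewrite lee_fin le_max lexx orbT.
  - by apply/measurable_EFinP; apply: measurable_maxr => //; exact: measurableT_comp.
  - by apply/measurable_EFinP; exact: measurableT_comp.
  - by move=> x _; rewrite lee_fin ge_max normr_ge0 andbT -normrN ler_norm.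
have mass_fin z : I z -> mu z setT \is a fin_num.
  by move=> Iz; have [m0 moo] := mu_mass z Iz; rewrite ge0_fin_numE.
have atomless := prob_signal_eq hf hQ.
have cell_gt0 a b : (forall i, a i < b i) -> box_in I a b -> (0 < P (signal_cell Y a b))%E.
  move=> ab Iab; rewrite -(cell_law_mass hf hQ ab).
  by case: hf => mf f0 _; exact: (closed_box_gt0 Q hI mf f0 hfpos Iab).
pose p a z := s a z z.
have s_le a a' z := @bid_share_le _ I u _ mu p hu_incr muE mu_mass
  gain_exists bid a a' z.
have s_eq a a' z : 0 <= a -> a < a' -> a' < 1 -> I z -> s a' z z = s a z z ->
    value_revealed I f Q z.
  move=> a0 aa' a'1 Iz sE; exists (s a z z).
  exact: (@bid_share_eq_revealed _ I u _ mu p hu_incr hu0 muE mu_mass gain_exists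
    bid a a' z).
have s_mono a z z' := @bid_mono _ I u _ mu p hu_incr muE mu_mass
  gain_exists bid mu_mono a z z'.
have s0 z := @bid0_gt0 _ I u _ mu p hu_incr muE mu_mass
  gain_exists bid upos z.
have gap_box a a' z l r : 0 <= a -> a < a' -> a' < 1 -> I z ->
    box_in I l r -> lower_bound_box z l r ->
    ((s a z z - s a' z z)%:E * P (signal_cell Y l r) <=
     \int[P]_(w in signal_cell Y l r) (share_gap a a' (s a z z) (s a' z z) (X ord0 w))%:E)%E.
  move=> a0 aa' a'1 Iz Ilr zlr.
  have sle := s_le a a' z a0 (ltW aa') a'1 Iz.
  have [m0 moo] := mu_mass z Iz.
  have := @share_gap_mean _ I u _ mu p hu_concave hu_incr muE mu_mass
    gain_exists bid a a' z a0 aa' a'1 Iz.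
  move=> /(lee_wpmul2r (measure_ge0 P (signal_cell Y l r))) h1.
  have := mu_cell z l r (share_gap a a' (s a z z) (s a' z z)) Iz Ilr zlr
    (share_gap_le a0 (ltW aa') sle) (share_gap_ge0 a0 (ltW aa') sle).
  (* Both bounds carry the factor [mu z setT], which is finite and positive and cancels. *)
  move=> /(le_trans h1); rewrite muleAC lee_pmul2r//.
  exact: mass_fin.
have unbounded a e z c c' : 0 <= a < 1 -> I e -> I z -> I c -> I c' ->
    e < z -> z < c -> c < c' ->
    (forall t, s a z z < t -> exists b, [/\ I b, z < b &
       P (X ord0 @^-1` `]t, +oo[%classic `&`
          signal_cell Y (top_lower c z (lift ord0 ord0) e) (top_upper c' b)) = 0%E]) -> False.
  move=> a01 Ie Iz Ic Ic' ez zc cc' Pt.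
  (* Null tails on the cells pass down to the dominated law at z, so the value is almost surely at
     most the bid there. Zero expected utility then concentrates it at the bid, which positive
     dependence forbids. *)
  suff Sv : signal_law I f Q z z \1_(~` [set s a z z]) = 0%E.
    exact: (signal_law_not_concentrated hI hf hfpos hQ hdep hfin Iz Ic Ic' Ie ez zc cc' Sv Pt).
  apply: (@no_gain_revealed _ I u _ mu p hu_incr hu0 muE mu_mass gain_exists
    bid a z a01 Iz).
  have tail t : s a z z < t -> mu z (`]t, +oo[%classic) = 0%E.
    move=> /Pt[b [Ib zb Pb]].
    pose l := top_lower c z (lift ord0 ord0 : 'I_n.+2) e; pose r := @top_upper R n c' b.
    have lr i : l i < r i.
      rewrite /l /r /top_lower /top_upper; case: ifP => // _; case: ifP => // _; exact: lt_trans zb.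
    have Ilr : box_in I l r.
      move=> i; split; last exact: ltW.
      - by rewrite /l /top_lower; case: ifP => // _; case: ifP.
      - by rewrite /r /top_upper; case: ifP.
    have zlr : lower_bound_box z l r.
      split=> //.
      - move=> i; rewrite /r /top_upper; case: ifP => _; last exact: ltW.
        by rewrite ltW// (lt_trans zc).
      - by rewrite /l /top_lower eqxx ltW.
      - by exists (lift ord0 ord0) => //; rewrite /l /top_lower/=.
    have mt : measurable (`]t, +oo[%classic : set (measurableTypeR R)) by exact: measurable_itv.
    have ind_le : {homo (\1_(`]t, +oo[%classic) : R -> R) : x y / x <= y}.
      move=> x y xy; rewrite !indicE; case: (boolP (x \in _)) => [|_]; last by case: (_ \in _).
      rewrite inE/= in_itv/= andbT => tx.
      by rewrite mem_set//= in_itv/= andbT (lt_le_trans tx).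
    have ind_ge0 x : 0 <= \1_(`]t, +oo[%classic) x :> R by [].
    have := mu_cell z l r _ Iz Ilr zlr ind_le ind_ge0.
    rewrite integral_indic// setIT.
    rewrite (_ : (\int[P]_(w in _) _)%E = 0%E); last first.
      transitivity (\int[P]_(w in signal_cell Y l r)
          (\1_(X ord0 @^-1` `]t, +oo[%classic) w)%:E)%E => //.
      rewrite integral_indic//; [exact: measurable_signal_cell|].
      rewrite -[X in measurable X]setTI; apply: (@measurable_funPT _ _ _ _ (X ord0)) => //.
    rewrite mul0e => le0; apply/eqP; rewrite eq_le measure_ge0 andbT.
    by move: le0; rewrite pmule_lle0// cell_gt0.
  have [B [mB B0 sB]] : (mu z).-negligible (\bigcup_m `]s a z z + m.+1%:R^-1, +oo[%classic).
    apply: negligible_bigcup => m; exists (`]s a z z + m.+1%:R^-1, +oo[%classic).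
    by split; [exact: measurable_itv|apply: tail; rewrite ltrDl invr_gt0|].
  exists B; split=> // x /= /negP; rewrite -ltNge => /ltr_add_invr[k kx].
  by apply: sB; exists k => //=; rewrite in_itv/= kx.
have total_le := total_revenue_le hI hYI atomless s_le s_mono gap_box hprice_int hshare_int.
have total0 := total_revenue0_gt0 hI hYI atomless cell_gt0 s0 hprice_int hshare_int.
have total_ge a : 0 <= a < 1 -> total_revenue X Y s 0 <= total_revenue X Y s a.
  by move=> /andP[]; rewrite le_eqVlt => /predU1P[<-//|]; exact: total_le.
split; [split; [|split; [|split]]|split] => //.
- exact: (auction_revenue_le hYI s_le hprice_int).
- by move=> nr a a'; exact: (auction_revenue_lt hI hYI atomless cell_gt0 s_le s_eq hprice_int nr).
- exact: (posc_revenue_gt0 hI hYI atomless cell_gt0 s_le s_mono unbounded hshare_int).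
- exact: (posc_revenue_lt hI hYI atomless cell_gt0 s_le s_mono unbounded hshare_int).
- move=> a a' a0 aa' a'1; split; first exact: total_le.
  by apply: (lt_le_trans total0); apply: total_ge; rewrite a0 (lt_trans aa').
Qed.
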